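(* Let $\{X_t\}_{t\ge0}$ be a $d$-dimensional Feller process with generator $(A,D(A))$ such that $C_c^\infty(\mathbb{R}^d)\subset D(A)$ and such that on $C_c^\infty(\mathbb{R}^d)$, $Au(x)=-\int_{\mathbb{R}^d}e^{ix\cdot\xi}p(x,\xi)\hat u(\xi)\,d\xi$ with symbol $$p(x,\xi)=\tfrac12\,\xi\cdot a(x)\xi-ib(x)\cdot\xi+\int_{z\ne0}\big(1-e^{iz\cdot\xi}+iz\cdot\xi\,\mathbf{1}_{\{|z|\le1\}}\big)\,\nu(x,dz).$$ For $x\in\mathbb{R}^d$ and $r>0$ let $$H(x,r)=\sup_{y:|y-x|\le r}\Bigg\{\frac{2}{r^2}\bigg[\frac12\sum_{j=1}^da_{jj}(y)+(y-x)\cdot\Big(b(y)-\int_{\{r<|z|\le1\}}z\,\nu(y,dz)\Big)\bigg]+\frac1{r^2}\int_{\{|z|\le r\}}|z|^2\,\nu(y,dz)+\int_{\{|z|>r\}}\nu(y,dz)\Bigg\}$$ and $$h(x,r)=\inf_{y:|y-x|<r}\int_{\{z:|z|\ge3r\}}\nu(y,dz).$$ Then for any $x\in\mathbb{R}^d$, $0<r<1$ and $t>0$, $$\mathbb{P}^x(\tau_{B(x,r)}\le t)\le\frac{t\,H(x,r)}{1-e^{-1}}\qquad\text{and}\qquad\mathbb{P}^x(\tau_{B(x,r)}>t)\le\frac1{t\,h(x,r)}.$$ Moreover, $$\frac{c_1}{H(x,r)}\le\mathbb{E}^x\tau_{B(x,2r)}\le\frac{c_2}{h(x,3r)},$$ where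 $c_1$ and $c_2$ are some positive absolute constants.
   Context: A Feller process is a Markov process on $\mathbb{R}^d$ (càdlàg version) whose transition semigroup $T_tu(x)=\mathbb{E}^xu(X_t)$ is sub-Markovian, maps $C_\infty(\mathbb{R}^d)$ (continuous functions vanishing at infinity) into itself, and satisfies $\lim_{t\to0}\|T_tf-f\|_\infty=0$ for $f\in C_\infty(\mathbb{R}^d)$. Its generator is $Au=\lim_{t\to0}(T_tu-u)/t$ (sup-norm limit) on the set $D(A)\subset C_\infty(\mathbb{R}^d)$ where the limit exists. $\hat u(\xi)=(2\pi)^{-d}\int e^{-ix\cdot\xi}u(x)\,dx$. The symbol $p$ is locally bounded; for each $x$, $a(x)=(a_{jk}(x))$ is a nonnegative definite $d\times d$ matrix, $b(x)\in\mathbb{R}^d$, and $\nu(x,dz)$ is a (kernel of) measure(s) on $\mathbb{R}^d\setminus\{0\}$ with $\int(1\wedge|z|^2)\,\nu(x,dz)<\infty$. $B(x,r)$ is the open ball of radius $r$ centred at $x$, and $\tau_U=\inf\{t\ge0:X_t\notin U\}$ is the first exit time from $U$. Fractions with denominator $0$ are read as $+\infty$. *)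

(* Defs.v *)
From HB Require Import structures.
From mathcomp Require Import all_boot all_order all_algebra.
From mathcomp Require Import all_classical all_reals all_analysis measurable_realfun.
From mathcomp Require Import complex.

Set Implicit Arguments.
Unset Strict Implicit.
Unset Printing Implicit Defensive.
Import Order.TTheory GRing.Theory Num.Theory numFieldNormedType.Exports.

Local Open Scope classical_set_scope.
Local Open Scope ring_scope.
Local Open Scope complex_scope.

(* The space R^d is ['rV[R]_d].  The library norm on matrices is the sup norm;
   it induces the usual topology, but [|z|] has to be the Euclidean norm. *)
Definition dot (R : realType) (d : nat) (x y : 'rV[R]_d) : R :=
  \sum_(j < d) x 0 j * y 0 j.

Definition enorm (R : realType) (d : nat) (x : 'rV[R]_d) : R :=
  Num.sqrt (dot x x).

Definition eball (R : realType) (d : nat) (x : 'rV[R]_d) (r : R) :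
  set 'rV[R]_d := [set y | enorm (y - x) < r].

HB.instance Definition _ (R : realType) (d : nat) :=
  Measurable.copy 'rV[R]_d (g_sigma_algebraType (open : set (set 'rV[R]_d))).

Section borel_rV.
Context (R : realType).

Let ball_rV n (q : 'rV[R]_n) (e : R) : 0 < e ->
  ball q e = \bigcap_(j in [set: 'I_n]) [set x | ball (q 0 j) e (x 0 j)].
Proof.
move=> e0; apply/seteqP; split => x /=.
- by move=> [_ qx] j _ /=; exact: qx.
- by move=> qx; split=> // i j; rewrite (ord1 i); exact: qx.
Qed.

Let rat_approx n (x : 'rV[R]_n) (e : R) : 0 < e ->
  exists q : 'rV[rat]_n, ball (map_mx ratr q : 'rV[R]_n) e x.
Proof.
move=> e0.
have H (j : 'I_n) : exists q : rat, ball (ratr q : R) e (x 0 j).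
  have [] := @dense_rat R (ball (x 0 j) e).
  - by exists (x 0 j); exact: ballxx.
  - exact: ball_open.
  by move=> y [yx [q _ qy]]; exists q; rewrite qy; exact: ball_sym.
have [q hq] := choice H.
exists (\row_j q j); split => // i j; rewrite (ord1 i) !mxE.
exact: hq.
Qed.

Lemma measurable_fun_rV (dT : measure_display) (T : measurableType dT) n
    (g : T -> 'rV[R]_n) :
  (forall j, measurable_fun setT (fun t => g t 0 j)) -> measurable_fun setT g.
Proof.
move=> mg.
have mball (q : 'rV[R]_n) (e : R) : 0 < e -> measurable (g @^-1` ball q e).
  move=> e0; rewrite ball_rV// preimage_bigcap.
  apply: fin_bigcap_measurable => // j _.
  rewrite -[X in measurable X]setTI.
  by apply: (mg j) => //; exact: measurable_ball.
apply: (@measurability _ _ _ _ _ _ (@open 'rV[R]_n)) => //.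
move=> _ [U oU <-]; rewrite setTI.
pose F (p : 'rV[rat]_n * nat) : set T :=
  [set t | ball (map_mx ratr p.1 : 'rV[R]_n) p.2.+1%:R^-1 `<=` U] `&`
  g @^-1` ball (map_mx ratr p.1 : 'rV[R]_n) p.2.+1%:R^-1.
have -> : g @^-1` U = \bigcup_p F p.
  apply/seteqP; split => [t /= Ut|t [p _ [/= + /=]]]; last exact.
  have /nbhs_ballP[e /= e0 eU] : nbhs (g t) U by exact: open_nbhs_nbhs.
  have [k ke] : exists k : nat, k.+1%:R^-1 < e / 2.
    have e20 : 0 < e / 2 by rewrite divr_gt0.
    have [N _ /(_ N (leqnn N))] := near_infty_natSinv_lt (PosNum e20).
    by exists N.
  have k0 : 0 < k.+1%:R^-1 :> R by rewrite invr_gt0.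
  have [q hq] := rat_approx (g t) k0.
  exists (q, k) => //; split => //= y qy; apply: eU.
  rewrite (splitr e); apply: ball_triangle (le_ball (ltW ke) qy).
  exact/ball_sym/(le_ball (ltW ke)).
apply: countable_bigcupT_measurable => [|p]; first exact: countableP.
rewrite /F; have [pU|pU] := pselect
    (ball (map_mx ratr p.1 : 'rV[R]_n) p.2.+1%:R^-1 `<=` U).
- rewrite (_ : [set t | _] = setT) ?setTI; first exact: mball.
  by apply/seteqP; split.
- rewrite (_ : [set t | _] = set0) ?set0I//.
  by apply/seteqP; split.
Qed.

End borel_rV.

Lemma measurable_rV_coord (R : realType) (d : nat) (j : 'I_d) :
  measurable_fun setT (fun x : 'rV[R]_d => x 0 j).
Proof.
apply: (measurability _ (RGenOpens.measurableE R)) => _ [_ [a [b ->]] <-].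
rewrite setTI; apply: sub_sigma_algebra.
by apply: open_comp => [x _|]; [exact: coord_continuous|exact: interval_open].
Qed.

(* [rV_cons] identifies R^d x R with R^(d+1); it is used to transport the
   d-fold product of Lebesgue measure on R. *)
Definition rV_cons (R : realType) (d : nat) (p : 'rV[R]_d * measurableTypeR R) :
  'rV[R]_d.+1 := row_mx (p.2 : R)%:M p.1 : 'rV[R]_(1 + d).

Lemma measurable_rV_cons (R : realType) (d : nat) :
  measurable_fun setT (@rV_cons R d).
Proof.
apply: measurable_fun_rV => j; case: (unliftP ord0 j) => [i ->|->].
- rewrite (_ : (fun _ => _) = (fun x : 'rV[R]_d => x 0 i) \o fst).
    exact: measurableT_comp (measurable_rV_coord i) measurable_fst.
  apply/funext => p /=; rewrite /rV_cons.
  have -> : lift ord0 i = rshift 1 i :> 'I_(1 + d) by exact: val_inj.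
  exact: row_mxEr.
- rewrite (_ : (fun _ => _) = snd); first exact: measurable_snd.
  apply/funext => p; rewrite /rV_cons.
  have -> : ord0 = lshift d (ord0 : 'I_1) :> 'I_(1 + d) by exact: val_inj.
  by rewrite [LHS]row_mxEl !mxE eqxx mulr1n.
Qed.

Fixpoint lebesgue_rV (R : realType) (d : nat) :
    {measure set 'rV[R]_d -> \bar R} :=
  match d with
  | 0 => \d_(0 : 'rV[R]_0)
  | d'.+1 =>
    measure_function_pushforward__canonical__measure_function_Measure
     (lebesgue_rV R d' \x (@lebesgue_measure R))%E (@measurable_rV_cons R d')
  end.

(* The library only integrates (extended) real-valued functions. *)
Definition cintegral (R : realType) (dT : measure_display)
    (T : measurableType dT) (mu : {measure set T -> \bar R}) (D : set T)
    (f : T -> R[i]) : R[i] :=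
  (\int[mu]_(x in D) complex.Re (f x)) +i* (\int[mu]_(x in D) complex.Im (f x)).

Definition expi (R : realType) (t : R) : R[i] := cos t +i* sin t.

Section function_spaces.
Context (R : realType) (d : nat).
Implicit Types u f : 'rV[R]_d -> R.

Fixpoint Ck (k : nat) u : Prop :=
  continuous u /\
  match k with
  | 0 => True
  | k'.+1 => forall j : 'I_d,
      (forall x, derivable u x (delta_mx 0 j)) /\
      Ck k' (fun x => 'D_(delta_mx 0 j) u x)
  end.

Definition Cc_smooth u : Prop :=
  (forall k, Ck k u) /\ compact (closure [set x | u x != 0]).

Definition C_infty f : Prop :=
  continuous f /\
  forall e, 0 < e -> exists M : R, forall x, M < enorm x -> `|f x| < e.

Definition supnorm f : \bar R := ereal_sup (range (fun x => `|f x|%:E)).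

Definition fourier u (xi : 'rV[R]_d) : R[i] :=
  ((2 * pi) ^- d)%:C *
  cintegral (lebesgue_rV R d) setT (fun x => expi (- dot x xi) * (u x)%:C).

Definition pseudo_diff (p : 'rV[R]_d -> 'rV[R]_d -> R[i]) u (x : 'rV[R]_d) :
    R[i] :=
  - cintegral (lebesgue_rV R d) setT
      (fun xi => expi (dot x xi) * p x xi * fourier u xi).

End function_spaces.

Section feller.
Context (R : realType) (d : nat) (dO : measure_display)
  (Omega : measurableType dO).
(* The semigroup may be strictly sub-Markovian, so the paths live in the
   one-point compactification of R^d: [None] is the cemetery, and functions on
   R^d are extended to it by 0.  The index [t] of [X t] ranges over [0, +oo[,
   the values at negative times are irrelevant. *)
Variable P : 'rV[R]_d -> probability Omega R.
Variable X : R -> Omega -> one_point_compactification 'rV[R]_d.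

Definition event_in (t : R) (B : set 'rV[R]_d) : set Omega :=
  X t @^-1` (Some @` B).

Definition past (t : R) : set (set Omega) :=
  <<s [set A | exists s B, [/\ 0 <= s, s <= t, measurable B & A = event_in s B]] >>.

Definition semigroup (t : R) (u : 'rV[R]_d -> R) (x : 'rV[R]_d) : R :=
  \int[P x]_w oapp u 0 (X t w).

Record markov_process : Prop := {
  mp_measurable : forall t B, 0 <= t -> measurable B ->
    measurable (event_in t B) ;
  mp_start : forall x, P x (event_in 0 [set x]) = 1%E ;
  mp_kernel : forall t B, 0 <= t -> measurable B ->
    measurable_fun setT (fun x => P x (event_in t B)) ;
  mp_markov : forall x s t F B, 0 <= s -> 0 <= t -> past s F -> measurable B ->
    P x (F `&` event_in (s + t) B) =
    (\int[P x]_(w in F) oapp (fun y => P y (event_in t B)) 0 (X s w))%E ;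
  mp_right_continuous : forall w t, 0 <= t -> X s w @[s --> t^'+] --> X t w ;
  mp_left_limits : forall w t, 0 < t ->
    exists l : one_point_compactification 'rV[R]_d, X s w @[s --> t^'-] --> l
}.

Record feller_process : Prop := {
  feller_markov : markov_process ;
  feller_C_infty : forall t f, 0 <= t -> C_infty f -> C_infty (semigroup t f) ;
  feller_continuous : forall f, C_infty f ->
    supnorm (semigroup t f \- f) @[t --> 0^'+] --> 0%E
}.

(* [is_generator u Au] states that [u] is in the domain D(A), with image [Au]. *)
Definition is_generator (u Au : 'rV[R]_d -> R) : Prop :=
  [/\ C_infty u, C_infty Au &
      supnorm (fun x => t^-1 * (semigroup t u x - u x) - Au x) @[t --> 0^'+]
        --> 0%E].

Definition generator_domain (u : 'rV[R]_d -> R) : Prop :=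
  exists Au, is_generator u Au.

(* The exit time, with inf set0 = +oo; being in the cemetery is being
   outside [U]. *)
Definition exit_time (U : set 'rV[R]_d) (w : Omega) : \bar R :=
  ereal_inf [set t%:E | t in [set t : R | 0 <= t /\ ~ event_in t U w]].

(* The events [exit_time U <= t] are measurable only for the completed
   sigma-algebra, whereas a library measure is unspecified outside its own
   sigma-algebra: [P x] is replaced by its completion. *)
Definition completed_law (x : 'rV[R]_d) :
    {measure set (caratheodory_type (P x)^*%mu) -> \bar R} :=
  @completed_measure_extension _ Omega R (P x).

End feller.
Arguments completed_law {R d dO Omega} P x.

Section symbol.
Context (R : realType) (d : nat).
Variables (a : 'rV[R]_d -> 'M[R]_d) (b : 'rV[R]_d -> 'rV[R]_d).
(* [nu x] is a measure on R^d \ {0}, i.e., a measure on R^d without mass at 0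
   (see [levy_kernel]). *)
Variable nu : R.-ker 'rV[R]_d ~> 'rV[R]_d.

Definition diffusion_matrix : Prop :=
  forall x, (a x)^T = a x /\ forall xi : 'rV[R]_d, 0 <= dot xi (xi *m (a x)^T).

Definition levy_kernel : Prop :=
  forall x, nu x [set 0] = 0%E /\
    (\int[nu x]_z (Num.min 1 (enorm z ^+ 2))%:E < +oo)%E.

(* Vectors are rows, so that a(x)xi is [xi *m (a x)^T]. *)
Definition symbol (x xi : 'rV[R]_d) : R[i] :=
  (2^-1 * dot xi (xi *m (a x)^T))%:C - (0 +i* dot (b x) xi)
  + cintegral (nu x) (~` [set 0]) (fun z =>
      1 - expi (dot z xi) + (0 +i* (dot z xi * (enorm z <= 1)%R%:R))).

Definition locally_bounded (p : 'rV[R]_d -> 'rV[R]_d -> R[i]) : Prop :=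
  forall x xi : 'rV[R]_d, exists C : R, \forall q \near (x, xi), `|p q.1 q.2| <= C%:C.

Definition jump_mean (y : 'rV[R]_d) (r : R) : 'rV[R]_d :=
  \row_j \int[nu y]_(z in [set z | r < enorm z <= 1]) z 0 j.

Definition H_fun (x : 'rV[R]_d) (r : R) : \bar R :=
  ereal_sup [set
    ((2 / r ^+ 2 * (2^-1 * (\sum_(j < d) a y j j)
                    + dot (y - x) (b y - jump_mean y r)))%:E
     + (r ^- 2)%:E * \int[nu y]_(z in [set z | enorm z <= r]%R) (enorm z ^+ 2)%:E
     + nu y [set z | r < enorm z]%R)%E
    | y in [set y | enorm (y - x) <= r]].

Definition h_fun (x : 'rV[R]_d) (r : R) : \bar R :=
  ereal_inf [set nu y [set z | 3 * r <= enorm z] | y in [set y | enorm (y - x) < r]].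

End symbol.

(* Main.v *)
(** For [u] in C_c^oo the formula for [Au] turns into an integro-differential operator: with real
    cosine and sine transforms, decay comes from integration by parts and inversion from a Poisson
    kernel regularisation.  Two test functions are used.  A cutoff that is 1 on B(x,r) and 0 off
    B(x,2r) satisfies [Au <= - nu(y, |z| >= 3r)] on B(x,r), because it is maximal there and a jump
    larger than 3r leaves its support.  The truncated Gaussian [u = exp(- |y-x|^2 / r^2)]
    satisfies [Au >= - u H(x,r)] on the closed ball, because of [exp(- s) - 1 >= - s].

    Stopping times are avoided by observing the process at the times [j delta] only.  If [F_j] is
    the event that [X] is in [U] at the times [0, delta, .., j delta], the Markov property and
    [T_delta u = u + delta (Au + o(1))], uniformly in space, make [E(u(X_(j delta)); F_j]) a
    telescoping sequence.  The cutoff bounds [sum_j delta P(F_j)], which dominates the mean exit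
    time; the Gaussian bounds [1 - P(F_n)], and right-continuity along dyadic [delta] turns this
    into a bound on the probability of an early exit, whence also the lower bound on the mean. *)
Require Import Defs.
From HB Require Import structures.
From mathcomp Require Import all_boot all_order all_algebra.
From mathcomp Require Import all_classical all_reals all_analysis measurable_realfun.
From mathcomp Require Import complex ring lra.

Set Implicit Arguments.
Unset Strict Implicit.
Unset Printing Implicit Defensive.
Import Order.TTheory GRing.Theory Num.Theory numFieldNormedType.Exports.

Local Open Scope classical_set_scope.
Local Open Scope ring_scope.

(** * Real-valued integrals on R^d *)

(** The constant 1 - e^(-1) is one minus the value of the Gaussian on the sphere of radius r, and it
    is reached only in a limit. A countable grid detects an exit through right-continuity only if
    being outside is an open condition, so the skeleton is watched in a closed ball of radius r' < r
    up to time t + eta; then r' tends to r and eta to 0. The exponent r^(-2) makes the local part of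
    Au reproduce the bracket 2/r^2 [...] of H. Since r < 1, all jumps of size at most r are
    compensated, while those between r and 1 leave a compensator, which is the drift correction in
    H. The Gaussian is cut off beyond radius 2r, where no jump of size at most r from the closed
    ball can land. For the lower bound on the mean, r' = r/2 yields c1 = (1 - e^(-1/4))/16; the
    upper bound holds with c2 = 1. On the Fourier side the obstacle is absolute integrability. All
    dominations on R^d go through one weight, the product of the 1/(1 + x_j^2), which factors along
    the inductive definition of Lebesgue measure. *)

Section Rintegrable.
Context d (T : measurableType d) (R : realType) (mu : {measure set T -> \bar R}).
Variables (D : set T) (mD : measurable D).
Implicit Types f g : T -> R.

Lemma RintegrableZl c f : mu.-integrable D (EFin \o f) ->
  mu.-integrable D (EFin \o (fun x => c * f x)).
Proof. by move=> /(integrableZl mD c); exact: eq_integrable. Qed.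

Lemma RintegrableZr c f : mu.-integrable D (EFin \o f) ->
  mu.-integrable D (EFin \o (fun x => f x * c)).
Proof. by move=> /(integrableZr mD c); exact: eq_integrable. Qed.

Lemma RintegrableD f g : mu.-integrable D (EFin \o f) ->
  mu.-integrable D (EFin \o g) -> mu.-integrable D (EFin \o (fun x => f x + g x)).
Proof. by move=> fi /(integrableD mD fi); exact: eq_integrable. Qed.

Lemma RintegrableN f : mu.-integrable D (EFin \o f) ->
  mu.-integrable D (EFin \o (fun x => - f x)).
Proof. by move=> /integrableN; exact: eq_integrable. Qed.

Lemma RintegrableB f g : mu.-integrable D (EFin \o f) ->
  mu.-integrable D (EFin \o g) -> mu.-integrable D (EFin \o (fun x => f x - g x)).
Proof. by move=> fi /RintegrableN; exact: RintegrableD. Qed.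

Lemma Rintegrable_sum (I : eqType) (s : seq I) (F : I -> T -> R) :
  (forall i, mu.-integrable D (EFin \o F i)) ->
  mu.-integrable D (EFin \o (fun x => \sum_(i <- s) F i x)).
Proof.
move=> Fi; elim: s => [|i s IH].
  by apply: eq_integrable (integrable0 _ D) => // x _; rewrite /= big_nil.
by apply: eq_integrable (RintegrableD (Fi i) IH) => // x _; rewrite /= big_cons.
Qed.

Lemma Rintegral_sum (I : eqType) (s : seq I) (F : I -> T -> R) :
  (forall i, mu.-integrable D (EFin \o F i)) ->
  \int[mu]_(x in D) (\sum_(i <- s) F i x) = \sum_(i <- s) \int[mu]_(x in D) F i x.
Proof.
move=> Fi; elim: s => [|i s IH].
  rewrite big_nil -[RHS](mul0r (fine (mu D))) -Rintegral_cst//.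
  by apply: eq_Rintegral => x _; rewrite big_nil.
rewrite big_cons -IH -RintegralD//; last exact: Rintegrable_sum.
by apply: eq_Rintegral => x _; rewrite big_cons.
Qed.

Lemma Rintegrable_measurable f : mu.-integrable D (EFin \o f) -> measurable_fun D f.
Proof. by move=> /(measurable_int mu)/measurable_EFinP. Qed.

Lemma Rintegral_EFin f : mu.-integrable D (EFin \o f) ->
  (\int[mu]_(x in D) (f x)%:E = (\int[mu]_(x in D) f x)%:E)%E.
Proof. by move=> fi; rewrite /Rintegral fineK//; apply: integrable_fin_num. Qed.

Lemma RintegralN f : mu.-integrable D (EFin \o f) ->
  \int[mu]_(x in D) (- f x) = - \int[mu]_(x in D) f x.
Proof.
move=> fi; rewrite -mulN1r -RintegralZl//.
by apply: eq_Rintegral => x _; rewrite mulN1r.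
Qed.

Lemma Rintegrable_norm f : mu.-integrable D (EFin \o f) ->
  mu.-integrable D (EFin \o (fun x => `|f x|)).
Proof. by move=> /integrable_norm; exact: eq_integrable. Qed.

Lemma Rintegrable_le f g : measurable_fun D f -> mu.-integrable D (EFin \o g) ->
  (forall x, D x -> `|f x| <= g x) -> mu.-integrable D (EFin \o f).
Proof.
move=> mf ig fg; apply: le_integrable ig => //; first exact/measurable_EFinP.
move=> x Dx /=; rewrite lee_fin (le_trans (fg x Dx))//.
exact: ler_norm.
Qed.

End Rintegrable.

Section dominated_fubini.
Context d1 d2 (T1 : measurableType d1) (T2 : measurableType d2) (R : realType).

Let dominated_aux (m1 : {sigma_finite_measure set T1 -> \bar R})
    (m2 : {sigma_finite_measure set T2 -> \bar R}) (f : T1 * T2 -> R) g h :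
  measurable_fun setT f ->
  m1.-integrable setT (EFin \o g) -> m2.-integrable setT (EFin \o h) ->
  (forall x y, `|f (x, y)| <= g x * h y) ->
  (m1 \x m2)%E.-integrable setT (EFin \o f).
Proof.
move=> mf ig ih fgh.
apply/integrable12ltyP; first exact/measurable_EFinP.
have mg : measurable_fun setT (fun x : T1 => g x).
  exact/measurable_EFinP/(measurable_int m1).
have mh : measurable_fun setT (fun x : T2 => h x).
  exact/measurable_EFinP/(measurable_int m2).
have ih' := Rintegrable_norm measurableT ih.
apply: (@le_lt_trans _ _
    (\int[m1]_x (`|g x| * \int[m2]_y `|h y|)%:E)%E).
  apply: ge0_le_integral => //=.
  - by move=> x _; exact: integral_ge0.
  - apply: (measurable_fun_fubini_tonelli_F (fun z => `|(f z)%:E|%E)) => //.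
    exact/measurableT_comp/measurable_EFinP.
  - apply/measurable_EFinP; apply: measurable_funM => //.
    exact: measurableT_comp.
  - move=> x _; rewrite -RintegralZl// -Rintegral_EFin//; last exact: RintegrableZl.
    apply: ge0_le_integral => //=.
    + apply/measurable_EFinP/measurableT_comp => //.
      exact: measurableT_comp mf (measurable_pair1 x).
    + apply/measurable_EFinP; apply: measurable_funM => //.
      exact: measurableT_comp.
    + move=> y _; rewrite lee_fin (le_trans (fgh _ _))//.
      by rewrite -normrM ler_norm.
rewrite (_ : (fun _ => _) = (EFin \o (fun x => `|g x| * \int[m2]_y `|h y|)%R))//.
have ig' := Rintegrable_norm measurableT ig.
have [_] := integrableP _ _ _ (RintegrableZr measurableT (\int[m2]_y `|h y|)%R ig').
apply: le_lt_trans; rewrite le_eqVlt.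
apply/orP; left; apply/eqP/eq_integral => x _ /=.
by rewrite normrM normr_id [in RHS]ger0_norm//; exact: Rintegral_ge0.
Qed.

Lemma sigma_finite_prod_integral (m1 : {sigma_finite_measure set T1 -> \bar R})
    (m2 : {sigma_finite_measure set T2 -> \bar R}) (f : T1 * T2 -> R) g h :
  measurable_fun setT f ->
  m1.-integrable setT (EFin \o g) -> m2.-integrable setT (EFin \o h) ->
  (forall x y, `|f (x, y)| <= g x * h y) ->
  [/\ (m1 \x m2)%E.-integrable setT (EFin \o f),
    m1.-integrable setT (EFin \o (fun x => \int[m2]_y f (x, y))),
    m2.-integrable setT (EFin \o (fun y => \int[m1]_x f (x, y))),
    \int[(m1 \x m2)%E]_z f z = \int[m1]_x \int[m2]_y f (x, y) &
    \int[(m1 \x m2)%E]_z f z = \int[m2]_y \int[m1]_x f (x, y)].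
Proof.
move=> mf ig ih fgh; have fi := dominated_aux mf ig ih fgh.
have mg : measurable_fun setT (fun x : T1 => g x).
  exact/measurable_EFinP/(measurable_int m1).
have mh : measurable_fun setT (fun x : T2 => h x).
  exact/measurable_EFinP/(measurable_int m2).
have fx x : m2.-integrable setT (EFin \o (fun y => f (x, y))).
  apply: (@Rintegrable_le _ _ _ m2 _ measurableT _ (fun y => g x * h y)) => //.
  - exact: measurableT_comp mf (measurable_pair1 x).
  - exact: RintegrableZl.
have fy y : m1.-integrable setT (EFin \o (fun x => f (x, y))).
  apply: (@Rintegrable_le _ _ _ m1 _ measurableT _ (fun x => g x * h y)) => //.
  - exact: measurableT_comp mf (measurable_pair2 y).
  - exact: RintegrableZr.
have Ex x : (\int[m2]_y (EFin \o f) (x, y) = (\int[m2]_y f (x, y))%R%:E)%E.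
  exact: Rintegral_EFin.
have Ey y : (\int[m1]_x (EFin \o f) (x, y) = (\int[m1]_x f (x, y))%R%:E)%E.
  exact: Rintegral_EFin.
split => //.
- have := integrable_fubini_F fi.
  by apply: eq_integrable => // x _; exact: Ex.
- apply: (@Rintegrable_le _ _ _ m2 _ measurableT _ (fun y => (\int[m1]_x g x) * h y)).
  + apply/measurable_EFinP; rewrite (_ : EFin \o _ = fubini_G m1 (EFin \o f)).
      exact: measurable_fubini_G fi.
    by apply/funext => y; rewrite /= -[LHS]Ey.
  + exact: RintegrableZl.
  + move=> y _; rewrite (le_trans (le_normr_Rintegral _ _))// -RintegralZr//.
    apply: le_Rintegral => //; first exact: Rintegrable_norm.
    exact: RintegrableZr.
- rewrite /Rintegral -integral12_prod_meas1//; congr fine.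
  by apply: eq_integral => x _; exact: Ex.
- rewrite /Rintegral -integral21_prod_meas1//; congr fine.
  by apply: eq_integral => x _; exact: Ey.
Qed.

(** [lebesgue_rV R d] and [nu y] are plain measures for which sigma-finiteness is a separate proof;
    the structure that the product measure needs is built inside the proof. The product measure is
    kept out of the conclusion, so the result does not mention these local structures. *)
Lemma Rintegral_Fubini (m1 : {measure set T1 -> \bar R})
    (m2 : {measure set T2 -> \bar R}) (f : T1 * T2 -> R) g h :
  sigma_finite setT m1 -> sigma_finite setT m2 ->
  measurable_fun setT f ->
  m1.-integrable setT (EFin \o g) -> m2.-integrable setT (EFin \o h) ->
  (forall x y, `|f (x, y)| <= g x * h y) ->
  [/\ m1.-integrable setT (EFin \o (fun x => \int[m2]_y f (x, y))),
    m2.-integrable setT (EFin \o (fun y => \int[m1]_x f (x, y))) &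
    \int[m1]_x \int[m2]_y f (x, y) = \int[m2]_y \int[m1]_x f (x, y)].
Proof.
move=> s1 s2 mf ig ih fgh.
pose A1 := isSFinite.Build _ _ _ _ (sfinite_measure_sigma_finite s1).
pose A2 := isSFinite.Build _ _ _ _ (sfinite_measure_sigma_finite s2).
pose B1 := isSigmaFinite.Build _ _ _ _ s1.
pose B2 := isSigmaFinite.Build _ _ _ _ s2.
pose n1 := HB.pack_for (SigmaFiniteMeasure.type T1 R) (Measure.sort m1) A1 B1.
pose n2 := HB.pack_for (SigmaFiniteMeasure.type T2 R) (Measure.sort m2) A2 B2.
have [_ i1 i2 e1 e2] := @sigma_finite_prod_integral n1 n2 f g h mf ig ih fgh.
by split => //; rewrite -[LHS]e1 -[RHS]e2.
Qed.
End dominated_fubini.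

(** * Sigma-finiteness of Lebesgue measure on R^d *)

Section lebesgue_rV_theory.
Context (R : realType).
Local Notation leb := (@lebesgue_measure R).
Implicit Type d : nat.

Lemma continuous_measurable_rV d (f : 'rV[R]_d -> R) :
  continuous f -> measurable_fun setT f.
Proof.
move=> cf; apply: (measurability _ (RGenOpens.measurableE R)) => _ [_ [a [b ->]] <-].
rewrite setTI; apply: sub_sigma_algebra.
by apply: open_comp => [x _|]; [exact: cf|exact: interval_open].
Qed.

(** Sup-norm balls: under [rV_cons] they are products of a cube and an interval, so their finite
    measure follows by induction on d. *)
Definition cube d (n : nat) : set 'rV[R]_d := [set x | forall j, `|x 0 j| <= n%:R].

Lemma measurable_cube d n : measurable (@cube d n).
Proof.
rewrite (_ : @cube d n = \bigcap_(j in [set: 'I_d]) ((fun x : 'rV[R]_d => x 0 j) @^-1` `[- n%:R, n%:R])).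
  apply: fin_bigcap_measurable => // j _.
  rewrite -[X in measurable X]setTI; exact: measurable_rV_coord.
apply/seteqP; split => x /= xn.
  by move=> j _ /=; rewrite in_itv/= -ler_norml xn.
by move=> j; have := xn j I; rewrite /= in_itv/= -ler_norml.
Qed.

Lemma rV_cons0 d (p : 'rV[R]_d * measurableTypeR R) : rV_cons p 0 ord0 = p.2.
Proof.
rewrite /rV_cons.
have -> : ord0 = lshift d (ord0 : 'I_1) :> 'I_(1 + d) by exact: val_inj.
by rewrite [LHS]row_mxEl !mxE eqxx mulr1n.
Qed.

Lemma rV_consS d (p : 'rV[R]_d * measurableTypeR R) j : rV_cons p 0 (lift ord0 j) = p.1 0 j.
Proof.
rewrite /rV_cons.
have -> : lift ord0 j = rshift 1 j :> 'I_(1 + d) by exact: val_inj.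
exact: row_mxEr.
Qed.

Lemma forall_ordS d (Q : 'I_d.+1 -> Prop) : Q ord0 -> (forall j, Q (lift ord0 j)) -> forall j, Q j.
Proof. by move=> Q0 QS j; case: (unliftP ord0 j) => [i|] ->. Qed.

Lemma lebesgue_rV_sigma_finite d : sigma_finite setT (lebesgue_rV R d).
Proof.
exists (@cube d).
  apply/seteqP; split => // x _.
  pose M := \sum_j `|x 0 j|.
  exists (Num.bound M) => //= j.
  have M0 : 0 <= M by apply: sumr_ge0.
  apply: (@le_trans _ _ M); last by rewrite ltW// archi_boundP.
  by rewrite /M (bigD1 j)//= lerDl sumr_ge0.
move=> n; split; first exact: measurable_cube.
elim: d => [|d IH] /=.
  by rewrite /dirac indicE ltry.
rewrite /pushforward.
have -> : @rV_cons R d @^-1` cube n = cube n `*` (`[- n%:R, n%:R] : set (measurableTypeR R)).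
  apply/seteqP; split => [p /= h|p /= [h1 h2]].
    split => [j|]; first by rewrite -rV_consS.
    by rewrite in_itv/= -ler_norml -rV_cons0; exact: h.
  apply: forall_ordS => [|j]; last by rewrite rV_consS.
  by rewrite rV_cons0 ler_norml; move: h2; rewrite in_itv.
rewrite product_measure1E//; last exact: measurable_cube.
rewrite lte_mul_pinfty//; last first.
  have := lebesgue_measure_itv `[(- n%:R : R), n%:R].
  rewrite /= => ->; case: ifP => _ //=; exact: ltry.
by rewrite ge0_fin_numE.
Qed.

End lebesgue_rV_theory.

(** * The Cauchy density and affine substitutions on the line *)

Section one_dim.
Context (R : realType).
Local Notation leb := (@lebesgue_measure R).

(** The unnormalised Cauchy density. It serves both as the reference integrable function on the line
    and, after rescaling, as the Poisson kernel. *)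
Definition lorentz (s : R) : R := (1 + s ^+ 2)^-1.

Lemma lorentz_den_gt0 (s : R) : 0 < 1 + s ^+ 2.
Proof. by rewrite ltr_pwDl// sqr_ge0. Qed.

Lemma lorentz_gt0 s : 0 < lorentz s.
Proof. by rewrite invr_gt0 lorentz_den_gt0. Qed.

Lemma continuous_lorentz : continuous lorentz.
Proof.
move=> s; apply: cvgV; first by rewrite gt_eqF// lorentz_den_gt0.
apply: cvgD; first exact: cvg_cst.
exact: exprn_continuous.
Qed.

Lemma integral_lorentz : (\int[leb]_s (lorentz s)%:E = pi%:E)%E.
Proof.
rewrite ge0_symfun_integralT; last 3 first.
- by move=> s; rewrite ltW// lorentz_gt0.
- exact: continuous_lorentz.
- by move=> s; rewrite /lorentz /= sqrrN.
have -> : [set x : R | 0 <= x] = `[0, +oo[%classic.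
  by apply/seteqP; split => x /=; rewrite in_itv/= andbT.
rewrite (@ge0_continuous_FTC2y _ _ (@atan R) 0 (pi / 2)).
- by rewrite atan0 sube0 -EFinM mulrC divfK.
- by move=> s _; rewrite ltW// lorentz_gt0.
- exact/continuous_subspaceT/continuous_lorentz.
- exact: cvgy_atan.
- by move=> x _; exact: derivable_atan.
- exact/cvg_at_right_filter/continuous_atan.
- by move=> x _; rewrite derive1_atan.
Qed.

Lemma integrable_lorentz : leb.-integrable [set: R] (EFin \o lorentz).
Proof.
apply/integrableP; split.
  apply/measurable_EFinP.
  apply: continuous_measurable_fun.
  exact: continuous_lorentz.
apply: le_lt_trans (ltry pi); rewrite -integral_lorentz le_eqVlt.
apply/orP; left; apply/eqP; apply: eq_integral => s _ /=.
by rewrite ger0_norm// ltW// lorentz_gt0.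
Qed.

Lemma Rintegral_lorentz : \int[leb]_s lorentz s = pi.
Proof. by rewrite /Rintegral integral_lorentz. Qed.

Lemma is_derive_affine (c y s : R) : is_derive s 1 (fun s : R => c + y * s) y.
Proof.
have h := is_deriveD (is_derive_cst c s 1) (is_deriveZ y (is_derive_id s (1 : R))).
by rewrite add0r /GRing.scale/= mulr1 in h.
Qed.

Lemma continuous_affine (c y : R) : continuous (fun s : R => c + y * s).
Proof.
by move=> x; apply: cvgD; [exact: cvg_cst|apply: cvgM; [exact: cvg_cst|exact: cvg_id]].
Qed.

Lemma ge0_integral_affine (f : R -> R) (w e : R) : 0 < e -> continuous f ->
  (forall x, 0 <= f x) ->
  (\int[leb]_s (f (w + e * s)%R)%:E * e%:E = \int[leb]_s (f s)%:E)%E.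
Proof.
move=> e0 cf f0.
pose F (s : R) : R := w + e * s.
have dF (x : R) : is_derive x 1 F e := is_derive_affine w e x.
have F'E : F^`()%classic = cst e by apply/funext => x; rewrite derive1E derive_val.
rewrite (@increasing_ge0_integration_by_substitutionT _ F f)//.
- rewrite -ge0_integralZr//=; last 3 first.
  + apply/measurable_EFinP; apply: continuous_measurable_fun => x.
    apply: continuous_comp; last exact: cf.
    exact/differentiable_continuous/derivable1_diffP.
  + by move=> x _; rewrite lee_fin.
  + by rewrite lee_fin ltW.
  by apply: eq_integral => x _ /=; rewrite F'E -EFinM.
- by move=> x y xy; rewrite ltrD2l ltr_pM2l.
- by rewrite F'E => x; exact: cvg_cst.
- by rewrite F'E; exact: is_cvg_cst.
- by rewrite F'E; exact: is_cvg_cst.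
- apply/cvgrNyPle => A; near=> x.
  rewrite /F -lerBrDl -ler_pdivlMl//; near: x.
- apply/cvgryPge => A; near=> x.
  rewrite /F -lerBlDl -ler_pdivrMl//; near: x.
Unshelve. all: end_near. Qed.

(** With t = w + e s one has s^2 = (t - w)^2 / e^2 <= 2 (t^2 + w^2) / e^2, so 1 + s^2 is at most a
    constant times 1 + t^2. *)
Lemma lorentz_affine (w e : R) : 0 < e ->
  exists C, forall s, lorentz (w + e * s) <= C * lorentz s.
Proof.
move=> e0.
exists (2 * (1 + w ^+ 2 + 1) * (1 + (e^-1) ^+ 2)) => s.
rewrite /lorentz ler_pdivlMr ?lorentz_den_gt0// mulrC ler_pdivrMr ?lorentz_den_gt0//.
set t := w + e * s.
have -> : s = e^-1 * (t - w) by rewrite /t; field; rewrite gt_eqF.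
have := sqr_ge0 (t + w); have := sqr_ge0 (e^-1); have := sqr_ge0 w; have := sqr_ge0 t.
rewrite exprMn; move: (e^-1 ^+ 2) => u t0 w0 u0 tw.
have h : (t - w) ^+ 2 <= 2 * t ^+ 2 + 2 * w ^+ 2 by rewrite !expr2 in tw *; lra.
move: t0 w0 h; move: (t ^+ 2) (w ^+ 2) ((t-w)^+2) => a b c a0 b0 h.
have := ler_wpM2l u0 h; have := mulr_ge0 u0 a0; have := mulr_ge0 u0 b0.
have := mulr_ge0 a0 b0; have := mulr_ge0 (mulr_ge0 u0 a0) b0; lra.
Qed.

(** The substitution is first made for nonnegative functions. A signed f is the difference of (|f| +
    f)/2 and (|f| - f)/2, which are continuous and obey the same bound. *)
Lemma Rintegral_affine (f : R -> R) (w e C : R) : 0 < e -> continuous f ->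
  (forall x, `|f x| <= C * lorentz x) ->
  (\int[leb]_s f (w + e * s)) * e = \int[leb]_s f s.
Proof.
move=> e0 cf fC.
have caff : continuous (fun s : R => w + e * s).
  by move=> x; apply: cvgD; [exact: cvg_cst|apply: cvgM; [exact: cvg_cst|exact: cvg_id]].
have [D hD] := lorentz_affine w e0.
have C0 : 0 <= C.
  by have := le_trans (normr_ge0 _) (fC 0); rewrite pmulr_lge0// lorentz_gt0.
have ic : leb.-integrable setT (EFin \o (fun s => C * lorentz s)).
  exact/RintegrableZl/integrable_lorentz.
have key (g : R -> R) : continuous g -> (forall x, `|g x| <= C * lorentz x) ->
  leb.-integrable setT (EFin \o g) /\
  leb.-integrable setT (EFin \o (fun s => g (w + e * s))).
  move=> cg gC; split.
    by apply: Rintegrable_le ic _ => //; exact: continuous_measurable_fun.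
  apply: (@Rintegrable_le _ _ _ leb setT measurableT (fun s => g (w + e * s)) (fun s => C * D * lorentz s)) => //.
  - apply: continuous_measurable_fun => x.
    by apply: continuous_comp; [exact: caff|exact: cg].
  - exact/RintegrableZl/integrable_lorentz.
  - by move=> s _; rewrite (le_trans (gC _))// -mulrA ler_wpM2l.
have pos (g : R -> R) : continuous g -> (forall x, `|g x| <= C * lorentz x) ->
  (forall x, 0 <= g x) -> (\int[leb]_s g (w + e * s)) * e = \int[leb]_s g s.
  move=> cg gC g0; have [i1 i2] := key _ cg gC.
  by apply: EFin_inj; rewrite EFinM -!Rintegral_EFin// ge0_integral_affine.
have cnf : continuous (fun x => `|f x|) by move=> x; apply: continuous_comp; [exact: cf|exact: norm_continuous].
have nfC x : `| (`|f x|) | <= C * lorentz x by rewrite normr_id.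
have cp : continuous (fun x => 2^-1 * (`|f x| + f x)).
  by move=> x; apply: cvgM; [exact: cvg_cst|apply: cvgD; [exact: cnf|exact: cf]].
have p0 x : 0 <= 2^-1 * (`|f x| + f x).
  by rewrite mulr_ge0// -lerBlDr sub0r (le_trans (ler_norm _))// normrN.
have pC x : `| 2^-1 * (`|f x| + f x)| <= C * lorentz x.
  rewrite ger0_norm//; have := fC x; have := ler_norm (f x); lra.
have cm : continuous (fun x => 2^-1 * (`|f x| - f x)).
  by move=> x; apply: cvgM; [exact: cvg_cst|apply: cvgB; [exact: cnf|exact: cf]].
have m0 x : 0 <= 2^-1 * (`|f x| - f x).
  by rewrite mulr_ge0// subr_ge0 ler_norm.
have mC x : `| 2^-1 * (`|f x| - f x)| <= C * lorentz x.
  rewrite ger0_norm//; have := fC x; have := p0 x; lra.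
have := pos _ cp pC p0; have := pos _ cm mC m0.
have [i1 i2] := key _ cp pC; have [j1 j2] := key _ cm mC.
have -> : \int[leb]_s f s = \int[leb]_s (2^-1 * (`|f s| + f s)) - \int[leb]_s (2^-1 * (`|f s| - f s)).
  by rewrite -RintegralB//; apply: eq_Rintegral => s _; field.
move=> <- <-; rewrite -mulrBl -RintegralB//; congr (_ * _).
by apply: eq_Rintegral => s _; field.
Qed.

End one_dim.

Section weight.
Context (R : realType).
Local Notation leb := (@lebesgue_measure R).
Local Notation lam d := (lebesgue_rV R d).

(* An integrable product weight: Fubini and decay estimates on R^d are reduced to
   domination by [wt]. *)
Definition wt d (x : 'rV[R]_d) : R := \prod_(j < d) lorentz (x 0 j).

Lemma wt_gt0 d (x : 'rV[R]_d) : 0 < wt x.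
Proof. by apply: prodr_gt0 => j _; exact: lorentz_gt0. Qed.

Lemma wt_cons d (p : 'rV[R]_d * measurableTypeR R) : wt (rV_cons p) = wt p.1 * lorentz p.2.
Proof.
rewrite /wt big_ord_recl rV_cons0 mulrC; congr (_ * _).
by apply: eq_bigr => j _; rewrite rV_consS.
Qed.

Lemma continuous_rV d (j : 'I_d) : continuous (fun x : 'rV[R]_d => x 0 j).
Proof. exact: coord_continuous. Qed.

Lemma continuous_mul (T : topologicalType) (f g : T -> R) :
  continuous f -> continuous g -> continuous (fun x => f x * g x).
Proof. by move=> cf cg x; apply: cvgM; [exact: cf|exact: cg]. Qed.

Lemma continuous_add (T : topologicalType) (f g : T -> R) :
  continuous f -> continuous g -> continuous (fun x => f x + g x).
Proof. by move=> cf cg x; apply: cvgD; [exact: cf|exact: cg]. Qed.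

Lemma continuous_opp (T : topologicalType) (f : T -> R) :
  continuous f -> continuous (fun x => - f x).
Proof. by move=> cf x; apply: cvgN; exact: cf. Qed.

Lemma continuous_inv (T : topologicalType) (f : T -> R) :
  continuous f -> (forall x, f x != 0) -> continuous (fun x => (f x)^-1).
Proof. by move=> cf f0 x; apply: cvgV; [exact: f0|exact: cf]. Qed.

Lemma continuous_cst (T : topologicalType) (c : R) : continuous (fun _ : T => c).
Proof. by move=> x; exact: cvg_cst. Qed.

Lemma continuous_prod (T : topologicalType) (I : Type) (s : seq I) (F : I -> T -> R) :
  (forall i, continuous (F i)) -> continuous (fun x => \prod_(i <- s) F i x).
Proof.
move=> cF; elim: s => [|i s IH] x.
  by rewrite (_ : (fun _ => _) = cst 1); [exact: cvg_cst|apply/funext => y; rewrite big_nil].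
rewrite (_ : (fun _ => _) = (fun x => F i x * \prod_(i <- s) F i x)); last first.
  by apply/funext => y; rewrite big_cons.
by apply: cvgM; [exact: cF|exact: IH].
Qed.

Lemma continuous_wt d : continuous (@wt d).
Proof.
apply: continuous_prod => j x.
by apply: (continuous_comp (@continuous_rV _ j x)); exact: continuous_lorentz.
Qed.

Definition dominated d (F : 'rV[R]_d -> R) := exists C, forall x, `|F x| <= C * wt x.

Lemma dominated_ge0 d (F : 'rV[R]_d -> R) C : (forall x, `|F x| <= C * wt x) -> 0 <= C.
Proof.
by move=> /(_ 0) h; have := le_trans (normr_ge0 _) h; rewrite pmulr_lge0// wt_gt0.
Qed.

Lemma measurable_wt d : measurable_fun setT (@wt d).
Proof. apply: continuous_measurable_rV; exact: continuous_wt. Qed.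

Lemma integrable_wt d : (lam d).-integrable setT (EFin \o @wt d).
Proof.
elim: d => [|d IH].
  apply/integrableP; split; first by apply/measurable_EFinP; exact: measurable_wt.
  rewrite integral_dirac//; last by apply/measurableT_comp => //; apply/measurable_EFinP; exact: measurable_wt.
  by rewrite /dirac indicE in_setT mul1e ltry.
rewrite /=; apply: integrable_pushforward => //.
- exact: measurable_rV_cons.
- by apply/measurable_EFinP; exact: measurable_wt.
rewrite preimage_setT.
pose A1 := isSFinite.Build _ _ _ _ (sfinite_measure_sigma_finite (lebesgue_rV_sigma_finite R d)).
pose B1 := isSigmaFinite.Build _ _ _ _ (lebesgue_rV_sigma_finite R d).
pose n1 := HB.pack_for (SigmaFiniteMeasure.type 'rV[R]_d R) (Measure.sort (lam d)) A1 B1.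
have [||] := @sigma_finite_prod_integral _ _ 'rV[R]_d (measurableTypeR R) R n1 leb (fun p => wt (rV_cons p)) (@wt d) (@lorentz R) _ IH (@integrable_lorentz R).
  exact: measurableT_comp (@measurable_wt _) (@measurable_rV_cons _ _).
by move=> x y; rewrite wt_cons ger0_norm// ltW// mulr_gt0// ?wt_gt0 ?lorentz_gt0.
by move=> h _ _ _ _; exact: h.
Qed.

Lemma dominated_integrable d (F : 'rV[R]_d -> R) : measurable_fun setT F ->
  dominated F -> (lam d).-integrable setT (EFin \o F).
Proof.
move=> mF [C FC]; apply: (@Rintegrable_le _ _ _ (lam d) _ measurableT _ (fun x => C * wt x)) => //.
exact: RintegrableZl (integrable_wt d).
Qed.

Lemma Rintegral_rV0 (F : 'rV[R]_0 -> R) : measurable_fun setT F -> \int[lam 0]_x F x = F 0.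
Proof.
move=> mF; rewrite /Rintegral integral_dirac//; last exact/measurable_EFinP.
by rewrite /dirac indicE in_setT mul1e.
Qed.

(** Peels off the first coordinate, in both orders of integration. It is the induction step for
    every computation on R^d below, the order being chosen by the coordinate in which an explicit
    integration is possible. *)
Lemma Rintegral_rVS d (F : 'rV[R]_d.+1 -> R) : measurable_fun setT F -> dominated F ->
  [/\ (lam d).-integrable setT (EFin \o (fun x => \int[leb]_s F (rV_cons (x, s)))),
    leb.-integrable setT (EFin \o (fun s => \int[lam d]_x F (rV_cons (x, s)))),
    \int[lam d.+1]_x F x = \int[lam d]_x \int[leb]_s F (rV_cons (x, s)) &
    \int[lam d.+1]_x F x = \int[leb]_s \int[lam d]_x F (rV_cons (x, s))].
Proof.
move=> mF [C FC].
have C0 := dominated_ge0 FC.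
pose A1 := isSFinite.Build _ _ _ _ (sfinite_measure_sigma_finite (lebesgue_rV_sigma_finite R d)).
pose B1 := isSigmaFinite.Build _ _ _ _ (lebesgue_rV_sigma_finite R d).
pose n1 := HB.pack_for (SigmaFiniteMeasure.type 'rV[R]_d R) (Measure.sort (lam d)) A1 B1.
have iC := @RintegrableZl _ _ _ (lam d) _ measurableT C _ (integrable_wt d).
have [||fi i1 i2 e1 e2] := @sigma_finite_prod_integral _ _ 'rV[R]_d (measurableTypeR R) R n1 leb (fun p => F (rV_cons p)) _ (@lorentz R) _ iC (@integrable_lorentz R).
- exact: measurableT_comp mF (@measurable_rV_cons _ _).
- by move=> x y; rewrite (le_trans (FC _))// wt_cons mulrA.
have E : \int[lam d.+1]_x F x = \int[(n1 \x leb)%E]_z F (rV_cons z).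
  rewrite /Rintegral /= integral_pushforward//.
  - exact: measurable_rV_cons.
  - exact/measurable_EFinP.
by split; [exact: i1|exact: i2|exact: etrans E e1|exact: etrans E e2].
Qed.

End weight.

(** * The Poisson kernel on the line *)

Section poisson1.
Context (R : realType).
Local Notation leb := (@lebesgue_measure R).

(** An antiderivative of exp(- e s) (1 + cos(t + y s)). The summand 1 makes the integrand
    nonnegative, as the fundamental theorem on a half-line requires; its contribution is subtracted
    afterwards. *)
Let prim (e t y s : R) : R := expR (0 + (- e) * s) *
  ((y * sin (t + y * s) - e * cos (t + y * s)) / (e ^+ 2 + y ^+ 2) - e^-1).

Let is_derive_prim (e t y s : R) : 0 < e ->
  is_derive s 1 (prim e t y) (expR (0 + (- e) * s) * (1 + cos (t + y * s))).
Proof.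
move=> e0.
have d1 := @is_derive1_comp R expR (fun s => 0 + (- e) * s) s _ _ (is_derive_expR (0 + (- e) * s)) (is_derive_affine 0 (- e) s).
have d2 := @is_derive1_comp R sin (fun s => t + y * s) s _ _ (is_derive_sin (t + y * s)) (is_derive_affine t y s).
have d3 := @is_derive1_comp R cos (fun s => t + y * s) s _ _ (is_derive_cos (t + y * s)) (is_derive_affine t y s).
set q := e ^+ 2 + y ^+ 2.
have q0 : q != 0 by rewrite gt_eqF// ltr_wpDr ?sqr_ge0// exprn_gt0.
have -> : prim e t y = (expR \o (fun s => 0 + (- e) * s)) *
   (q^-1 *: (y *: (sin \o (fun s => t + y * s)) - e *: (cos \o (fun s => t + y * s))) - cst e^-1).
  by apply/funext => x; rewrite /prim -/q /GRing.scale/= [_ / q]mulrC.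
apply: is_derive_eq.
rewrite /GRing.scale/= subr0.
set E := expR _; set C := cos _; set S := sin _.
rewrite [X in _ + X * _](_ : _ = q^-1 * (y * S - e * C) - e^-1)//.
rewrite /q in q0 *.
by field; rewrite q0 gt_eqF.
Qed.

Let poisson_half (e t y : R) : 0 < e ->
  (\int[leb]_(s in `[0%R, +oo[) (expR (- (e * s)) * (1 + cos (t + y * s)))%:E =
   (e^-1 + (e * cos t - y * sin t) / (e ^+ 2 + y ^+ 2))%:E)%E.
Proof.
move=> e0.
have cp s : {for s, continuous (prim e t y)}.
  by apply: differentiable_continuous; apply/derivable1_diffP; apply: ex_derive; exact: is_derive_prim.
rewrite (@ge0_continuous_FTC2y _ _ (prim e t y) 0 0).
- rewrite -EFinB /prim !mulr0 !addr0 expR0; congr EFin; ring.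
- by move=> x _; rewrite mulr_ge0 ?expR_ge0// -lerBlDl sub0r cos_geN1.
- apply: continuous_subspaceT => x; apply: cvgM.
    apply: (@continuous_comp _ _ _ (fun s : R => - (e * s)) expR); last exact: continuous_expR.
    by apply: cvgN; apply: cvgM; [exact: cvg_cst|exact: cvg_id].
  apply: cvgD; first exact: cvg_cst.
  by apply: (continuous_comp (@continuous_affine R t y x)); exact: continuous_cos.
- pose K := (`|y| + e) / (e ^+ 2 + y ^+ 2) + e^-1.
  have q0 : 0 < e ^+ 2 + y ^+ 2 by rewrite ltr_wpDr ?sqr_ge0// exprn_gt0.
  apply: norm_cvg0.
  have lim : (K * expR (- (e * s))) @[s --> +oo] --> (0 : R).
    rewrite -[X in _ --> X](mulr0 K); apply: cvgM; first exact: cvg_cst.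
    apply: (@cvg_comp _ _ _ (fun s : R => e * s) (fun s => expR (- s)) _ (pinfty_nbhs R)); last exact: cvgr_expR.
    apply/cvgryPge => A; near=> x.
    by rewrite -ler_pdivrMl//; near: x.
  apply: (@squeeze_cvgr _ _ _ _ (cst 0) (fun s => K * expR (- (e * s)))) => //; last first.
    exact: cvg_cst.
  near=> s; rewrite normr_ge0/= normrM [`|expR _|]ger0_norm ?expR_ge0// add0r mulNr mulrC ler_wpM2r ?expR_ge0//.
  rewrite (le_trans (ler_normB _ _))// lerD//; last by rewrite ger0_norm// invr_ge0 ltW.
  rewrite normrM [`|_^-1|]gtr0_norm ?invr_gt0// ler_pM2r ?invr_gt0//.
  rewrite (le_trans (ler_normB _ _))// !normrM [`|e|]gtr0_norm// lerD//.
    by rewrite ler_piMr// ler_norml sin_geN1 sin_le1.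
  by rewrite ler_piMr ?(ltW e0)// ler_norml cos_geN1 cos_le1.
- by move=> x _; apply: ex_derive; exact: is_derive_prim.
- exact/cvg_at_right_filter/cp.
- move=> x _; rewrite derive1E.
  have := is_derive_prim t y x e0 => h; rewrite derive_val.
  by rewrite add0r mulNr.
Unshelve. all: end_near. Qed.

Let ge0_integral_halves (f : R -> R) : (forall x, 0 <= f x) -> continuous f ->
  (\int[leb]_x (f x)%:E = \int[leb]_(x in `[0%R, +oo[) (f (- x)%R)%:E +
     \int[leb]_(x in `[0%R, +oo[) (f x)%:E)%E.
Proof.
move=> f0 cf.
have mf : measurable_fun [set: R] f by exact: continuous_measurable_fun.
rewrite -(setUv (`]-oo, 0]%classic : set R)) ge0_integral_setU//=; last 4 first.
- exact: measurableC.
- by apply/measurable_EFinP; rewrite setUv.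
- by move=> x _; rewrite lee_fin.
- exact/disj_setPCl.
rewrite setCitvl; congr (_ + _)%E.
  rewrite -{1}oppr0 ge0_integration_by_substitutionNy//.
  exact: continuous_subspaceT.
rewrite integral_itv_obnd_cbnd//.
exact/measurable_EFinP/measurable_funTS.
Qed.

Let ge0_poisson (e t y : R) : 0 < e ->
  (\int[leb]_s (expR (- (e * `|s|)) * (1 + cos (t + y * s)))%:E =
   (2 * e^-1 + 2 * e * cos t / (e ^+ 2 + y ^+ 2))%:E)%E.
Proof.
move=> e0; rewrite ge0_integral_halves; last 2 first.
- by move=> x; rewrite mulr_ge0 ?expR_ge0// -lerBlDl sub0r cos_geN1.
- move=> x; apply: cvgM.
    apply: (@continuous_comp _ _ _ (fun s : R => - (e * `|s|)) expR); last exact: continuous_expR.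
    by apply: cvgN; apply: cvgM; [exact: cvg_cst|exact: norm_continuous].
  apply: cvgD; first exact: cvg_cst.
  by apply: (continuous_comp (@continuous_affine R t y x)); exact: continuous_cos.
transitivity ((e^-1 + (e * cos t - (- y) * sin t) / (e ^+ 2 + (- y) ^+ 2))%:E +
    (e^-1 + (e * cos t - y * sin t) / (e ^+ 2 + y ^+ 2))%:E)%E; last first.
  by rewrite -EFinD sqrrN; congr EFin; ring.
rewrite -(poisson_half t (- y) e0) -(poisson_half t y e0); congr (_ + _)%E; apply: eq_integral => s;
  rewrite inE/= in_itv/= andbT => s0.
  by rewrite normrN ger0_norm// mulrN mulNr.
by rewrite ger0_norm.
Qed.

Lemma continuous_expRN (e : R) : continuous (fun s : R => expR (- (e * `|s|))).
Proof.
move=> x; apply: (@continuous_comp _ _ _ (fun s : R => - (e * `|s|)) expR); last exact: continuous_expR.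
by apply: cvgN; apply: cvgM; [exact: cvg_cst|exact: norm_continuous].
Qed.

Lemma integrable_expRN (e : R) : 0 < e ->
  leb.-integrable setT (EFin \o (fun s : R => expR (- (e * `|s|)))).
Proof.
move=> e0; apply/integrableP; split.
  apply/measurable_EFinP; apply: continuous_measurable_fun; exact: continuous_expRN.
(* The phase pi/2 with frequency 0 makes the cosine vanish, which isolates the exponential. *)
have := ge0_poisson (pi / 2) 0 e0; rewrite cos_pihalf => h.
apply: le_lt_trans (ltry (2 * e^-1 + 2 * e * 0 / (e ^+ 2 + 0 ^+ 2))).
rewrite -h le_eqVlt; apply/orP; left; apply/eqP; apply: eq_integral => s _ /=.
by rewrite ger0_norm ?expR_ge0// mul0r addr0 cos_pihalf addr0 mulr1.
Qed.

Lemma integrable_poisson (e t y : R) : 0 < e ->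
  leb.-integrable setT (EFin \o (fun s : R => expR (- (e * `|s|)) * cos (t + y * s))).
Proof.
move=> e0; have i1 := integrable_expRN e0.
have mc : measurable_fun setT (fun s : R => cos (t + y * s)).
  apply: continuous_measurable_fun => s.
  by apply: (continuous_comp (@continuous_affine R t y s)); exact: continuous_cos.
apply: (@Rintegrable_le _ _ _ leb setT measurableT _ (fun s : R => expR (- (e * `|s|)))) => //.
  apply: measurable_funM => //.
  apply: continuous_measurable_fun; exact: continuous_expRN.
move=> s _; rewrite normrM ger0_norm ?expR_ge0// ler_piMr ?expR_ge0//.
by rewrite ler_norml cos_geN1 cos_le1.
Qed.

(** On the two half-lines the frequencies are y and - y, so the sine terms cancel and only cos t
    times the Poisson kernel remains once the integral of the exponential is removed. *)
Lemma Rintegral_poisson (e t y : R) : 0 < e ->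
  \int[leb]_s (expR (- (e * `|s|)) * cos (t + y * s)) = cos t * (2 * e / (e ^+ 2 + y ^+ 2)).
Proof.
move=> e0.
have i1 := integrable_expRN e0; have i2 := integrable_poisson t y e0.
have h0 : \int[leb]_s expR (- (e * `|s|)) = 2 * e^-1.
  rewrite /Rintegral; have := ge0_poisson (pi / 2) 0 e0.
  rewrite cos_pihalf mulr0 mul0r addr0 => h.
  rewrite -[RHS]/(fine (_%:E)) -h; congr fine; apply: eq_integral => s _ /=.
  by rewrite mul0r addr0 cos_pihalf addr0 mulr1.
have : \int[leb]_s (expR (- (e * `|s|)) + expR (- (e * `|s|)) * cos (t + y * s)) =
   2 * e^-1 + 2 * e * cos t / (e ^+ 2 + y ^+ 2).
  rewrite /Rintegral -[RHS]/(fine (_%:E)) -ge0_poisson//; congr fine.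
  by apply: eq_integral => s _ /=; rewrite mulrDr mulr1.
rewrite RintegralD// h0 => /addrI ->; ring.
Qed.

Lemma expRN_lorentz (e : R) : 0 < e ->
  exists C, forall s, expR (- (e * `|s|)) <= C * lorentz s.
Proof.
(* From exp(u) >= (1 + u/2)^2 at u = e |s|: the term 4 / e^2 turns (e s / 2)^2 into s^2. *)
move=> e0; exists (1 + 4 / e ^+ 2) => s.
rewrite /lorentz ler_pdivlMr ?lorentz_den_gt0// expRN mulrC ler_pdivrMr ?expR_gt0//.
have h1 : (1 + e * `|s| / 2) ^+ 2 <= expR (e * `|s|).
  rewrite [leRHS](_ : _ = expR (e * `|s| / 2) ^+ 2); last first.
    by rewrite -expRM_natl; congr expR; field.
  rewrite lerXn2r// ?nnegrE ?expR_ge0//; last exact: expR_ge1Dx.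
  by rewrite addr_ge0// divr_ge0// mulr_ge0// ltW.
apply: le_trans (ler_wpM2l _ h1); last first.
  by rewrite addr_ge0// divr_ge0// sqr_ge0.
rewrite -[s ^+ 2]real_normK ?num_real//; have := normr_ge0 s; move: (`|s|) => {h1 s} s s0.
have es : 0 <= e * s by rewrite mulr_ge0// ltW.
have -> : (1 + 4 / e ^+ 2) * (1 + e * s / 2) ^+ 2 = 1 + s ^+ 2 + (e * s + (e * s / 2) ^+ 2 + 4 / e ^+ 2 + 4 * (e * s) / e ^+ 2).
  by field; rewrite gt_eqF.
rewrite lerDl; have e2 : 0 <= e ^+ 2 by rewrite sqr_ge0.
by rewrite !addr_ge0// ?sqr_ge0// divr_ge0// mulr_ge0.
Qed.

End poisson1.

(** * Affine substitution, integration by parts and the Poisson kernel on R^d *)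

Section multi_dim.
Context (R : realType).
Local Notation leb := (@lebesgue_measure R).
Local Notation lam d := (lebesgue_rV R d).

Lemma continuous_compose (T U V : topologicalType) (f : T -> U) (g : U -> V) :
  continuous f -> continuous g -> continuous (g \o f).
Proof. by move=> cf cg x; apply: continuous_comp; [exact: cf|exact: cg]. Qed.

Lemma continuous_to_rV (T : topologicalType) d (g : T -> 'rV[R]_d) :
  (forall j, continuous (fun t => g t 0 j)) -> continuous g.
Proof.
move=> cg x; apply/cvg_ballP => e e0.
have : \forall t \near x, forall j, ball (g x 0 j) e (g t 0 j).
  apply: filter_forall => j.
  by move: e e0; apply/cvg_ballP; exact: cg.
apply: filterS => t h; split => // i j; rewrite (ord1 i); exact: h.
Qed.

Lemma continuous_rV_cons_fst d (s : R) : continuous (fun x : 'rV[R]_d => rV_cons (x, s)).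
Proof.
apply: continuous_to_rV; apply: forall_ordS => [|j].
  by under [X in continuous X]eq_fun do rewrite rV_cons0; exact: cst_continuous.
by under [X in continuous X]eq_fun do rewrite rV_consS; exact: continuous_rV.
Qed.

Lemma continuous_rV_cons_snd d (x : 'rV[R]_d) : continuous (fun s : R => rV_cons (x, s)).
Proof.
apply: continuous_to_rV; apply: forall_ordS => [|j].
  by under [X in continuous X]eq_fun do rewrite rV_cons0; move=> s; exact: cvg_id.
by under [X in continuous X]eq_fun do rewrite rV_consS; exact: cst_continuous.
Qed.

(** The scale is a vector because the change of variables is proved one coordinate at a time,
    rescaling the first coordinate and leaving the others fixed. *)
Definition aff d (w e x : 'rV[R]_d) : 'rV[R]_d := \row_j (w 0 j + e 0 j * x 0 j).

Lemma continuous_aff d (w e : 'rV[R]_d) : continuous (aff w e).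
Proof.
apply: continuous_to_rV => j; under [X in continuous X]eq_fun do rewrite mxE.
apply: (@continuous_compose _ _ _ (fun x : 'rV[R]_d => x 0 j) (fun s => w 0 j + e 0 j * s)).
  exact: continuous_rV.
exact: continuous_affine.
Qed.

Lemma dominated_aff d (F : 'rV[R]_d -> R) (w e : 'rV[R]_d) : (forall j, 0 < e 0 j) ->
  dominated F -> dominated (F \o aff w e).
Proof.
move=> e0 [C FC]; have C0 := dominated_ge0 FC.
have [K KP] := choice (fun j => lorentz_affine (w 0 j) (e0 j)).
exists (C * \prod_j K j) => x; rewrite (le_trans (FC _))// -mulrA ler_wpM2l//.
rewrite /wt -big_split/=; apply: ler_prod => j _.
by rewrite ltW ?lorentz_gt0//= mxE KP.
Qed.

Lemma aff_cons d (w e : 'rV[R]_d.+1) x s :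
  aff w e (rV_cons (x, s)) = rV_cons (aff (\row_j w 0 (lift ord0 j)) (\row_j e 0 (lift ord0 j)) x, w 0 ord0 + e 0 ord0 * s).
Proof.
apply/rowP; apply: forall_ordS => [|j]; rewrite mxE ?rV_cons0 ?rV_consS//.
by rewrite !mxE.
Qed.

Lemma dominated_cons_fst d (F : 'rV[R]_d.+1 -> R) s :
  dominated F -> dominated (fun x => F (rV_cons (x, s))).
Proof.
move=> [C FC]; exists (C * lorentz s) => x.
by rewrite (le_trans (FC _))// wt_cons -mulrA [lorentz _ * _]mulrC.
Qed.

Lemma Rintegral_aff d (F : 'rV[R]_d -> R) (w e : 'rV[R]_d) : (forall j, 0 < e 0 j) ->
  continuous F -> dominated F ->
  (\int[lam d]_x F (aff w e x)) * \prod_j e 0 j = \int[lam d]_x F x.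
Proof.
elim: d F w e => [|d IH] F w e e0 cF dF.
  rewrite big_ord0 mulr1; apply: eq_Rintegral => x _; congr F.
  by apply/rowP => -[].
have mF (G : 'rV[R]_d.+1 -> R) : continuous G -> measurable_fun setT G.
  by move=> cG; apply: continuous_measurable_rV.
have cFa w' e' : continuous (F \o aff w' e').
  by apply: continuous_compose => //; exact: continuous_aff.
pose w' : 'rV[R]_d.+1 := \row_j (if j == ord0 then w 0 ord0 else 0).
pose e' : 'rV[R]_d.+1 := \row_j (if j == ord0 then e 0 ord0 else 1).
have e'0 j : 0 < e' 0 j by rewrite mxE; case: ifP.
have aff' x s : aff w' e' (rV_cons (x, s)) = rV_cons (x, w 0 ord0 + e 0 ord0 * s).
  rewrite aff_cons; congr (rV_cons (_, _)); last by rewrite !mxE eqxx.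
  by apply/rowP => j; rewrite !mxE/= add0r mul1r.
have d1 := dominated_aff w e0 dF.
have d2 := dominated_aff w' e'0 dF.
have [_ i1 _ ->] := Rintegral_rVS (mF _ (cFa _ _)) d1.
have [j1 _ a1 a2] := Rintegral_rVS (mF _ (cFa w' e')) d2.
have [_ _ b1 _] := Rintegral_rVS (mF _ cF) dF.
rewrite big_ord_recl [X in _ * X]mulrC mulrA -RintegralZr//.
transitivity ((\int[leb]_s \int[lam d]_x (F \o aff w' e') (rV_cons (x, s))) * e 0 ord0).
  congr (_ * _); apply: eq_Rintegral => s _ /=.
  under eq_Rintegral do rewrite aff_cons.
  under [in RHS]eq_Rintegral do rewrite aff'.
  rewrite -(IH (fun x => F (rV_cons (x, w 0 ord0 + e 0 ord0 * s)))
    (\row_j w 0 (lift ord0 j)) (\row_j e 0 (lift ord0 j))).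
  - by congr (_ * _); apply: eq_bigr => j _; rewrite mxE.
  - by move=> j; rewrite mxE.
  - exact: (continuous_compose (@continuous_rV_cons_fst _ _)).
  - exact: dominated_cons_fst.
rewrite -a2 a1 b1 -(RintegralZr _ _ j1)//.
apply: eq_Rintegral => x _.
have [C FC] := dF.
rewrite -(@Rintegral_affine _ (fun s => F (rV_cons (x, s))) (w 0 ord0) (e 0 ord0) (C * wt x))//.
- by congr (_ * _); apply: eq_Rintegral => s _; rewrite /= aff'.
- exact: (continuous_compose (@continuous_rV_cons_snd _ x)).
- by move=> s; rewrite (le_trans (FC _))// wt_cons mulrA.
Qed.

Lemma Rintegral_derive1 (g g' : R -> R) (M : R) : 0 < M ->
  (forall s : R, is_derive s 1 g (g' s)) -> continuous g' ->
  (forall s, M <= `|s| -> g s = 0 /\ g' s = 0) ->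
  \int[leb]_s g' s = 0.
Proof.
move=> M0 dg cg' g0.
have -> : \int[leb]_s g' s = \int[leb]_(s in `[- M, M]) g' s.
  rewrite [RHS]Rintegral_mkcond; apply: eq_Rintegral => s _; rewrite patchE.
  case: ifPn => //; rewrite notin_setE /= in_itv/= -ler_norml => /negP.
  by rewrite -ltNge => /ltW/g0[].
rewrite /Rintegral (@continuous_FTC2 _ g' g).
- have [-> _] : g M = 0 /\ g' M = 0 by apply: g0; rewrite ler_norm.
  have [-> _] : g (- M) = 0 /\ g' (- M) = 0 by apply: g0; rewrite normrN ler_norm.
  by rewrite subee.
- by rewrite gtrN.
- exact: continuous_subspaceT.
- have cg s : {for s, continuous g}.
    by apply: differentiable_continuous; apply/derivable1_diffP; apply: ex_derive.
  split; first by move=> x _; exact: ex_derive.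
  + exact/cvg_at_right_filter/cg.
  + exact/cvg_at_left_filter/cg.
- by move=> s _; rewrite derive1E derive_val.
Qed.

(** Directional derivatives become derivatives along a line, so that the one-variable chain rule and
    fundamental theorem apply to partial derivatives. *)
Lemma is_derive_along (V : normedModType R) (F : V -> R) (x v : V) (s D : R) :
  is_derive (s *: v + x) v F D <-> is_derive s 1 (fun h => F (h *: v + x)) D.
Proof.
have E : (fun h : R => h^-1 *: ((F \o shift (s *: v + x)) (h *: v) - F (s *: v + x))) =
  (fun h : R => h^-1 *: (((fun h => F (h *: v + x)) \o shift s) (h *: 1) - F (s *: v + x))).
  by apply/funext => h /=; rewrite addrA -scalerDl [h *: 1]mulr1.
split=> -[h1 h2]; apply: DeriveDef.
- by rewrite /derivable -E.
- by rewrite -h2 /derive -E.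
- by rewrite /derivable E.
- by rewrite -h2 /derive E.
Qed.

Lemma rV_cons_shift0 d (x : 'rV[R]_d) (s : R) :
  rV_cons (x, s) = s *: delta_mx 0 ord0 + rV_cons (x, 0).
Proof.
apply/rowP; apply: forall_ordS => [|j]; rewrite [RHS]mxE ?rV_cons0 ?rV_consS !mxE/=.
  by rewrite mulr1 addr0.
by rewrite mulr0 add0r.
Qed.

Lemma rV_cons_shiftS d (x : 'rV[R]_d) (s h : R) j :
  rV_cons (h *: delta_mx 0 j + x, s) = h *: delta_mx 0 (lift ord0 j) + rV_cons (x, s).
Proof.
apply/rowP; apply: forall_ordS => [|i]; rewrite [RHS]mxE ?rV_cons0 ?rV_consS !mxE/=.
  by rewrite mulr0 add0r.
by rewrite (inj_eq lift_inj).
Qed.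

(** Integration by parts without boundary terms, to be applied to a product G. Fubini lets the j-th
    coordinate be integrated innermost, where the fundamental theorem on [- M, M] gives 0. *)
Lemma Rintegral_derive0 d (G G' : 'rV[R]_d -> R) (j : 'I_d) (M : R) : 0 < M ->
  (forall x : 'rV[R]_d, is_derive x (delta_mx 0 j) G (G' x)) -> continuous G' -> dominated G' ->
  (forall x : 'rV[R]_d, (exists i, M <= `|x 0 i|) -> G x = 0 /\ G' x = 0) ->
  \int[lam d]_x G' x = 0.
Proof.
move=> M0; elim: d G G' j => [|d IH] G G' j; first by case: j.
move=> dG cG' dG' G0.
have [_ _ i1 i2] := Rintegral_rVS (continuous_measurable_rV cG') dG'.
case: (unliftP ord0 j) dG => [i ->|->] dG.
- rewrite i2; transitivity (\int[leb]_s (0 : R)); last by rewrite Rintegral_cst// mul0r.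
  apply: eq_Rintegral => s _; apply: (IH (fun x => G (rV_cons (x, s))) _ i).
  + move=> x; suff : is_derive (0 *: delta_mx 0 i + x) (delta_mx 0 i)
      (fun x => G (rV_cons (x, s))) (G' (rV_cons (x, s))) by rewrite scale0r add0r.
    apply: (proj2 (@is_derive_along _ (fun x => G (rV_cons (x, s))) x (delta_mx 0 i) 0 _)).
    rewrite (_ : (fun h => _) = (fun h => G (h *: delta_mx 0 (lift ord0 i) + rV_cons (x, s)))); last first.
      by apply/funext => h; rewrite rV_cons_shiftS.
    apply: (proj1 (@is_derive_along _ G (rV_cons (x, s)) (delta_mx 0 (lift ord0 i)) 0 _)).
    by rewrite scale0r add0r; exact: dG.
  + exact: (continuous_compose (@continuous_rV_cons_fst _ _)).
  + exact: dominated_cons_fst.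
  + by move=> x [k kx]; apply: G0; exists (lift ord0 k); rewrite rV_consS.
- rewrite i1; transitivity (\int[lam d]_x (0 : R)); last by rewrite Rintegral_cst// mul0r.
  apply: eq_Rintegral => x _; apply: (@Rintegral_derive1 (fun s => G (rV_cons (x, s))) _ M) => //.
  + move=> s; rewrite (_ : (fun s => _) = (fun s => G (s *: delta_mx 0 ord0 + rV_cons (x, 0)))); last first.
      by apply/funext => h; rewrite rV_cons_shift0.
    apply: (proj1 (@is_derive_along _ G (rV_cons (x, 0)) (delta_mx 0 ord0) s _)).
    by rewrite -rV_cons_shift0; exact: dG.
  + exact: (continuous_compose (@continuous_rV_cons_snd _ _)).
  + by move=> s sM; apply: G0; exists ord0; rewrite rV_cons0.
Qed.

(** The regularising weight for Fourier inversion; e tends to 0. Being a product, it has a transform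
    that factors into one-dimensional Poisson kernels. *)
Definition expw d (e : R) (x : 'rV[R]_d) : R := \prod_j expR (- (e * `|x 0 j|)).

Lemma expw_cons d e (x : 'rV[R]_d) s : expw e (rV_cons (x, s)) = expR (- (e * `|s|)) * expw e x.
Proof.
rewrite /expw big_ord_recl rV_cons0; congr (_ * _).
by apply: eq_bigr => j _; rewrite rV_consS.
Qed.

Lemma continuous_expw d (e : R) : continuous (@expw d e).
Proof.
apply: continuous_prod => j.
by apply: (@continuous_compose _ _ _ (fun x : 'rV[R]_d => x 0 j) (fun s => expR (- (e * `|s|))));
  [exact: continuous_rV|exact: continuous_expRN].
Qed.

Lemma expw_ge0 d (e : R) (x : 'rV[R]_d) : 0 <= expw e x.
Proof. by apply: prodr_ge0 => j _; exact: expR_ge0. Qed.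

Lemma expw_le1 d (e : R) (x : 'rV[R]_d) : 0 <= e -> expw e x <= 1.
Proof.
move=> e0; rewrite -[leRHS](@big1_eq _ 1 *%R 'I_d (index_enum 'I_d) predT).
apply: ler_prod => j _; rewrite expR_ge0/= -expR0 ler_expR oppr_le0 mulr_ge0//.
Qed.

Lemma dominated_expw d (e : R) : 0 < e -> dominated (@expw d e).
Proof.
move=> e0; have [C CP] := expRN_lorentz e0.
exists (\prod_(j < d) C) => x; rewrite ger0_norm ?expw_ge0// /wt -big_split/=.
by apply: ler_prod => j _; rewrite expR_ge0/= CP.
Qed.

Lemma dominated_bounded d (F G : 'rV[R]_d -> R) (K : R) :
  (forall x, `|G x| <= K) -> dominated F -> dominated (fun x => F x * G x).
Proof.
move=> GK [C FC]; exists (C * K) => x.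
by rewrite normrM mulrAC ler_pM.
Qed.

Lemma dot_rV_cons d (y : 'rV[R]_d.+1) x s :
  dot y (rV_cons (x, s)) = y 0 ord0 * s + dot (\row_j y 0 (lift ord0 j)) x.
Proof.
rewrite /dot big_ord_recl rV_cons0; congr (_ + _).
by apply: eq_bigr => j _; rewrite rV_consS mxE.
Qed.

Lemma continuous_sum (T : topologicalType) (I : Type) (s : seq I) (F : I -> T -> R) :
  (forall i, continuous (F i)) -> continuous (fun x => \sum_(i <- s) F i x).
Proof.
move=> cF; elim: s => [|i s IH] x.
  by rewrite (_ : (fun _ => _) = cst 0); [exact: cvg_cst|apply/funext => y; rewrite big_nil].
rewrite (_ : (fun _ => _) = (fun x => F i x + \sum_(i <- s) F i x)); last first.
  by apply/funext => y; rewrite big_cons.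
by apply: cvgD; [exact: cF|exact: IH].
Qed.

Lemma continuous_dot d (y : 'rV[R]_d) : continuous (dot y).
Proof.
apply: continuous_sum => j; apply: continuous_mul; first exact: continuous_cst.
exact: continuous_rV.
Qed.

(** The free phase t makes the induction on d work: while one coordinate is integrated, the others
    are part of the phase. *)
Lemma Rintegral_poisson_rV d (e t : R) (y : 'rV[R]_d) : 0 < e ->
  \int[lam d]_x (expw e x * cos (t + dot y x)) =
  cos t * \prod_j (2 * e / (e ^+ 2 + (y 0 j) ^+ 2)).
Proof.
move=> e0.
have cc d' (y' : 'rV[R]_d') t' : continuous (fun x => expw e x * cos (t' + dot y' x)).
  apply: continuous_mul; first exact: continuous_expw.
  apply: (continuous_compose _ (@continuous_cos R)).
  by apply: continuous_add; [exact: continuous_cst|exact: continuous_dot].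
have dc d' (y' : 'rV[R]_d') t' : dominated (fun x => expw e x * cos (t' + dot y' x)).
  apply: (@dominated_bounded _ _ _ 1); last exact: dominated_expw.
  by move=> x; rewrite ler_norml cos_geN1 cos_le1.
elim: d t y => [|d IH] t y.
  rewrite Rintegral_rV0; last exact: continuous_measurable_rV.
  by rewrite /expw /dot !big_ord0 addr0 mul1r mulr1.
have [_ _ i1 _] := Rintegral_rVS (continuous_measurable_rV (cc _ y t)) (dc _ y t).
rewrite i1 big_ord_recl; set y' := \row_j y 0 (lift ord0 j).
transitivity (\int[lam d]_x (expw e x * cos (t + dot y' x) * (2 * e / (e ^+ 2 + y 0 ord0 ^+ 2)))).
  apply: eq_Rintegral => x _.
  transitivity (\int[leb]_s (expR (- (e * `|s|)) * cos (t + dot y' x + y 0 ord0 * s) * expw e x)).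
    apply: eq_Rintegral => s _.
    by rewrite expw_cons dot_rV_cons mulrAC [y 0 ord0 * _ + _]addrC addrA.
  rewrite RintegralZr//; last exact: integrable_poisson.
  by rewrite Rintegral_poisson// mulrAC [cos _ * _]mulrC.
rewrite RintegralZr//; last first.
  apply: dominated_integrable; last exact: dc.
  apply: continuous_measurable_rV; exact: cc.
rewrite IH [in RHS]mulrA [RHS]mulrAC; congr (_ * _ * _).
by apply: eq_bigr => j _; rewrite mxE.
Qed.

End multi_dim.

Section dot_theory.
Context (R : realType) (d : nat).
Implicit Types x y z : 'rV[R]_d.

Lemma dotC x y : dot x y = dot y x.
Proof. by apply: eq_bigr => j _; rewrite mulrC. Qed.

Lemma dotDl x y z : dot (x + y) z = dot x z + dot y z.
Proof. by rewrite /dot -big_split/=; apply: eq_bigr => j _; rewrite mxE mulrDl. Qed.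

Lemma dotZl c x z : dot (c *: x) z = c * dot x z.
Proof. by rewrite /dot mulr_sumr; apply: eq_bigr => j _; rewrite mxE mulrA. Qed.

Lemma dotNl x z : dot (- x) z = - dot x z.
Proof. by rewrite -scaleN1r dotZl mulN1r. Qed.

Lemma dotBl x y z : dot (x - y) z = dot x z - dot y z.
Proof. by rewrite dotDl dotNl. Qed.

Lemma dot_delta j z : dot (delta_mx 0 j) z = z 0 j.
Proof.
rewrite /dot (bigD1 j)//= mxE !eqxx mul1r big1 ?addr0// => i ij.
by rewrite mxE eqxx/= (negbTE ij) mul0r.
Qed.

Lemma measurable_fun_dot dT (T : measurableType dT) (f g : T -> 'rV[R]_d) :
  measurable_fun setT f -> measurable_fun setT g ->
  measurable_fun setT (fun t => dot (f t) (g t)).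
Proof.
move=> mf mg; apply: measurable_sum => j; apply: measurable_funM.
  exact: measurableT_comp (measurable_rV_coord j) mf.
exact: measurableT_comp (measurable_rV_coord j) mg.
Qed.

End dot_theory.

Section Rdominated.
Context d (T : measurableType d) (R : realType) (mu : {measure set T -> \bar R}).

Lemma cvg_Rintegral_dominated (f_ : (T -> R)^nat) (f g : T -> R) :
  (forall n, measurable_fun setT (f_ n)) ->
  (forall x, f_ n x @[n --> \oo] --> f x) ->
  mu.-integrable setT (EFin \o g) ->
  (forall n x, `|f_ n x| <= g x) ->
  \int[mu]_x f_ n x @[n --> \oo] --> \int[mu]_x f x.
Proof.
move=> mf cf ig fg.
have mff : measurable_fun setT f.
  by apply: (measurable_fun_cvg mf) => x _; exact: cf.
have [||||fi _ h] := @dominated_convergence _ _ _ mu setT measurableT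
  (fun n => EFin \o f_ n) (EFin \o f) (EFin \o g) _ _ _ ig.
- by move=> n; apply/measurable_EFinP.
- exact/measurable_EFinP.
- by apply: aeW => x _; apply: cvg_EFin; [exact: nearW|exact: cf].
- by apply: aeW => x n _ /=; rewrite lee_fin.
apply: fine_cvg; rewrite fineK; last exact: integrable_fin_num.
exact: h.
Qed.

End Rdominated.

(** * Fourier inversion *)

Section trig_transform.
Context (R : realType) (d : nat).
Local Notation lam := (lebesgue_rV R d).
Implicit Types (v : 'rV[R]_d -> R) (x w xi : 'rV[R]_d).

(* The Fourier transform of a real function in real form: [p = 0] is its cosine
   transform, [p = pi / 2] its sine transform, and [p = dot w xi] the real part of
   exp(i w.xi) times the transform. *)
Definition trig v (p : R) xi : R := \int[lam]_x (cos (p - dot x xi) * v x).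

Let mcos (p : R) xi : measurable_fun setT (fun x => cos (p - dot x xi)).
Proof.
apply: measurableT_comp; first exact: continuous_measurable_fun (@continuous_cos R).
by apply: measurable_funB => //; apply: measurable_fun_dot.
Qed.

Lemma trig_integrable v p xi : lam.-integrable setT (EFin \o v) ->
  lam.-integrable setT (EFin \o (fun x => cos (p - dot x xi) * v x)).
Proof.
move=> iv; apply: (@Rintegrable_le _ _ _ lam setT measurableT _ (fun x => `|v x|)).
- by apply: measurable_funM => //; exact: Rintegrable_measurable iv.
- exact: Rintegrable_norm.
- by move=> x _; rewrite normrM ler_piMl// ler_norml cos_geN1 cos_le1.
Qed.

Lemma trig_le v p xi : lam.-integrable setT (EFin \o v) ->
  `|trig v p xi| <= \int[lam]_x `|v x|.
Proof.
move=> iv; rewrite (le_trans (le_normr_Rintegral _ (trig_integrable _ _ iv)))//.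
apply: le_Rintegral => //; [exact/Rintegrable_norm/trig_integrable|exact: Rintegrable_norm|].
by move=> x _; rewrite normrM ler_piMl// ler_norml cos_geN1 cos_le1.
Qed.

Lemma trigD v p q xi : lam.-integrable setT (EFin \o v) ->
  trig v (p + q) xi = cos q * trig v p xi + sin q * trig v (p + pi / 2) xi.
Proof.
move=> iv; rewrite /trig -!RintegralZl//; [|exact: trig_integrable..].
rewrite -RintegralD//; [|apply: RintegrableZl => //; exact: trig_integrable..].
apply: eq_Rintegral => x _.
set a := dot x xi.
have -> : p + q - a = (p - a) + q by ring.
have -> : p + pi / 2 - a = (p - a) + pi / 2 by ring.
rewrite cosDpihalf cosD; ring.
Qed.

Lemma trigDpi v p xi : lam.-integrable setT (EFin \o v) ->
  trig v (p + pi) xi = - trig v p xi.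
Proof. by move=> iv; rewrite trigD// cospi sinpi mul0r addr0 mulN1r. Qed.

Lemma Rintegral_wt d' : \int[lebesgue_rV R d']_x wt x = pi ^+ d'.
Proof.
elim: d' => [|d' IH].
  rewrite Rintegral_rV0; last exact: measurable_wt.
  by rewrite /wt big_ord0 expr0.
have dw : dominated (@wt R d'.+1) by exists 1 => x; rewrite mul1r ger0_norm// ltW// wt_gt0.
have [_ _ -> _] := Rintegral_rVS (@measurable_wt R d'.+1) dw.
rewrite exprS -IH -RintegralZl//; last exact: integrable_wt.
apply: eq_Rintegral => x _.
transitivity (\int[lebesgue_measure]_s (wt x * lorentz s)).
  by apply: eq_Rintegral => s _; rewrite wt_cons.
by rewrite RintegralZl//; [rewrite Rintegral_lorentz mulrC|exact: integrable_lorentz].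
Qed.

Lemma expwN (e : R) xi : expw e xi * expw (- e) xi = 1.
Proof.
rewrite /expw -big_split/= big1// => j _.
by rewrite -expRD mulNr subrr expR0.
Qed.

(* [trig v] is not absolutely integrable jointly in [(x, xi)]; the exponential weight makes it so. *)
Let weighted_Fubini v (p : 'rV[R]_d -> R) (e : R) : 0 < e ->
  continuous v -> dominated v -> measurable_fun setT p ->
  [/\ lam.-integrable setT (EFin \o (fun xi => expw e xi * trig v (p xi) xi)) &
   \int[lam]_xi (expw e xi * trig v (p xi) xi) =
   \int[lam]_x (v x * \int[lam]_xi (expw e xi * cos (p xi - dot x xi)))].
Proof.
move=> e0 cv [C vC] mp.
have [K eK] := dominated_expw d e0.
have dv : dominated v by exists C.
have iv := dominated_integrable (continuous_measurable_rV cv) dv.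
pose f (z : 'rV[R]_d * 'rV[R]_d) := expw e z.1 * (cos (p z.1 - dot z.2 z.1) * v z.2).
have [||i1 i2 E] := @Rintegral_Fubini _ _ _ _ R lam lam f _ _
  (lebesgue_rV_sigma_finite R d) (lebesgue_rV_sigma_finite R d) _
  (@RintegrableZl _ _ _ lam _ measurableT K _ (integrable_wt R d))
  (@RintegrableZl _ _ _ lam _ measurableT C _ (integrable_wt R d)).
- apply: measurable_funM.
    apply: (@measurableT_comp _ _ _ _ _ _ (@expw R d e) _ fst) => //.
    by apply: continuous_measurable_rV; exact: continuous_expw.
  apply: measurable_funM.
    apply: measurableT_comp; first exact: continuous_measurable_fun (@continuous_cos R).
    apply: measurable_funB; first exact: (@measurableT_comp _ _ _ _ _ _ p _ fst).
    exact: measurable_fun_dot.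
  apply: (@measurableT_comp _ _ _ _ _ _ v _ snd) => //.
  exact: continuous_measurable_rV.
- move=> x y; rewrite /f/= normrM; apply: ler_pM => //.
  by rewrite normrM (le_trans _ (vC y))// ler_piMl// ler_norml cos_geN1 cos_le1.
have E1 xi : \int[lam]_x f (xi, x) = expw e xi * trig v (p xi) xi.
  by rewrite /f/= RintegralZl//; exact: trig_integrable.
have E2 x : \int[lam]_xi f (xi, x) = v x * \int[lam]_xi (expw e xi * cos (p xi - dot x xi)).
  rewrite -RintegralZl//; last first.
    apply: (@Rintegrable_le _ _ _ lam setT measurableT _ (@expw R d e)).
    - apply: measurable_funM; first by apply: continuous_measurable_rV; exact: continuous_expw.
      apply: measurableT_comp; first exact: continuous_measurable_fun (@continuous_cos R).
      by apply: measurable_funB => //; exact: measurable_fun_dot.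
    - apply: dominated_integrable; last exact: dominated_expw.
      by apply: continuous_measurable_rV; exact: continuous_expw.
    - by move=> xi _; rewrite normrM ger0_norm ?expw_ge0// ler_piMr ?expw_ge0// ler_norml cos_geN1 cos_le1.
  by apply: eq_Rintegral => xi _; rewrite /f/=; ring.
split.
- by apply: eq_integrable i1 => // xi _ /=; rewrite E1.
- transitivity (\int[lam]_xi \int[lam]_x f (xi, x)); first by apply: eq_Rintegral => xi _; rewrite E1.
  by rewrite E; apply: eq_Rintegral => x _; rewrite E2.
Qed.

(** Fubini gives measurability of the transform times the weight [expw 1]; the factor [expw (- 1)]
    then cancels the weight. *)
Lemma measurable_trig v (p : 'rV[R]_d -> R) : continuous v -> dominated v ->
  measurable_fun setT p -> measurable_fun setT (fun xi => trig v (p xi) xi).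
Proof.
move=> cv dv mp; have [i1 _] := weighted_Fubini ltr01 cv dv mp.
rewrite (_ : (fun _ => _) = (fun xi => expw (- 1) xi * (expw 1 xi * trig v (p xi) xi))); last first.
  by apply/funext => xi; rewrite mulrA [expw _ _ * _]mulrC expwN mul1r.
apply: measurable_funM; first by apply: continuous_measurable_rV; exact: continuous_expw.
exact: Rintegrable_measurable i1.
Qed.

(** The weighted integral has two limits as the weight tends to 1. Dominated convergence gives the
    left-hand side. Fubini turns it into the Poisson average of v around w, which rescales to 2^d
    times the integral of v(w + e s) [wt] s and tends to 2^d pi^d v(w). *)
Lemma trig_inversion v w (K C : R) : continuous v -> dominated v -> (forall x, `|v x| <= K) ->
  (forall p xi, `|trig v p xi| <= C * wt xi) ->
  \int[lam]_xi trig v (dot w xi) xi = (2 * pi) ^+ d * v w.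
Proof.
move=> cv dv vK tC.
pose e (n : nat) : R := n.+1%:R^-1.
have e0 n : 0 < e n by rewrite invr_gt0.
have ecvg : e n @[n --> \oo] --> (0 : R) by exact: cvg_harmonic.
have mdot : measurable_fun setT (fun xi => dot w xi) by exact: measurable_fun_dot.
pose I n := \int[lam]_xi (expw (e n) xi * trig v (dot w xi) xi).
have L1 : I n @[n --> \oo] --> \int[lam]_xi trig v (dot w xi) xi.
  apply: (@cvg_Rintegral_dominated _ _ _ lam _ _ (fun xi => C * wt xi)).
  - move=> n; apply: measurable_funM; first by apply: continuous_measurable_rV; exact: continuous_expw.
    exact: measurable_trig.
  - move=> xi; rewrite -[X in _ --> X]mul1r; apply: cvgM; last exact: cvg_cst.
    rewrite -(expwN 0 xi) oppr0.
    have -> : expw 0 xi * expw 0 xi = expw 0 xi.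
      by rewrite /expw -big_split; apply: eq_bigr => j _ /=; rewrite -expRD mul0r oppr0 addr0.
    have : continuous (fun t : R => expw t xi).
      apply: continuous_prod => j; apply: (continuous_compose _ (@continuous_expR R)).
      apply: continuous_opp; apply: continuous_mul; first by move=> x; exact: cvg_id.
      exact: continuous_cst.
    by move=> /(_ 0); apply: cvg_comp.
  - exact: RintegrableZl (integrable_wt R d).
  - move=> n xi; rewrite normrM ger0_norm ?expw_ge0// (le_trans _ (tC (dot w xi) xi))//.
    by rewrite ler_piMl// expw_le1// ltW.
have IE n : I n = 2 ^+ d * \int[lam]_s (v (aff w (const_mx (e n)) s) * wt s).
  rewrite /I (weighted_Fubini (e0 n) cv dv mdot).2.
  (* The substitution x = w + e s turns each factor, times e, into 2 / (1 + s_j^2). *)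
  pose G x := v x * \prod_j (2 * e n / (e n ^+ 2 + ((w - x) 0 j) ^+ 2)).
  transitivity (\int[lam]_x G x).
    apply: eq_Rintegral => x _; congr (_ * _).
    have := @Rintegral_poisson_rV R d (e n) 0 (w - x) (e0 n).
    rewrite cos0 mul1r => <-; apply: eq_Rintegral => xi _.
    by rewrite add0r dotBl.
  have cG : continuous G.
    apply: continuous_mul => //; apply: continuous_prod => j.
    apply: continuous_mul; first exact: continuous_cst.
    apply: continuous_inv => [|x]; last by rewrite gt_eqF// ltr_wpDr ?sqr_ge0// exprn_gt0.
    apply: continuous_add; first exact: continuous_cst.
    apply: (continuous_compose _ (@exprn_continuous R 2)).
    under [X in continuous X]eq_fun do rewrite !mxE.
    by apply: continuous_add; [exact: continuous_cst|apply: continuous_opp; exact: continuous_rV].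
  have dG : dominated G.
    apply: (@dominated_bounded _ _ _ _ (\prod_(j < d) (2 / e n))) => // x.
    rewrite normr_prod; apply: ler_prod => j _; rewrite normr_ge0/=.
    have q0 : 0 < e n ^+ 2 + ((w - x) 0 j) ^+ 2 by rewrite ltr_wpDr ?sqr_ge0// exprn_gt0.
    rewrite ger0_norm; last by rewrite divr_ge0 ?ltW// mulr_gt0.
    rewrite -mulrA ler_pM2l// ler_pdivrMr// ler_pdivlMl//.
    by rewrite -expr2 lerDl sqr_ge0.
  rewrite -(Rintegral_aff w (e := const_mx (e n)) _ cG dG); last by move=> j; rewrite mxE.
  have GE s : G (aff w (const_mx (e n)) s) * e n ^+ d =
      2 ^+ d * (v (aff w (const_mx (e n)) s) * wt s).
    rewrite /G -mulrA [RHS]mulrCA; congr (_ * _).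
    have pc (c : R) : \prod_(j < d) c = c ^+ d by rewrite prodr_const card_ord.
    rewrite /wt -(pc (e n)) -(pc 2) -!big_split; apply: eq_bigr => j _ /=.
    rewrite !mxE /lorentz.
    have h1 : e n != 0 by rewrite gt_eqF.
    have h2 : 1 + s 0 j ^+ 2 != 0 by rewrite gt_eqF// lorentz_den_gt0.
    have h3 : e n ^+ 2 + (w 0 j - (w 0 j + e n * s 0 j)) ^+ 2 = e n ^+ 2 * (1 + s 0 j ^+ 2) by ring.
    by rewrite h3; field; rewrite h1 h2.
  have P : \prod_(j < d) (const_mx (e n) : 'rV[R]_d) 0 j = e n ^+ d.
    by under eq_bigr do rewrite mxE; rewrite prodr_const card_ord.
  rewrite P -!RintegralZl//.
  - rewrite -RintegralZr//.
      by apply: eq_Rintegral => s _; exact: GE.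
    apply: dominated_integrable.
      apply: continuous_measurable_rV; apply: continuous_compose cG; exact: continuous_aff.
    by apply: dominated_aff => // j; rewrite mxE.
  - apply: (@Rintegrable_le _ _ _ lam setT measurableT _ (fun x => K * wt x)).
    + apply: measurable_funM; last exact: measurable_wt.
      by apply: continuous_measurable_rV; apply: continuous_compose cv; exact: continuous_aff.
    + exact: RintegrableZl (integrable_wt R d).
    + by move=> x _; rewrite normrM; apply: ler_pM => //; rewrite ger0_norm// ltW// wt_gt0.
have L2 : I n @[n --> \oo] --> 2 ^+ d * \int[lam]_s (v w * wt s).
  under [X in X @ _]eq_fun do rewrite IE.
  apply: cvgM; first exact: cvg_cst.
  apply: (@cvg_Rintegral_dominated _ _ _ lam _ _ (fun xi => K * wt xi)).
  - move=> n; apply: measurable_funM; last exact: measurable_wt.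
    by apply: continuous_measurable_rV; apply: continuous_compose cv; exact: continuous_aff.
  - move=> s; apply: cvgM; last exact: cvg_cst.
    have : continuous (fun t : R => v (aff w (const_mx t) s)).
      apply: continuous_compose cv; apply: continuous_to_rV => j.
      under [X in continuous X]eq_fun do rewrite !mxE.
      apply: continuous_add; first exact: continuous_cst.
      apply: continuous_mul; last exact: continuous_cst.
      by move=> x; exact: cvg_id.
    have h0 : aff w (const_mx 0) s = w by apply/rowP => j; rewrite !mxE mul0r addr0.
    move=> /(_ 0); rewrite /continuous_at h0.
    exact: cvg_comp.
  - exact: RintegrableZl (integrable_wt R d).
  - by move=> n x; rewrite normrM; apply: ler_pM => //; rewrite ger0_norm// ltW// wt_gt0.
rewrite (cvg_unique _ L1 L2) // RintegralZl//; last exact: integrable_wt.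
by rewrite Rintegral_wt exprMn; ring.
Qed.

End trig_transform.

(** * Calculus in C_c^oo *)

Section Cc_smooth_theory.
Context (R : realType) (d : nat).
Implicit Types u v : 'rV[R]_d -> R.

Definition pd (j : 'I_d) u : 'rV[R]_d -> R := fun x => 'D_(delta_mx 0 j) u x.

Lemma Ck_continuous k u : Ck k u -> continuous u.
Proof. by case: k => [|k] []. Qed.

Lemma CkW k u : Ck k.+1 u -> Ck k u.
Proof.
elim: k u => [|k IH] u; first by case.
move=> [cu h]; split => // j; have [h1 h2] := h j; split => //.
exact: IH.
Qed.

Lemma Ck_is_derive k u j (x : 'rV[R]_d) : Ck k.+1 u -> is_derive x (delta_mx 0 j) u (pd j u x).
Proof. by move=> [_ /(_ j)[h _]]; apply: DeriveDef. Qed.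

Lemma Ck_pd k u j : Ck k.+1 u -> Ck k (pd j u).
Proof. by move=> [_ /(_ j)[_ h]]. Qed.

Lemma Ck_intro k u (u' : 'I_d -> 'rV[R]_d -> R) : continuous u ->
  (forall j (x : 'rV[R]_d), is_derive x (delta_mx 0 j) u (u' j x)) ->
  (forall j, Ck k (u' j)) -> Ck k.+1 u.
Proof.
move=> cu du cu'; split => // j; split; first by move=> x; apply: ex_derive.
by rewrite (_ : (fun _ => _) = u' j)//; apply/funext => x; apply: derive_val.
Qed.

Lemma Ck_add k u v : Ck k u -> Ck k v -> Ck k (fun x => u x + v x).
Proof.
elim: k u v => [|k IH] u v hu hv.
  by split => //; apply: continuous_add; apply: Ck_continuous; eassumption.
apply: (@Ck_intro _ _ (fun j x => pd j u x + pd j v x)).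
- by apply: continuous_add; apply: Ck_continuous; eassumption.
- by move=> j x; exact: is_deriveD (Ck_is_derive j x hu) (Ck_is_derive j x hv).
- by move=> j; apply: IH; exact: Ck_pd.
Qed.

Lemma Ck_mul k u v : Ck k u -> Ck k v -> Ck k (fun x => u x * v x).
Proof.
elim: k u v => [|k IH] u v hu hv.
  by split => //; apply: continuous_mul; apply: Ck_continuous; eassumption.
apply: (@Ck_intro _ _ (fun j x => u x * pd j v x + v x * pd j u x)).
- by apply: continuous_mul; apply: Ck_continuous; eassumption.
- move=> j x; have := is_deriveM (Ck_is_derive j x hu) (Ck_is_derive j x hv).
  exact.
- by move=> j; apply: Ck_add; apply: IH; (exact: CkW || exact: Ck_pd).
Qed.

Lemma Ck_cst k (c : R) : Ck k (fun _ : 'rV[R]_d => c).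
Proof.
elim: k c => [|k IH] c; first by split => //; exact: continuous_cst.
by apply: (@Ck_intro _ _ (fun _ _ => 0)) => //; exact: continuous_cst.
Qed.

Lemma Cc_smooth_continuous u : Cc_smooth u -> continuous u.
Proof. by move=> [/(_ 0)/Ck_continuous]. Qed.

Lemma Cc_smooth_is_derive u j (x : 'rV[R]_d) : Cc_smooth u -> is_derive x (delta_mx 0 j) u (pd j u x).
Proof. by move=> [/(_ 1) h _]; exact: Ck_is_derive h. Qed.

Lemma Cc_smooth_pd u j : Cc_smooth u -> Cc_smooth (pd j u).
Proof.
move=> [hu cu]; split; first by move=> k; exact: Ck_pd.
apply: (subclosed_compact _ cu); first exact: closed_closure.
suff h : [set x | pd j u x != 0] `<=` closure [set x | u x != 0].
  rewrite [X in _ `<=` X](proj1 (closure_id _) (@closed_closure _ _)).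
  exact: closure_subset.
move=> x /= /eqP ux; apply: contrapT => xS; apply: ux.
have nx : \forall t \near x, u t = 0.
  have : nbhs x (~` closure [set x | u x != 0]).
    by apply: open_nbhs_nbhs; split => //; apply: closed_openC; exact: closed_closure.
  apply: filterS => t tS; apply: contrapT => ut; apply: tS.
  by apply: subset_closure; apply/eqP.
by rewrite /pd (near_eq_derive (g := cst 0)) ?derive_cst.
Qed.

Lemma Cc_smooth_add u v : Cc_smooth u -> Cc_smooth v -> Cc_smooth (fun x => u x + v x).
Proof.
move=> [hu cu] [hv cv]; split; first by move=> k; exact: Ck_add.
apply: (subclosed_compact _ (compactU cu cv)); first exact: closed_closure.
rewrite -closureU; apply: closure_subset => x /= uv.
have [u0|] := eqVneq (u x) 0; last by left.
by right => /=; move: uv; rewrite u0 add0r.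
Qed.

Lemma Cc_smooth_scale (c : R) u : Cc_smooth u -> Cc_smooth (fun x => c * u x).
Proof.
move=> [hu cu]; split; first by move=> k; apply: Ck_mul => //; exact: Ck_cst.
apply: (subclosed_compact _ cu); first exact: closed_closure.
by apply: closure_subset => x /=; apply: contra => /eqP ->; rewrite mulr0.
Qed.

Lemma Cc_smooth_support u : Cc_smooth u ->
  exists2 M : R, 0 < M & forall x : 'rV[R]_d, (exists i, M <= `|x 0 i|) -> u x = 0.
Proof.
move=> [_ cu].
pose g (x : 'rV[R]_d) : R := \sum_i `|x 0 i|.
have cg : continuous g.
  apply: continuous_sum => i; apply: (continuous_compose _ (@norm_continuous _ R)).
  exact: continuous_rV.
have /compact_bounded[M [_ MP]] := continuous_compact (continuous_subspaceT cg) cu.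
exists (Num.max 1 (M + 1) + 1); first by rewrite ltr_pwDr// le_max ler01.
move=> x [i xi]; apply: contrapT => ux.
have := MP (Num.max 1 (M + 1)); rewrite lt_max ltrDl ltr01 orbT => /(_ isT (g x)).
have gx : (g @` closure [set x | u x != 0]) (g x).
  by exists x => //; apply: subset_closure; apply/eqP.
move=> /(_ gx); apply/negP; rewrite -ltNge.
have g0 : `|x 0 i| <= g x by rewrite /g (bigD1 i)//= lerDl sumr_ge0.
rewrite (lt_le_trans _ (ler_norm _))// (lt_le_trans _ g0)// (lt_le_trans _ xi)//.
by rewrite ltrDl.
Qed.

Lemma Cc_smooth_bounded u : Cc_smooth u -> exists K : R, forall x, `|u x| <= K.
Proof.
move=> hu; have cu := Cc_smooth_continuous hu; case: hu => _ su.
have /compact_bounded[M [_ MP]] := continuous_compact (continuous_subspaceT cu) su.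
exists (Num.max 0 (M + 1)) => x.
have [->|ux] := eqVneq (u x) 0; first by rewrite normr0 le_max lexx.
apply: MP; first by rewrite lt_max ltrDl ltr01 orbT.
by exists x => //; apply: subset_closure.
Qed.

Lemma Cc_smooth_dominated u : Cc_smooth u -> dominated u.
Proof.
move=> hu; have [M M0 MP] := Cc_smooth_support hu.
have [K KP] := Cc_smooth_bounded hu.
(* Where all |x_j| < M, the product of the 1 + M^2 dominates 1 / [wt] x; elsewhere u vanishes. *)
exists (K * \prod_(j < d) (1 + M ^+ 2)) => x.
have K0 : 0 <= K by apply: le_trans (KP 0).
have [h|h] := pselect (exists i, M <= `|x 0 i|).
  by rewrite MP// normr0 !mulr_ge0// ?ltW ?wt_gt0//; apply: prodr_gt0 => j _; exact: lorentz_den_gt0.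
rewrite (le_trans (KP x))// -mulrA ler_peMr// /wt -big_split/=.
rewrite -[leLHS](@big1_eq _ 1 *%R 'I_d (index_enum 'I_d) predT).
apply: ler_prod => j _; rewrite ler01/= /lorentz ler_pdivlMr ?lorentz_den_gt0// mul1r lerD2l.
have xM : `|x 0 j| <= M by rewrite leNgt; apply/negP => Mx; apply: h; exists j; exact: ltW.
by rewrite -[x 0 j ^+ 2]real_normK ?num_real// lerXn2r// nnegrE ltW.
Qed.

Lemma Cc_smooth_integrable u : Cc_smooth u -> (lebesgue_rV R d).-integrable setT (EFin \o u).
Proof.
move=> hu; apply: dominated_integrable (Cc_smooth_dominated hu).
by apply: continuous_measurable_rV; exact: Cc_smooth_continuous.
Qed.

End Cc_smooth_theory.

(** * Decay of the transform and elementary bounds on sine and cosine *)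

Section trig_decay.
Context (R : realType) (d : nat).
Local Notation lam := (lebesgue_rV R d).
Implicit Types (v : 'rV[R]_d -> R) (x xi : 'rV[R]_d).

(** The j-th partial derivative of sin(p - x.xi) v(x) has integral 0. A derivative on v costs the
    phase shift pi/2, the real form of multiplication by i. *)
Lemma trig_pd v j p xi : Cc_smooth v ->
  xi 0 j * trig v p xi = - trig (pd j v) (p + pi / 2) xi.
Proof.
move=> hv; have hv' := Cc_smooth_pd j hv.
have iv := Cc_smooth_integrable hv; have iv' := Cc_smooth_integrable hv'.
have cv := Cc_smooth_continuous hv; have cv' := Cc_smooth_continuous hv'.
pose G x := sin (p - dot x xi) * v x.
pose G' x := - xi 0 j * (cos (p - dot x xi) * v x) - cos (p + pi / 2 - dot x xi) * pd j v x.
have [M1 M10 M1P] := Cc_smooth_support hv.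
have [M2 M20 M2P] := Cc_smooth_support hv'.
have cdot q : continuous (fun x : 'rV[R]_d => q - dot x xi).
  apply: continuous_add; first exact: continuous_cst.
  apply: continuous_opp; under [X in continuous X]eq_fun do rewrite dotC.
  exact: continuous_dot.
have ccos q : continuous (fun x : 'rV[R]_d => cos (q - dot x xi)).
  exact: continuous_compose (cdot q) (@continuous_cos R).
have cG' : continuous G'.
  apply: continuous_add; last by apply: continuous_opp; exact: continuous_mul.
  by apply: continuous_mul; [exact: continuous_cst|exact: continuous_mul].
have dG' : dominated G'.
  have [C1 C1P] := Cc_smooth_dominated hv; have [C2 C2P] := Cc_smooth_dominated hv'.
  exists (`|xi 0 j| * C1 + C2) => x; rewrite (le_trans (ler_normB _ _))// [leRHS]mulrDl lerD//.
    rewrite normrM normrN -mulrA ler_wpM2l// normrM (le_trans _ (C1P x))//.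
    by rewrite ler_piMl// ler_norml cos_geN1 cos_le1.
  by rewrite normrM (le_trans _ (C2P x))// ler_piMl// ler_norml cos_geN1 cos_le1.
have dG x : is_derive x (delta_mx 0 j) G (G' x).
  have h1 : is_derive (0 : R) 1 (fun h : R => v (h *: delta_mx 0 j + x)) (pd j v x).
    apply: (proj1 (@is_derive_along _ _ v x (delta_mx 0 j) 0 _)).
    by rewrite scale0r add0r; exact: Cc_smooth_is_derive.
  have h2 : is_derive (0 : R) 1 (sin \o (fun h : R => (p - dot x xi) + (- xi 0 j) * h))
      (cos (p - dot x xi) * (- xi 0 j)).
    have := @is_derive1_comp R sin (fun h : R => p - dot x xi + - xi 0 j * h) 0 _ _
      (is_derive_sin _) (is_derive_affine _ _ _).
    by rewrite mulr0 addr0.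
  have h3 := is_deriveM h2 h1.
  suff : is_derive (0 *: delta_mx 0 j + x) (delta_mx 0 j) G (G' x) by rewrite scale0r add0r.
  apply: (proj2 (@is_derive_along _ _ G x (delta_mx 0 j) 0 _)).
  rewrite (_ : (fun h => _) = (sin \o (fun h : R => p - dot x xi + - xi 0 j * h)) * (fun h : R => v (h *: delta_mx 0 j + x))); last first.
    apply/funext => h; rewrite /G dotDl dotZl dot_delta; congr (sin _ * _); ring.
  apply: is_derive_eq h3 _.
  rewrite /G' /= scale0r add0r mulr0 addr0 /GRing.scale/=.
  have -> : p + pi / 2 - dot x xi = (p - dot x xi) + pi / 2 by ring.
  rewrite cosDpihalf; ring.
have := @Rintegral_derive0 R d G G' j (Num.max M1 M2) _ dG cG' dG' _.
rewrite lt_max M10/= => /(_ isT) h.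
have {h} : \int[lam]_x G' x = 0.
  apply: h => x -[i +]; rewrite ge_max => /andP[i1 i2].
  rewrite /G /G' (M1P x); last by exists i.
  by rewrite (M2P x) ?mulr0 ?subrr//; exists i.
rewrite RintegralB//; last 2 first.
- by apply: RintegrableZl => //; exact: trig_integrable.
- exact: trig_integrable.
rewrite RintegralZl//; last exact: trig_integrable.
by move/eqP; rewrite subr_eq0 mulNr eqr_oppLR => /eqP.
Qed.

Lemma trig_pd2 v j k p xi : Cc_smooth v ->
  xi 0 j * (xi 0 k * trig v p xi) = - trig (pd j (pd k v)) p xi.
Proof.
move=> hv; rewrite trig_pd// mulrN trig_pd; last exact: Cc_smooth_pd.
rewrite -addrA -splitr trigDpi ?opprK//.
by apply: Cc_smooth_integrable; do 2 apply: Cc_smooth_pd.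
Qed.

Lemma trig_lin v1 v2 (c : R) p xi : Cc_smooth v1 -> Cc_smooth v2 ->
  trig (fun x => v1 x + c * v2 x) p xi = trig v1 p xi + c * trig v2 p xi.
Proof.
move=> h1 h2; have i1 := Cc_smooth_integrable h1; have i2 := Cc_smooth_integrable h2.
rewrite /trig -RintegralZl ?trig_integrable// -RintegralD//; last 2 first.
- exact: trig_integrable.
- by apply: RintegrableZl => //; exact: trig_integrable.
by apply: eq_Rintegral => x _; ring.
Qed.

(** Applying 1 - D_j^2 to v for every j multiplies its transform by the product of the 1 + xi_j^2,
    that is by 1 / [wt] xi; the new transform is bounded by an L^1 norm. *)
Lemma trig_decay v : Cc_smooth v -> exists C, forall p xi, `|trig v p xi| <= C * wt xi.
Proof.
move=> hv.
have [v' hv' E] : exists2 v', Cc_smooth v' & forall p xi,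
    \prod_(j < d) (1 + xi 0 j ^+ 2) * trig v p xi = trig v' p xi.
  elim: (index_enum 'I_d) v hv => [|j s IH] v hv.
    by exists v => // p xi; rewrite big_nil mul1r.
  have h2 : Cc_smooth (pd j (pd j v)) by do 2 apply: Cc_smooth_pd.
  have h3 : Cc_smooth (fun x => v x + (-1) * pd j (pd j v) x).
    by apply: Cc_smooth_add => //; exact: Cc_smooth_scale.
  have [v' hv' E] := IH _ h3; exists v' => // p xi.
  by rewrite big_cons -E trig_lin// mulN1r -trig_pd2//; ring.
exists (\int[lam]_x `|v' x|) => p xi.
have -> : trig v p xi = wt xi * trig v' p xi.
  rewrite -E mulrA /wt -big_split/= big1 ?mul1r// => j _.
  by rewrite mulVf// gt_eqF// lorentz_den_gt0.
rewrite normrM ger0_norm ?(ltW (wt_gt0 _))// mulrC ler_wpM2r ?(ltW (wt_gt0 _))//.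
exact: trig_le (Cc_smooth_integrable hv').
Qed.

Definition l1norm xi : R := \sum_(j < d) `|xi 0 j|.

(** The additional factor absorbs the quadratic growth of the symbol in xi. The l1 norm is used
    because its square is the sum of the |xi_j xi_k|, each of which is traded for two derivatives of
    v. *)
Lemma trig_decay2 v : Cc_smooth v ->
  exists C, forall p xi, (1 + l1norm xi ^+ 2) * `|trig v p xi| <= C * wt xi.
Proof.
move=> hv; have [C CP] := trig_decay hv.
have hjk j k : Cc_smooth (pd j (pd k v)) by do 2 apply: Cc_smooth_pd.
have [K KP] := choice (fun jk : 'I_d * 'I_d => trig_decay (hjk jk.1 jk.2)).
exists (C + \sum_j \sum_k K (j, k)) => p xi.
rewrite !mulrDl mul1r lerD// expr2 mulr_suml mulr_suml [leRHS]mulr_suml.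
apply: ler_sum => j _; rewrite mulr_sumr !mulr_suml.
apply: ler_sum => k _; rewrite -!normrM -mulrA trig_pd2// normrN.
exact: (KP (j, k)).
Qed.

Lemma Cc_trig_inversion v (w : 'rV[R]_d) : Cc_smooth v ->
  lam.-integrable setT (EFin \o (fun xi => trig v (dot w xi) xi)) /\
  \int[lam]_xi trig v (dot w xi) xi = (2 * pi) ^+ d * v w.
Proof.
move=> hv; have cv := Cc_smooth_continuous hv; have dv := Cc_smooth_dominated hv.
have [C CP] := trig_decay hv; have [K KP] := Cc_smooth_bounded hv.
split; last exact: trig_inversion KP CP.
apply: (@Rintegrable_le _ _ _ lam setT measurableT _ (fun x => C * wt x)) => //.
  by apply: measurable_trig => //; exact: measurable_fun_dot.
exact: RintegrableZl (integrable_wt R d).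
Qed.

Lemma normr_sin_le (t : R) : `|sin t| <= `|t|.
Proof.
wlog t0 : t / 0 <= t.
  move=> h; have [/h//|/ltW t0] := leP 0 t.
  by rewrite -normrN -sinN -[leRHS]normrN h// oppr_ge0.
have ds (x : R) : x \in `]0, t[ -> is_derive x 1 sin (cos x) by move=> _; exact: is_derive_sin.
have cs : {within `[0, t], continuous (@sin R)}.
  by apply: continuous_subspaceT; exact: continuous_sin.
have [c _] := MVT_segment t0 ds cs.
by rewrite sin0 !subr0 => ->; rewrite normrM ler_piMl// cos_max.
Qed.

Lemma one_sub_cos_le (t : R) : 0 <= 1 - cos t <= t ^+ 2 / 2.
Proof.
rewrite subr_ge0 cos_le1/=.
have -> : 1 - cos t = 2 * sin (t / 2) ^+ 2.
  have h := cos2Dsin2 (t / 2).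
  have -> : cos t = cos (t / 2) ^+ 2 - sin (t / 2) ^+ 2 by rewrite {1}[t]splitr cosD -!expr2.
  lra.
have -> : t ^+ 2 / 2 = 2 * (t / 2) ^+ 2 by field.
rewrite ler_pM2l// -[leLHS]real_normK ?num_real// -[leRHS]real_normK ?num_real//.
by rewrite lerXn2r ?nnegrE// normr_sin_le.
Qed.

(** A quadratic bound valid for all t, matching the integrability of |z|^2 near 0 under the Levy
    measure. For |t| > 1 it is trivial; for smaller t the mean value theorem and the bound on 1 -
    cos apply. *)
Lemma sin_sub_le (t : R) : `|sin t - t| <= 2 * t ^+ 2.
Proof.
wlog t0 : t / 0 <= t.
  move=> h; have [/h//|/ltW t0] := leP 0 t.
  have := h (- t); rewrite oppr_ge0 sinN sqrrN opprK => /(_ t0).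
  by rewrite -normrN opprD !opprK.
have [t1|t1] := leP t 1; last first.
  have := ler_normB (sin t) t; have := normr_sin_le t; rewrite [`|t|]ger0_norm//.
  have : t <= t ^+ 2 by rewrite expr2 ler_peMl// ltW.
  lra.
have dg (x : R) : is_derive x 1 (fun x : R => sin x - x) (cos x - 1).
  exact: is_deriveB (is_derive_sin x) (is_derive_id x 1).
have cg : {within `[0, t], continuous (fun x : R => sin x - x)}.
  apply: continuous_subspaceT => x; apply: differentiable_continuous.
  by apply/derivable1_diffP; apply: ex_derive; exact: dg.
have [c] := MVT_segment t0 (fun s _ => dg s) cg.
rewrite in_itv/= => /andP[c0 ct]; rewrite sin0 !subr0 => ->.
have /andP[h1 h2] := one_sub_cos_le c.
rewrite -opprB mulNr normrN ger0_norm; last by rewrite mulr_ge0.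
have c2t : c ^+ 2 <= t ^+ 2 by rewrite lerXn2r.
have t2 : 0 <= t ^+ 2 by rewrite sqr_ge0.
have h3 : (1 - cos c) * t <= (1 - cos c) by rewrite ler_piMr.
lra.
Qed.

End trig_decay.

Section enorm_theory.
Context (R : realType) (d : nat).
Implicit Types x y z : 'rV[R]_d.

Lemma dot_ge0 x : 0 <= dot x x.
Proof. by apply: sumr_ge0 => j _; rewrite -expr2 sqr_ge0. Qed.

Lemma enorm_ge0 x : 0 <= enorm x.
Proof. exact: sqrtr_ge0. Qed.

Lemma sqr_enorm x : enorm x ^+ 2 = dot x x.
Proof. by rewrite sqr_sqrtr// dot_ge0. Qed.

Lemma coord_le_enorm x j : `|x 0 j| <= enorm x.
Proof.
rewrite -ler_sqr ?nnegrE ?enorm_ge0// real_normK ?num_real// sqr_enorm.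
by rewrite /dot (bigD1 j)//= -expr2 lerDl sumr_ge0// => i _; rewrite -expr2 sqr_ge0.
Qed.

Lemma enorm0_eq0 x : enorm x = 0 -> x = 0.
Proof.
move=> x0; apply/rowP => j; rewrite mxE; apply/eqP; rewrite -normr_le0 -x0.
exact: coord_le_enorm.
Qed.

Lemma enorm0 : enorm (0 : 'rV[R]_d) = 0.
Proof. by rewrite /enorm /dot big1 ?sqrtr0// => j _; rewrite mxE mul0r. Qed.

Lemma dot_le_l1norm x xi : `|dot x xi| <= enorm x * l1norm xi.
Proof.
rewrite /dot (le_trans (ler_norm_sum _ _ _))// /l1norm mulr_sumr.
by apply: ler_sum => j _; rewrite normrM ler_wpM2r// coord_le_enorm.
Qed.

Lemma CauchySchwarz_dot x y : `|dot x y| <= enorm x * enorm y.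
Proof.
rewrite -ler_sqr ?nnegrE ?mulr_ge0 ?enorm_ge0//.
rewrite real_normK ?num_real// exprMn !sqr_enorm.
have h t : 0 <= dot x x - 2 * t * dot x y + t ^+ 2 * dot y y.
  have := dot_ge0 (x - t *: y).
  rewrite dotBl dotZl ![dot _ (x - _)]dotC !dotBl !dotZl [dot y x]dotC.
  by congr (0 <= _); ring.
have [y0|y0] := eqVneq (dot y y) 0.
  have := h (dot x y); rewrite y0 !mulr0 addr0 -mulrA -expr2 => h1.
  have [->|xy0] := eqVneq (dot x y) 0; first by rewrite expr0n.
  have p : 0 < dot x y ^+ 2 by rewrite exprn_even_gt0.
  (* Here the quadratic polynomial in t is affine with nonzero slope; this t makes it equal to - 3
     x.x - 2 < 0. *)
  have := h (dot x x / dot x y + dot x x / dot x y + (dot x y)^-1).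
  rewrite y0 mulr0 addr0.
  have -> : dot x x - 2 * (dot x x / dot x y + dot x x / dot x y + (dot x y)^-1) * dot x y
    = - 3 * dot x x - 2 by field.
  by have := dot_ge0 x; lra.
have yp : 0 < dot y y by rewrite lt_neqAle eq_sym y0 dot_ge0.
have := h (dot x y / dot y y).
have -> : dot x x - 2 * (dot x y / dot y y) * dot x y + (dot x y / dot y y) ^+ 2 * dot y y
  = dot x x - dot x y ^+ 2 / dot y y by field.
by rewrite subr_ge0 ler_pdivrMr.
Qed.

Lemma enorm_triangle x y : enorm (x + y) <= enorm x + enorm y.
Proof.
rewrite -ler_sqr ?nnegrE ?addr_ge0 ?enorm_ge0// sqrrD !sqr_enorm.
rewrite dotDl ![dot _ (x + y)]dotC !dotDl [dot y x]dotC.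
have := CauchySchwarz_dot x y; have := ler_norm (dot x y); lra.
Qed.

Lemma enormN x : enorm (- x) = enorm x.
Proof. by rewrite /enorm /dot; congr Num.sqrt; apply: eq_bigr => j _; rewrite !mxE mulrNN. Qed.

Lemma continuous_sqr_dist x : continuous (fun y => dot (y - x) (y - x)).
Proof.
apply: continuous_sum => j.
have h : continuous (fun y : 'rV[R]_d => (y - x) 0 j).
  under [X in continuous X]eq_fun do rewrite !mxE.
  by apply: continuous_add; [exact: continuous_rV|exact: continuous_cst].
exact: continuous_mul.
Qed.

Lemma continuous_enorm : continuous (@enorm R d).
Proof.
have : continuous (fun y : 'rV[R]_d => dot (y - 0) (y - 0)) by exact: continuous_sqr_dist.
move=> h; rewrite (_ : @enorm R d = Num.sqrt \o (fun y => dot (y - 0) (y - 0))).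
  apply: continuous_compose h _; exact: sqrt_continuous.
by apply/funext => y; rewrite /= subr0.
Qed.

Lemma measurable_enorm : measurable_fun setT (@enorm R d).
Proof. apply: continuous_measurable_rV; exact: continuous_enorm. Qed.

Lemma measurable_enorm_preimage (A : set R) : measurable A ->
  measurable [set z : 'rV[R]_d | A (enorm z)].
Proof.
move=> mA; have := measurable_enorm measurableT mA.
by rewrite setTI.
Qed.

End enorm_theory.

(** * The generator as a Levy operator *)

Section levy.
Context (R : realType) (d : nat) (nu : {measure set 'rV[R]_d -> \bar R}).
Hypothesis nu0 : nu [set 0] = 0%E.
Hypothesis nufin : (\int[nu]_z (Num.min 1 (enorm z ^+ 2))%:E < +oo)%E.

Definition levy_min (z : 'rV[R]_d) : R := Num.min 1 (enorm z ^+ 2).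

Lemma levy_min_ge0 z : 0 <= levy_min z.
Proof. by rewrite /levy_min le_min ler01 sqr_ge0. Qed.

Lemma measurable_levy_min : measurable_fun setT levy_min.
Proof.
apply: measurable_minr => //.
by apply: measurable_funX; exact: measurable_enorm.
Qed.

Lemma integrable_levy_min : nu.-integrable setT (EFin \o levy_min).
Proof.
apply/integrableP; split; first by apply/measurable_EFinP; exact: measurable_levy_min.
apply: le_lt_trans nufin; rewrite le_eqVlt; apply/orP; left; apply/eqP.
by apply: eq_integral => z _ /=; rewrite ger0_norm// levy_min_ge0.
Qed.

Lemma levy_tail_fin (e : R) : 0 < e -> (nu [set z | e < enorm z]%R < +oo)%E.
Proof.
move=> e0.
have mE : measurable [set z : 'rV[R]_d | e < enorm z].
  have -> : [set z : 'rV[R]_d | e < enorm z] = [set z | `]e, +oo[%classic (enorm z)].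
    by apply/seteqP; split => z /=; rewrite in_itv/= andbT.
  exact: measurable_enorm_preimage.
pose c := Num.min 1 (e ^+ 2).
have c0 : 0 < c by rewrite lt_min ltr01 exprn_gt0.
rewrite -[X in nu X]setIT -integral_indic//.
apply: (@le_lt_trans _ _ (\int[nu]_z (c^-1 * levy_min z)%:E)%E).
  apply: ge0_le_integral => //=.
  - by apply/measurable_EFinP; exact: measurable_indic.
  - by apply/measurable_EFinP; apply: measurable_funM => //; exact: measurable_levy_min.
  - move=> z _; rewrite lee_fin indicE; case: (boolP (z \in _)) => [|_].
      rewrite inE/= => ez; rewrite ler_pdivlMl// mulr1 /c /levy_min.
      by rewrite le_min !ge_min lexx/= lerXn2r ?orbT ?nnegrE ?enorm_ge0// ltW.
    by rewrite mulr_ge0// ?levy_min_ge0// invr_ge0 ltW.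
apply: integrable_lty => //.
exact: RintegrableZl integrable_levy_min.
Qed.

(** The tails |z| > 1/(n+1) have finite mass and exhaust all but the origin, which is null and is
    added to each of them. *)
Lemma levy_sigma_finite : sigma_finite setT nu.
Proof.
pose E (n : nat) := [set z : 'rV[R]_d | n.+1%:R^-1 < enorm z].
have mE n : measurable (E n).
  rewrite (_ : E n = [set z | `]n.+1%:R^-1, +oo[%classic (enorm z)]).
    exact: measurable_enorm_preimage.
  by apply/seteqP; split => z; rewrite /E /= in_itv/= andbT.
have m0 : measurable [set 0 : 'rV[R]_d].
  rewrite (_ : [set 0] = [set z : 'rV[R]_d | [set 0 : R] (enorm z)]).
    exact: measurable_enorm_preimage.
  apply/seteqP; split => z /=; first by move->; exact: enorm0.
  exact: enorm0_eq0.
pose F n := E n `|` [set 0].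
have mF n : measurable (F n) by exact: measurableU.
exists F.
  apply/seteqP; split => // z _.
  have [->|z0] := eqVneq z 0; first by exists 0; [|right].
  have ez : 0 < enorm z.
    rewrite lt_neqAle enorm_ge0 andbT eq_sym; apply: contra z0 => /eqP/enorm0_eq0 ->.
    exact: eqxx.
  exists (Num.bound (enorm z)^-1) => //; left; rewrite /E /=.
  rewrite invf_plt ?posrE// (lt_le_trans (archi_boundP _)) ?ler_nat//.
  by rewrite invr_ge0 ltW.
move=> n; split => //; apply: (@le_lt_trans _ _ (nu (E n) + nu [set 0%R])%E).
  exact: measureU2.
by rewrite nu0 adde0 levy_tail_fin.
Qed.

End levy.

Lemma Rintegral_linear_comb dT (T : measurableType dT) (R : realType)
    (mu : {measure set T -> \bar R}) (I : finType) (c V : I -> R) (F : I -> T -> R) :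
  (forall i, mu.-integrable setT (EFin \o F i)) -> (forall i, \int[mu]_x F i x = V i) ->
  mu.-integrable setT (EFin \o (fun x => \sum_i c i * F i x)) /\
  \int[mu]_x (\sum_i c i * F i x) = \sum_i c i * V i.
Proof.
move=> iF FV.
have h i : mu.-integrable setT (EFin \o (fun x => c i * F i x)) by exact: RintegrableZl.
split; first exact: (Rintegrable_sum measurableT _ h).
rewrite (Rintegral_sum measurableT _ h); apply: eq_bigr => i _.
by rewrite RintegralZl// FV.
Qed.

Section generator_formula.
Context (R : realType) (d : nat).
Local Notation lam := (lebesgue_rV R d).
Variables (a : 'rV[R]_d -> 'M[R]_d) (b : 'rV[R]_d -> 'rV[R]_d).
Variable nu : R.-ker 'rV[R]_d ~> 'rV[R]_d.
Hypothesis levy_nu : levy_kernel nu.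
Implicit Types (v : 'rV[R]_d -> R) (y z xi : 'rV[R]_d).

Definition jump_term v y z : R :=
  v (y + z) - v y - (enorm z <= 1)%R%:R * \sum_j z 0 j * pd j v y.

Definition levy_operator v y : R :=
  2^-1 * (\sum_j \sum_k a y j k * pd j (pd k v) y) + \sum_j b y 0 j * pd j v y
  + \int[nu y]_z jump_term v y z.

(** Real and imaginary parts of the symbol. The jump integrals run over the whole space, since the
    integrands vanish at z = 0. *)
Let symR y xi := 2^-1 * dot xi (xi *m (a y)^T) + \int[nu y]_z (1 - cos (dot z xi)).
Let symI y xi := - dot (b y) xi +
  \int[nu y]_z (dot z xi * (enorm z <= 1)%R%:R - sin (dot z xi)).

Let Re_symbol y xi : complex.Re (symbol a b nu y xi) = symR y xi.
Proof.
rewrite /symbol /= subr0; congr (_ + _).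
rewrite [LHS]Rintegral_mkcond; apply: eq_Rintegral => z _; rewrite patchE.
case: ifPn => [_|]; first by rewrite /= addr0.
rewrite notin_setE /= => /contrapT ->.
by rewrite /dot big1 ?cos0 ?subrr// => j _; rewrite mxE mul0r.
Qed.

Let Im_symbol y xi : complex.Im (symbol a b nu y xi) = symI y xi.
Proof.
rewrite /symbol /= sub0r; congr (_ + _).
rewrite [LHS]Rintegral_mkcond; apply: eq_Rintegral => z _; rewrite patchE.
case: ifPn => [_|]; first by rewrite /= sub0r addrC.
rewrite notin_setE /= => /contrapT ->.
by rewrite /dot big1 ?sin0 ?mul0r ?subrr// => j _; rewrite mxE mul0r.
Qed.

Let Re_fourier v xi : Cc_smooth v ->
  complex.Re (fourier v xi) = (2 * pi) ^- d * trig v 0 xi.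
Proof.
move=> hv; rewrite /fourier /trig /= mul0r subr0; congr (_ * _).
by apply: eq_Rintegral => x _; rewrite /= mulr0 subr0 sub0r.
Qed.

Let Im_fourier v xi : Cc_smooth v ->
  complex.Im (fourier v xi) = - ((2 * pi) ^- d * trig v (pi / 2) xi).
Proof.
move=> hv; rewrite /fourier /trig /= mul0r addr0 -mulrN; congr (_ * _).
rewrite -RintegralN//; last exact: trig_integrable (Cc_smooth_integrable hv).
apply: eq_Rintegral => x _; rewrite /= mulr0 add0r addrC cosDpihalf; ring.
Qed.

(** The image under the generator is real-valued, so taking real parts loses nothing. The factor
    exp(i y.xi) is absorbed into the phase of the transforms. *)
Let Re_integrand v y xi : Cc_smooth v ->
  complex.Re (expi (dot y xi) * symbol a b nu y xi * fourier v xi)%C =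
  (2 * pi) ^- d * (symR y xi * trig v (dot y xi) xi + symI y xi * trig v (dot y xi + pi / 2) xi).
Proof.
move=> hv; have iv := Cc_smooth_integrable hv.
move: (Re_symbol y xi) (Im_symbol y xi) (Re_fourier xi hv) (Im_fourier xi hv).
case: (symbol a b nu y xi) => p1 p2; case: (fourier v xi) => q1 q2 /= -> -> -> ->.
have e1 : trig v (dot y xi) xi = cos (dot y xi) * trig v 0 xi + sin (dot y xi) * trig v (pi / 2) xi.
  by have := trigD 0 (dot y xi) xi iv; rewrite !add0r.
have e2 : trig v (dot y xi + pi / 2) xi = cos (dot y xi) * trig v (pi / 2) xi - sin (dot y xi) * trig v 0 xi.
  rewrite addrC trigD// -splitr; congr (_ + _).
  by have := trigDpi 0 xi iv; rewrite add0r => ->; rewrite mulrN.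
rewrite e1 e2; ring.
Qed.

(** A bound of product form, in z times in xi, as Fubini requires: [levy_min] is [nu]-integrable and
    the factor in xi is compensated by [trig_decay2]. *)
Let one_sub_cos_bound z xi :
  `|1 - cos (dot z xi)| <= levy_min z * (2 * (1 + l1norm xi ^+ 2)).
Proof.
have /andP[h1 h2] := one_sub_cos_le (dot z xi); rewrite ger0_norm//.
have L2 : 0 <= l1norm xi ^+ 2 by rewrite sqr_ge0.
rewrite /levy_min; case: (leP 1 (enorm z ^+ 2)) => [z1|z1].
  by have := cos_geN1 (dot z xi); lra.
apply: (le_trans h2).
have h3 : dot z xi ^+ 2 <= enorm z ^+ 2 * l1norm xi ^+ 2.
  rewrite -exprMn -[leLHS]real_normK ?num_real//.
  rewrite lerXn2r ?nnegrE ?mulr_ge0 ?enorm_ge0 ?sumr_ge0//; exact: dot_le_l1norm.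
have := mulr_ge0 (sqr_ge0 (enorm z)) L2; have := sqr_ge0 (enorm z); lra.
Qed.

Let sin_bound z xi :
  `|dot z xi * (enorm z <= 1)%R%:R - sin (dot z xi)| <= levy_min z * (2 * (1 + l1norm xi ^+ 2)).
Proof.
have L2 : 0 <= l1norm xi ^+ 2 by rewrite sqr_ge0.
rewrite /levy_min; case: (leP (enorm z) 1) => z1.
  rewrite mulr1 distrC (le_trans (sin_sub_le _))//.
  rewrite (min_idPr _); last by rewrite exprn_ile1 ?enorm_ge0.
  have h3 : dot z xi ^+ 2 <= enorm z ^+ 2 * l1norm xi ^+ 2.
    rewrite -exprMn -[leLHS]real_normK ?num_real//.
    rewrite lerXn2r ?nnegrE ?mulr_ge0 ?enorm_ge0 ?sumr_ge0//; exact: dot_le_l1norm.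
  have := mulr_ge0 (sqr_ge0 (enorm z)) L2; have := sqr_ge0 (enorm z); lra.
rewrite mulr0 sub0r normrN (min_idPl _); last by rewrite exprn_ege1// ltW.
by have := sin_max (dot z xi); lra.
Qed.

(** The jump part of the symbol is itself an integral in z. Exchanging it with the integral in xi
    allows inversion for each fixed z; integrability of the jump term is a by-product of Fubini. *)
Lemma levy_operatorE v y : Cc_smooth v ->
  (nu y).-integrable setT (EFin \o jump_term v y) /\
  complex.Re (pseudo_diff (symbol a b nu) v y) = levy_operator v y.
Proof.
move=> hv; have [nu0 nufin] := levy_nu y.
have iv := Cc_smooth_integrable hv; have cv := Cc_smooth_continuous hv.
have dv := Cc_smooth_dominated hv.
pose ind z : R := (enorm z <= 1)%R%:R.
pose C xi := trig v (dot y xi) xi; pose S xi := trig v (dot y xi + pi / 2) xi.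
pose f (p : 'rV[R]_d * 'rV[R]_d) := (cos (dot p.1 p.2) - 1) * C p.2 +
  (sin (dot p.1 p.2) - dot p.1 p.2 * ind p.1) * S p.2.
have [K KP] := trig_decay2 hv.
have mind : measurable_fun setT ind.
  rewrite (_ : ind = \1_[set z | `]-oo, 1]%classic (enorm z)]).
    by apply: measurable_indic; exact: measurable_enorm_preimage.
  apply/funext => z; rewrite indicE /ind; congr (_%:R).
  by congr nat_of_bool; apply/idP/idP; rewrite inE /= in_itv/=.
have mdy : measurable_fun setT (fun xi => dot y xi) by exact: measurable_fun_dot.
have mC : measurable_fun setT C by apply: measurable_trig.
have mS : measurable_fun setT S.
  by apply: measurable_trig => //; exact: measurable_funD.
have mcos : measurable_fun setT (@cos R) by exact: continuous_measurable_fun (@continuous_cos R).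
have msin : measurable_fun setT (@sin R) by exact: continuous_measurable_fun (@continuous_sin R).
have mf : measurable_fun setT f.
  have md : measurable_fun setT (fun p : 'rV[R]_d * 'rV[R]_d => dot p.1 p.2).
    by apply: measurable_fun_dot; [exact: measurable_fst|exact: measurable_snd].
  apply: measurable_funD; apply: measurable_funM.
  - by apply: measurable_funB => //; exact: measurableT_comp mcos md.
  - exact: measurableT_comp mC measurable_snd.
  - apply: measurable_funB; first exact: measurableT_comp msin md.
    by apply: measurable_funM => //; exact: measurableT_comp mind measurable_fst.
  - exact: measurableT_comp mS measurable_snd.
have ilm := integrable_levy_min nufin.
have sg := levy_sigma_finite nu0 nufin.
have fb z xi : `|f (z, xi)| <= levy_min z * (4 * K * wt xi).
  rewrite /f/= (le_trans (ler_normD _ _))// !normrM.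
  rewrite [`|cos _ - 1|]distrC [`|sin _ - _|]distrC.
  have h1 := ler_wpM2r (normr_ge0 (C xi)) (one_sub_cos_bound z xi).
  have h2 := ler_wpM2r (normr_ge0 (S xi)) (sin_bound z xi).
  apply: (le_trans (lerD h1 h2)).
  rewrite -!mulrA -mulrDr ler_wpM2l ?levy_min_ge0//.
  have := KP (dot y xi) xi; have := KP (dot y xi + pi / 2) xi.
  by rewrite -/(C xi) -/(S xi); lra.
have iz (c : R) (g : 'rV[R]_d -> R) : measurable_fun setT g -> (forall z, `|g z| <= levy_min z * c) ->
    (nu y).-integrable setT (EFin \o g).
  move=> mg gb; apply: (@Rintegrable_le _ _ _ (nu y) setT measurableT _ (fun z => levy_min z * c)) => //.
  exact: RintegrableZr ilm.
have mdz xi : measurable_fun setT (fun z : 'rV[R]_d => dot z xi) by exact: measurable_fun_dot.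
have i1 xi : (nu y).-integrable setT (EFin \o (fun z => 1 - cos (dot z xi))).
  apply: (iz _ _ _ (one_sub_cos_bound^~ xi)).
  by apply: measurable_funB => //; exact: measurableT_comp mcos (mdz xi).
have i2 xi : (nu y).-integrable setT (EFin \o (fun z => dot z xi * ind z - sin (dot z xi))).
  apply: (iz _ _ _ (sin_bound^~ xi)); apply: measurable_funB.
    exact: measurable_funM.
  exact: measurableT_comp msin (mdz xi).
have [if1 if2 E] := @Rintegral_Fubini _ _ _ _ R (nu y) lam f _ _ sg
  (lebesgue_rV_sigma_finite R d) mf ilm
  (@RintegrableZl _ _ _ lam _ measurableT (4 * K) _ (integrable_wt R d)) fb.
have Ez xi : \int[nu y]_z f (z, xi) =
    - ((\int[nu y]_z (1 - cos (dot z xi))) * C xi +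
       (\int[nu y]_z (dot z xi * ind z - sin (dot z xi))) * S xi).
  rewrite -!RintegralZr// -RintegralD//; [|exact: RintegrableZr..].
  rewrite -RintegralN//; last by apply: RintegrableD => //; exact: RintegrableZr.
  by apply: eq_Rintegral => z _; rewrite /f/=; ring.
have hp j := Cc_smooth_pd j hv.
have hpp j k := Cc_smooth_pd j (Cc_smooth_pd k hv).
have S1 xi j : xi 0 j * S xi = trig (pd j v) (dot y xi) xi.
  rewrite /S trig_pd// -addrA -splitr trigDpi ?opprK//.
  exact: Cc_smooth_integrable (hp j).
(* By the addition formula, cos(z.xi) and sin(z.xi) move the phase from y to y + z, so inversion
   produces v(y + z); the compensator is inverted through the partial derivatives. *)
have Exi z : \int[lam]_xi f (z, xi) = (2 * pi) ^+ d * jump_term v y z.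
  have [j0 e0] := Cc_trig_inversion (y + z) hv.
  have [j1 e1] := Cc_trig_inversion y hv.
  pose T xi := \sum_j z 0 j * trig (pd j v) (dot y xi) xi.
  have jj j : lam.-integrable setT (EFin \o (fun xi => z 0 j * trig (pd j v) (dot y xi) xi)).
    by apply: RintegrableZl => //; exact: (Cc_trig_inversion y (hp j)).1.
  have jT : lam.-integrable setT (EFin \o T) by exact: Rintegrable_sum.
  transitivity (\int[lam]_xi ((trig v (dot (y + z) xi) xi - C xi) - ind z * T xi)).
    apply: eq_Rintegral => xi _.
    rewrite dotDl trigD// /f/= -/(C xi) -/(S xi).
    have -> : T xi = dot z xi * S xi.
      by rewrite /dot mulr_suml; apply: eq_bigr => j _; rewrite -mulrA S1.
    ring.
  rewrite RintegralB//; [|exact: RintegrableB|exact: RintegrableZl].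
  rewrite RintegralB// RintegralZl// e0 e1 Rintegral_sum//.
  rewrite /jump_term !mulrBr; congr (_ - _); rewrite mulrCA; congr (_ * _).
  rewrite mulr_sumr; apply: eq_bigr => j _.
  have [j2 e2] := Cc_trig_inversion y (hp j).
  by rewrite RintegralZl// e2 mulrCA.
have pi0 : (2 * pi) ^+ d != 0 :> R by rewrite expf_neq0// mulf_neq0// gt_eqF// pi_gt0.
have ij : (nu y).-integrable setT (EFin \o jump_term v y).
  have := @RintegrableZl _ _ _ (nu y) setT measurableT ((2 * pi) ^- d) _ if1.
  by apply: eq_integrable => // z _ /=; rewrite Exi mulKf.
split => //.
pose Q xi := 2^-1 * (\sum_j \sum_k a y j k * trig (pd j (pd k v)) (dot y xi) xi) +
  \sum_j b y 0 j * trig (pd j v) (dot y xi) xi.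
have QE xi : 2^-1 * dot xi (xi *m (a y)^T) * C xi - dot (b y) xi * S xi = - Q xi.
  rewrite /Q opprD; congr (_ + _).
    rewrite -mulrA -mulrN; congr (_ * _); rewrite /dot mulr_suml -sumrN.
    apply: eq_bigr => j _; rewrite mxE mulr_sumr mulr_suml -sumrN.
    apply: eq_bigr => k _; rewrite mxE -mulrN -trig_pd2// /C; ring.
  rewrite /dot mulr_suml -sumrN -[RHS]sumrN; apply: eq_bigr => j _.
  by rewrite -mulrA S1.
have [iA IA] : lam.-integrable setT (EFin \o (fun xi => \sum_j \sum_k a y j k * trig (pd j (pd k v)) (dot y xi) xi)) /\
    \int[lam]_xi (\sum_j \sum_k a y j k * trig (pd j (pd k v)) (dot y xi) xi) =
    (2 * pi) ^+ d * \sum_j \sum_k a y j k * pd j (pd k v) y.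
  have h j := @Rintegral_linear_comb _ _ R lam _ (a y j) (fun k => (2 * pi) ^+ d * pd j (pd k v) y)
    (fun k xi => trig (pd j (pd k v)) (dot y xi) xi)
    (fun k => (Cc_trig_inversion y (hpp j k)).1) (fun k => (Cc_trig_inversion y (hpp j k)).2).
  split; first exact: (Rintegrable_sum measurableT _ (fun j => (h j).1)).
  rewrite (Rintegral_sum measurableT _ (fun j => (h j).1)) mulr_sumr.
  apply: eq_bigr => j _; rewrite (h j).2 mulr_sumr; apply: eq_bigr => k _; exact: mulrCA.
have [iB IB] := @Rintegral_linear_comb _ _ R lam _ (fun j => b y 0 j) (fun j => (2 * pi) ^+ d * pd j v y)
    (fun j xi => trig (pd j v) (dot y xi) xi)
    (fun j => (Cc_trig_inversion y (hp j)).1) (fun j => (Cc_trig_inversion y (hp j)).2).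
have iQ : lam.-integrable setT (EFin \o Q).
  exact: (RintegrableD measurableT (RintegrableZl measurableT 2^-1 iA) iB).
have IQ : \int[lam]_xi Q xi = (2 * pi) ^+ d *
   (2^-1 * (\sum_j \sum_k a y j k * pd j (pd k v) y) + \sum_j b y 0 j * pd j v y).
  rewrite (RintegralD measurableT (RintegrableZl measurableT 2^-1 iA) iB).
  rewrite (RintegralZl _ measurableT iA) IA IB [RHS]mulrDr; congr (_ + _).
    exact: mulrCA.
  by rewrite mulr_sumr; apply: eq_bigr => j _; exact: mulrCA.
have E2 xi : complex.Re (expi (dot y xi) * symbol a b nu y xi * fourier v xi)%C =
    (2 * pi) ^- d * (- Q xi - \int[nu y]_z f (z, xi)).
  rewrite Re_integrand//; congr (_ * _); rewrite -QE Ez /symR /symI /C /S /ind.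
  ring.
have -> : complex.Re (pseudo_diff (symbol a b nu) v y) =
   - \int[lam]_xi ((2 * pi) ^- d * (- Q xi - \int[nu y]_z f (z, xi))).
  transitivity (- \int[lam]_xi complex.Re (expi (dot y xi) * symbol a b nu y xi * fourier v xi)%C).
    by [].
  by congr (- _); apply: eq_Rintegral => xi _; exact: E2.
have iNQ := RintegrableN measurableT iQ.
rewrite (RintegralZl _ measurableT (RintegrableB measurableT iNQ if2)).
rewrite (RintegralB measurableT iNQ if2) (RintegralN measurableT iQ) IQ -E.
have -> : \int[nu y]_z \int[lam]_xi f (z, xi) = (2 * pi) ^+ d * \int[nu y]_z jump_term v y z.
  by rewrite -(RintegralZl _ measurableT ij); apply: eq_Rintegral => z _; rewrite Exi.
by rewrite /levy_operator; field.
Qed.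

End generator_formula.

(** * Test functions *)

Section flat_exponential.
Context (R : realType).
Implicit Types (s t : R).

(** The classical flat function exp(- 1/t), multiplied by powers of 1/t so that derivatives stay in
    the linear span of the family. *)
Definition flat_exp (n : nat) t : R := if 0 < t then t^-1 ^+ n * expR (- t^-1) else 0.

Lemma flat_exp_le0 n t : t <= 0 -> flat_exp n t = 0.
Proof. by rewrite /flat_exp ltNge => ->. Qed.

Lemma flat_exp_ge0 n t : 0 <= flat_exp n t.
Proof. by rewrite /flat_exp; case: ifP => // t0; rewrite mulr_ge0 ?expR_ge0// exprn_ge0// invr_ge0 ltW. Qed.

(** Keeping one term of the exponential series, exp(u) >= u^(n+2) / (n+2)! at u = 1/t. The quadratic
    bound gives derivative 0 at the origin. *)
Lemma flat_exp_le n t : flat_exp n t <= n.+2`!%:R * t ^+ 2.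
Proof.
rewrite /flat_exp; case: ifPn => [t0|_]; last by rewrite mulr_ge0// sqr_ge0.
have u0 : 0 < t^-1 by rewrite invr_gt0.
rewrite expRN ler_pdivrMr ?expR_gt0//.
have h : t^-1 ^+ n.+2 / n.+2`!%:R <= expR t^-1.
  have := expR_ge1Dxn n.+1 (ltW u0); lra.
have f0 : 0 < n.+2`!%:R :> R by rewrite ltr0n fact_gt0.
move: h; rewrite ler_pdivrMr// => h.
have -> : t^-1 ^+ n = t^-1 ^+ n.+2 * t ^+ 2.
  by rewrite -addn2 exprD mulrAC -mulrA -exprMn mulfV ?gt_eqF// expr1n mulr1.
have := ler_wpM2r (sqr_ge0 t) h; lra.
Qed.

Lemma is_derive_flat_exp n t :
  is_derive t 1 (flat_exp n) (flat_exp n.+2 t - n%:R * flat_exp n.+1 t).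
Proof.
have [t0|t0|t0] := ltgtP 0 t.
- apply: (@near_eq_is_derive _ _ _ (fun t : R => t^-1 ^+ n * expR (- t^-1))).
    near=> s; rewrite /flat_exp ifT//; near: s; exact: lt_nbhsr.
  have dV : is_derive t 1 (fun s : R => s^-1) (- t ^- 2).
    have := @is_deriveV R id t 1 1 (lt0r_neq0 t0) (is_derive_id t 1).
    by rewrite /GRing.scale/= mulr1.
  have dE : is_derive t 1 (expR \o (fun s : R => - s^-1)) (expR (- t^-1) * (t ^- 2)).
    have := @is_derive1_comp R expR (fun s => - s^-1) t _ _ (is_derive_expR _) (is_deriveN dV).
    by rewrite opprK.
  have dP : is_derive t 1 (fun s : R => s^-1 ^+ n) (- (n%:R * t^-1 ^+ n.+1)).
    elim: n => [|m IH]; first by rewrite mul0r oppr0; exact: is_derive_cst.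
    rewrite (_ : (fun s : R => s^-1 ^+ m.+1) = (fun s : R => s^-1) * (fun s : R => s^-1 ^+ m)); last first.
      by apply/funext => s; rewrite exprS.
    have h := is_deriveM dV IH; apply: is_derive_eq h _.
    by rewrite /GRing.scale/= -exprVn !exprS -[m.+1%:R]natr1; ring.
  have := is_deriveM dP dE => h; apply: is_derive_eq h _.
  rewrite /flat_exp t0 /GRing.scale/= -exprVn.
  by rewrite mulrN !exprS; ring.
- rewrite !flat_exp_le0 ?ltW// mulr0 subrr.
  apply: (@near_eq_is_derive _ _ _ (cst 0)).
    near=> s; rewrite flat_exp_le0// ltW//; near: s; exact: lt_nbhsl.
- rewrite -t0 !flat_exp_le0// mulr0 subrr.
  pose K : R := n.+2`!%:R.
  have H : (fun h : R => h^-1 *: ((flat_exp n \o shift 0) (h *: 1) - flat_exp n 0)) @ 0^' --> (0 : R).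
    apply: norm_cvg0.
    apply: (@squeeze_cvgr _ _ _ _ (cst 0) (fun h : R => K * `|h|)).
    - near=> h; rewrite normr_ge0/= addr0 [h *: 1]mulr1 (flat_exp_le0 _ (lexx 0)) subr0.
      have h0 : h != 0 by near: h; exact: nbhs_dnbhs_neq.
      rewrite normrM [`|flat_exp n h|]ger0_norm ?flat_exp_ge0// normfV ler_pdivrMl ?normr_gt0//.
      rewrite (le_trans (flat_exp_le n h))// -/K -[h ^+ 2]real_normK ?num_real// expr2.
      by rewrite mulrCA mulrA.
    - exact: cvg_cst.
    - rewrite -[X in _ --> X](mulr0 K) -[X in K * X](normr0 R); apply: cvgM; first exact: cvg_cst.
      apply: cvg_norm; exact: cvg_within.
  apply: DeriveDef; first exact: (cvgP _ H).
  exact: cvg_lim H.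
Unshelve. all: end_near. Qed.

Lemma flat_exp0_le s t : s <= t -> flat_exp 0 s <= flat_exp 0 t.
Proof.
rewrite /flat_exp !expr0 !mul1r => st; case: ifPn => [s0|_].
  by rewrite (lt_le_trans s0 st) ler_expR lerN2 lef_pV2// posrE// (lt_le_trans s0).
by case: ifP => // _; exact: expR_ge0.
Qed.

Lemma flat_exp01 : flat_exp 0 1 = expR (- 1).
Proof. by rewrite /flat_exp ltr01 expr0 mul1r invr1. Qed.

(* A class of functions closed under derivation, whence the smoothness of [flat_exp 0]. *)
Inductive flat_span : (R -> R) -> Prop :=
| flat_span_gen n : flat_span (flat_exp n)
| flat_span_comb (c : R) (f g : R -> R) : flat_span f -> flat_span g ->
    flat_span (fun t => f t + c * g t).

Lemma flat_span_derive f : flat_span f ->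
  exists2 f', flat_span f' & forall t, is_derive t 1 f (f' t).
Proof.
elim=> [n|c {}f g _ [f' sf' df'] _ [g' sg' dg']].
  exists (fun t => flat_exp n.+2 t + (- n%:R) * flat_exp n.+1 t).
    by apply: flat_span_comb; exact: flat_span_gen.
  by move=> t; have := is_derive_flat_exp n t; rewrite mulNr.
exists (fun t => f' t + c * g' t); first exact: flat_span_comb.
move=> t; exact: is_deriveD (df' t) (is_deriveZ c (dg' t)).
Qed.

(** With phi = [flat_exp 0], this is e phi(1 - phi(s - a) / phi(b - a)). The inner argument is 1 for
    s <= a and nonpositive for s >= b, and e normalises phi(1) = e^(-1). Nesting phi, instead of
    forming the usual quotient, leaves only compositions to be differentiated. *)
Definition smooth_step (a b s : R) : R :=
  expR 1 * flat_exp 0 (1 - (flat_exp 0 (b - a))^-1 * flat_exp 0 (s - a)).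

Lemma smooth_step1 a b s : s <= a -> smooth_step a b s = 1.
Proof.
move=> sa; rewrite /smooth_step [flat_exp 0 (s - a)]flat_exp_le0 ?subr_le0//.
by rewrite mulr0 subr0 flat_exp01 -expRD subrr expR0.
Qed.

Lemma smooth_step0 a b s : a < b -> b <= s -> smooth_step a b s = 0.
Proof.
move=> ab bs; rewrite /smooth_step [X in _ * X]flat_exp_le0 ?mulr0//.
have p : 0 < flat_exp 0 (b - a) by rewrite /flat_exp subr_gt0 ab expr0 mul1r expR_gt0.
by rewrite subr_le0 ler_pdivlMl// mulr1 flat_exp0_le// lerD2r.
Qed.

Lemma smooth_step_ge0 a b s : 0 <= smooth_step a b s.
Proof. by rewrite mulr_ge0 ?expR_ge0 ?flat_exp_ge0. Qed.

Lemma smooth_step_le1 a b s : smooth_step a b s <= 1.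
Proof.
have -> : 1 = expR 1 * flat_exp 0 1 by rewrite flat_exp01 -expRD subrr expR0.
rewrite ler_pM2l ?expR_gt0// flat_exp0_le// lerBlDr lerDl.
by rewrite mulr_ge0 ?flat_exp_ge0// invr_ge0 flat_exp_ge0.
Qed.

End flat_exponential.

Section radial_functions.
Context (R : realType) (d : nat) (x : 'rV[R]_d).
Implicit Types (u v : 'rV[R]_d -> R) (y z : 'rV[R]_d) (a b c : R).

(** Squared, hence a polynomial that is smooth at x as well; the radii passed to [cutoff] are
    therefore squared too. *)
Definition sqdist y : R := dot (y - x) (y - x).

Lemma sqdistE y : sqdist y = enorm (y - x) ^+ 2.
Proof. by rewrite sqr_enorm. Qed.

Lemma Ck_sum k (I : Type) (s : seq I) (F : I -> 'rV[R]_d -> R) :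
  (forall i, Ck k (F i)) -> Ck k (fun y => \sum_(i <- s) F i y).
Proof.
move=> hF; elim: s => [|i s IH].
  by rewrite (_ : (fun _ => _) = fun=> 0); [exact: Ck_cst|apply/funext => y; rewrite big_nil].
rewrite (_ : (fun _ => _) = (fun y => F i y + \sum_(i <- s) F i y)); first exact: Ck_add.
by apply/funext => y; rewrite big_cons.
Qed.

Lemma is_derive_coord j i y : is_derive y (delta_mx 0 i) (fun y => (y - x) 0 j) (i == j)%:R.
Proof.
suff : is_derive (0 *: delta_mx 0 i + y) (delta_mx 0 i) (fun y => (y - x) 0 j) (i == j)%:R.
  by rewrite scale0r add0r.
apply: (proj2 (@is_derive_along _ _ (fun y => (y - x) 0 j) y (delta_mx 0 i) 0 _)).
rewrite (_ : (fun h => _) = (fun h : R => (y - x) 0 j + (i == j)%:R * h)); last first.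
  by apply/funext => h; rewrite !mxE/= eq_sym; ring.
exact: is_derive_affine.
Qed.

Lemma continuous_coord_sub j : continuous (fun y => (y - x) 0 j).
Proof.
under [X in continuous X]eq_fun do rewrite !mxE.
by apply: continuous_add; [exact: continuous_rV|exact: continuous_cst].
Qed.

Lemma Ck_coord k j : Ck k (fun y => (y - x) 0 j).
Proof.
case: k => [|k]; first by split => //; exact: continuous_coord_sub.
apply: (@Ck_intro _ _ _ _ (fun i _ => (i == j)%:R)).
- exact: continuous_coord_sub.
- by move=> i y; exact: is_derive_coord.
- by move=> i; exact: Ck_cst.
Qed.

Lemma Ck_sqdist k : Ck k sqdist.
Proof. by apply: Ck_sum => j; apply: Ck_mul; exact: Ck_coord. Qed.

Lemma is_derive_sqdist j y : is_derive y (delta_mx 0 j) sqdist (2 * (y - x) 0 j).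
Proof.
suff : is_derive (0 *: delta_mx 0 j + y) (delta_mx 0 j) sqdist (2 * (y - x) 0 j).
  by rewrite scale0r add0r.
apply: (proj2 (@is_derive_along _ _ sqdist y (delta_mx 0 j) 0 _)).
have -> : (fun h : R => sqdist (h *: delta_mx 0 j + y)) =
   (fun h => sqdist y + 2 * (y - x) 0 j * h + h * h).
  apply/funext => h; rewrite /sqdist -[h *: _ + y - x]addrA; set w := y - x.
  rewrite dotDl dotZl dot_delta [dot w _]dotC dotDl dotZl dot_delta.
  have -> : (h *: delta_mx 0 j + w) 0 j = h + w 0 j by rewrite !mxE !eqxx mulr1.
  ring.
have := is_deriveD (is_derive_affine (sqdist y) (2 * (y - x) 0 j) 0) (is_deriveM (is_derive_id (0 : R) 1) (is_derive_id (0 : R) 1)).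
by rewrite !scale0r !addr0.
Qed.

Lemma is_derive_radial (f f' : R -> R) u (D : 'I_d -> 'rV[R]_d -> R) j y :
  (forall t : R, is_derive t 1 f (f' t)) ->
  is_derive y (delta_mx 0 j) u (D j y) -> is_derive y (delta_mx 0 j) (f \o u) (f' (u y) * D j y).
Proof.
move=> df du.
suff : is_derive (0 *: delta_mx 0 j + y) (delta_mx 0 j) (f \o u) (f' (u y) * D j y).
  by rewrite scale0r add0r.
apply: (proj2 (@is_derive_along _ _ (f \o u) y (delta_mx 0 j) 0 _)).
have h : is_derive (0 : R) 1 (fun h : R => u (h *: delta_mx 0 j + y)) (D j y).
  by apply: (proj1 (@is_derive_along _ _ u y (delta_mx 0 j) 0 _)); rewrite scale0r add0r.
have := @is_derive1_comp R f (fun h : R => u (h *: delta_mx 0 j + y)) 0 _ _ (df _) h.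
by rewrite scale0r add0r.
Qed.

(** Smoothness of f is encoded as membership in a class S closed under derivation: [flat_span] for
    the cutoffs and the singleton of [expR] for the Gaussian. *)
Lemma Ck_comp (S : (R -> R) -> Prop) k (f : R -> R) u :
  (forall f, S f -> exists2 f', S f' & forall t : R, is_derive t 1 f (f' t)) ->
  S f -> (forall k, Ck k u) -> Ck k (f \o u).
Proof.
move=> hS + hu; elim: k f => [|k IH] f Sf; have [f' Sf' df'] := hS f Sf.
  split => //; apply: continuous_compose; first exact: Ck_continuous (hu 0).
  by move=> t; apply: differentiable_continuous; apply/derivable1_diffP; exact: ex_derive.
apply: (@Ck_intro _ _ _ _ (fun j y => f' (u y) * pd j u y)).
- apply: continuous_compose; first exact: Ck_continuous (hu 0).
  by move=> t; apply: differentiable_continuous; apply/derivable1_diffP; exact: ex_derive.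
- by move=> j y; apply: (is_derive_radial (D := fun j => pd j u)) => //; exact: Ck_is_derive (hu 1).
- move=> j; apply: Ck_mul; first exact: IH.
  exact: Ck_pd (hu k.+1).
Qed.

Definition cutoff a b y := smooth_step a b (sqdist y).

Lemma Ck_cutoff k a b : Ck k (cutoff a b).
Proof.
apply: Ck_mul; first exact: Ck_cst.
have h1 k' : Ck k' (flat_exp 0 \o (fun y => sqdist y + - a)).
  apply: (@Ck_comp _ k' (flat_exp 0) (fun y => sqdist y + - a) (@flat_span_derive R) (flat_span_gen R 0)).
  by move=> k''; apply: Ck_add; [exact: Ck_sqdist|exact: Ck_cst].
have := @Ck_comp _ k (flat_exp 0) (fun y => 1 + (- (flat_exp 0 (b - a))^-1) * flat_exp 0 (sqdist y + - a))
  (@flat_span_derive R) (flat_span_gen R 0).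
rewrite (_ : _ \o _ = (fun y => flat_exp 0 (1 - (flat_exp 0 (b - a))^-1 * flat_exp 0 (sqdist y - a)))).
  apply => k'; apply: Ck_add; first exact: Ck_cst.
  by apply: Ck_mul; [exact: Ck_cst|exact: h1].
by apply/funext => y /=; rewrite mulNr.
Qed.

Lemma closed_sqdist_le b : closed [set y | sqdist y <= b].
Proof.
have c : continuous sqdist := Ck_continuous (Ck_sqdist 0).
exact: (proj1 (continuous_closedP _) c [set t | t <= b] (@closed_le _ b)).
Qed.

Lemma compact_sqdist_le b : compact [set y | sqdist y <= b].
Proof.
have cK : compact [set y : 'rV[R]_d | forall i, `[x 0 i - (1 + b), x 0 i + (1 + b)]%classic (y 0 i)].
  apply: (@rV_compact _ _ (fun i => `[x 0 i - (1 + b), x 0 i + (1 + b)]%classic)) => i.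
  exact: segment_compact.
apply: (subclosed_compact (@closed_sqdist_le b) cK).
- move=> y /= yb i; rewrite /= in_itv/= -ler_distl.
  have : (y 0 i - x 0 i) ^+ 2 <= b.
    apply: le_trans yb; rewrite /sqdist /dot (bigD1 i)//= !mxE -expr2 lerDl.
    by apply: sumr_ge0 => j _; rewrite -expr2 sqr_ge0.
  rewrite -real_normK ?num_real//; move: (`|_|) (normr_ge0 (y 0 i - x 0 i)) => s s0 sb.
  have := sqr_ge0 (s - 1); have := sqr_ge0 s; rewrite !expr2 in sb *; nra.
Qed.

Lemma Cc_smooth_mul_cutoff u a b : a < b -> (forall k, Ck k u) ->
  Cc_smooth (fun y => u y * cutoff a b y).
Proof.
move=> ab hu; split; first by move=> k; apply: Ck_mul => //; exact: Ck_cutoff.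
have cb := @compact_sqdist_le b; apply: (subclosed_compact _ cb); first exact: closed_closure.
rewrite [X in _ `<=` X](proj1 (closure_id _) (@closed_sqdist_le b)); apply: closure_subset => y /=.
apply: contraNT; rewrite -ltNge => by_.
by rewrite /cutoff smooth_step0 ?mulr0// ltW.
Qed.

Lemma cutoff1 a b y : sqdist y <= a -> cutoff a b y = 1.
Proof. exact: smooth_step1. Qed.

Lemma cutoff0 a b y : a < b -> b <= sqdist y -> cutoff a b y = 0.
Proof. exact: smooth_step0. Qed.

Lemma cutoff_ge0 a b y : 0 <= cutoff a b y.
Proof. exact: smooth_step_ge0. Qed.

Lemma cutoff_le1 a b y : cutoff a b y <= 1.
Proof. exact: smooth_step_le1. Qed.

Lemma near_sqdist_lt a y : sqdist y < a -> \forall t \near y, sqdist t < a.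
Proof.
move=> ya; have c : continuous sqdist := Ck_continuous (Ck_sqdist 0).
exact: (c y _ (lt_nbhsl ya)).
Qed.

Lemma near_pd u v y j : (\forall t \near y, u t = v t) -> \forall t \near y, pd j u t = pd j v t.
Proof.
by move=> /near_join; apply: filterS => t; exact: near_eq_derive.
Qed.

Definition gauss c y : R := expR (- c * sqdist y).

Lemma Ck_gauss k c : Ck k (gauss c).
Proof.
have hS f : [set @expR R] f -> exists2 f', [set @expR R] f' & forall t : R, is_derive t 1 f (f' t).
  by move=> ->; exists expR => // t; exact: is_derive_expR.
apply: (@Ck_comp _ k expR (fun y => - c * sqdist y) hS erefl) => k'.
by apply: Ck_mul; [exact: Ck_cst|exact: Ck_sqdist].
Qed.

Lemma is_derive_gauss c j y :
  is_derive y (delta_mx 0 j) (gauss c) (gauss c y * (- (2 * c) * (y - x) 0 j)).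
Proof.
have de (t : R) : is_derive t 1 (fun t : R => expR (- c * t)) (expR (- c * t) * (- c)).
  rewrite -[X in expR X * _]add0r (_ : (fun t : R => _) = expR \o (fun t => 0 + (- c) * t)).
    exact: is_derive1_comp (is_derive_expR _) (is_derive_affine 0 (- c) t).
  by apply/funext => s /=; rewrite add0r.
have h := @is_derive_radial _ _ sqdist (fun j y => 2 * (y - x) 0 j) j y de (is_derive_sqdist j y).
by apply: is_derive_eq h _; rewrite /gauss; ring.
Qed.

Lemma pd_gauss c j : pd j (gauss c) = (fun y => gauss c y * (- (2 * c) * (y - x) 0 j)).
Proof. by apply/funext => y; have h := is_derive_gauss c j y; rewrite /pd derive_val. Qed.

Lemma pd2_gauss c j k y : pd j (pd k (gauss c)) y =
  gauss c y * (4 * c ^+ 2 * ((y - x) 0 j * (y - x) 0 k) - 2 * c * (j == k)%:R).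
Proof.
rewrite pd_gauss /pd.
have h := is_deriveM (is_derive_gauss c j y) (is_deriveZ (- (2 * c)) (is_derive_coord k j y)).
have -> : (fun y => gauss c y * (- (2 * c) * (y - x) 0 k)) =
   gauss c * (- (2 * c) \*: (fun y => (y - x) 0 k)) by [].
rewrite derive_val /GRing.scale/=.
rewrite [X in _ + X * _](_ : _ = - (2 * c) * (y - x) 0 k)//; ring.
Qed.

End radial_functions.

Lemma dot_sqrD (R : realType) d (u v : 'rV[R]_d) :
  dot (u + v) (u + v) = dot u u + (2 * dot u v + dot v v).
Proof.
rewrite dotDl [dot u (u + v)]dotC [dot v (u + v)]dotC !dotDl [dot v u]dotC; ring.
Qed.

(** * Bounds on the generator at the two test functions *)

Section generator_bounds.
Context (R : realType) (d : nat).
Variables (a : 'rV[R]_d -> 'M[R]_d) (b : 'rV[R]_d -> 'rV[R]_d).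
Variable nu : R.-ker 'rV[R]_d ~> 'rV[R]_d.
Hypothesis psd : diffusion_matrix a.
Hypothesis levy_nu : levy_kernel nu.
Variables (x : 'rV[R]_d) (r : R).
Hypothesis r0 : 0 < r.
Implicit Types (y z : 'rV[R]_d).

Let ind (A : set R) z : R := \1_A (enorm z).

Lemma measurable_enorm_set (A : set R) (B : set 'rV[R]_d) : measurable A ->
  (forall z, B z <-> A (enorm z)) -> measurable B.
Proof.
move=> mA BA; rewrite (_ : B = [set z | A (enorm z)]); first exact: measurable_enorm_preimage.
by apply/seteqP; split => z /BA.
Qed.

Definition tail_cutoff := cutoff x (r ^+ 2) ((2 * r) ^+ 2).

Lemma r2_lt_4r2 : r ^+ 2 < (2 * r) ^+ 2.
Proof. by rewrite exprMn ltr_pMl ?exprn_gt0//; lra. Qed.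

Lemma Cc_smooth_tail_cutoff : Cc_smooth tail_cutoff.
Proof.
have := Cc_smooth_mul_cutoff x r2_lt_4r2 (fun k => Ck_cst d k (1 : R)).
by under [X in Cc_smooth X]eq_fun do rewrite mul1r.
Qed.

Lemma tail_cutoff_pd y j : enorm (y - x) < r -> pd j tail_cutoff y = 0.
Proof.
move=> yr; have : \forall t \near y, tail_cutoff t = cst 1 t.
  have : sqdist x y < r ^+ 2 by rewrite sqdistE ltrXn2r ?enorm_ge0.
  move=> /near_sqdist_lt; apply: filterS => t tr; rewrite /tail_cutoff cutoff1//; exact: ltW.
by move=> /near_eq_derive => h; rewrite /pd h derive_cst.
Qed.

Lemma tail_cutoff_pd2 y j k : enorm (y - x) < r -> pd j (pd k tail_cutoff) y = 0.
Proof.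
move=> yr; have : \forall t \near y, pd k tail_cutoff t = cst 0 t.
  have : sqdist x y < r ^+ 2 by rewrite sqdistE ltrXn2r ?enorm_ge0.
  move=> /near_sqdist_lt; apply: filterS => t; rewrite sqdistE => tr.
  rewrite tail_cutoff_pd//; rewrite -ltr_sqr ?nnegrE ?enorm_ge0//; exact: ltW.
by move=> /near_eq_derive => h; rewrite /pd h derive_cst.
Qed.

(** Near y the cutoff is constantly 1, so diffusion, drift and compensator all drop out and the jump
    term reduces to u(y + z) - 1. *)
Lemma levy_operator_tail_cutoff y : enorm (y - x) < r ->
  (nu y [set z | 3 * r <= enorm z]%R <= (- levy_operator a b nu tail_cutoff y)%:E)%E.
Proof.
move=> yr.
have [ij _] := levy_operatorE a b levy_nu y Cc_smooth_tail_cutoff.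
have y1 : tail_cutoff y = 1.
  by rewrite /tail_cutoff cutoff1// sqdistE lerXn2r ?nnegrE ?enorm_ge0 ?ltW.
have jE z : jump_term tail_cutoff y z = tail_cutoff (y + z) - 1.
  rewrite /jump_term y1 big1 ?mulr0 ?subr0// => j _.
  by rewrite tail_cutoff_pd ?mulr0.
have -> : levy_operator a b nu tail_cutoff y = \int[nu y]_z jump_term tail_cutoff y z.
  rewrite /levy_operator big1 ?mulr0 ?add0r; last first.
    by move=> j _; rewrite big1// => k _; rewrite tail_cutoff_pd2// mulr0.
  by rewrite big1 ?add0r// => j _; rewrite tail_cutoff_pd// mulr0.
have mA : measurable [set z : 'rV[R]_d | 3 * r <= enorm z].
  apply: (@measurable_enorm_set `[3 * r, +oo[%classic) => // z.
  by rewrite /= in_itv/= andbT.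
rewrite -RintegralN// -Rintegral_EFin//; last exact: RintegrableN.
rewrite -[X in nu y X]setIT -integral_indic//.
apply: ge0_le_integral => //=.
- by apply/measurable_EFinP; exact: measurable_indic.
- by apply/measurable_EFinP; exact: Rintegrable_measurable (RintegrableN measurableT ij).
- move=> z _; rewrite lee_fin jE opprB indicE; case: (boolP (z \in _)) => [|_].
    rewrite inE/= => zr; rewrite /tail_cutoff cutoff0 ?subr0//; first exact: r2_lt_4r2.
    rewrite sqdistE lerXn2r ?nnegrE ?enorm_ge0 ?mulr_ge0 ?ltW//.
    (* A jump of size at least 3r from a point within r of x lands at distance at least 2r from
       x. *)
    have := enorm_triangle (y + z - x) (- (y - x)); rewrite enormN.
    have -> : y + z - x + - (y - x) = z by apply/rowP => j; rewrite !mxE; ring.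
    lra.
  by rewrite subr_ge0; exact: cutoff_le1.
Qed.

Hypothesis r1 : r < 1.

(** The cutoff starts at radius 2r, so that from the closed ball of radius r a jump of size at most
    r still lands where the function is exactly Gaussian. Larger jumps use only that the function is
    nonnegative. *)
Definition exit_gauss y := gauss x (r ^- 2) y * cutoff x ((2 * r) ^+ 2) ((3 * r) ^+ 2) y.

Let c := r ^- 2.

Lemma r2r3 : (2 * r) ^+ 2 < (3 * r) ^+ 2.
Proof. by rewrite ltrXn2r// ?mulr_ge0 ?ltW// ltr_pM2r//; lra. Qed.

Lemma Cc_smooth_exit_gauss : Cc_smooth exit_gauss.
Proof. exact: Cc_smooth_mul_cutoff r2r3 (fun k => Ck_gauss x k (r ^- 2)). Qed.

Lemma exit_gauss_ge0 y : 0 <= exit_gauss y.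
Proof. by rewrite mulr_ge0 ?expR_ge0 ?cutoff_ge0. Qed.

Lemma exit_gaussE y : enorm (y - x) <= 2 * r -> exit_gauss y = gauss x c y.
Proof.
move=> yr; rewrite /exit_gauss cutoff1 ?mulr1// sqdistE lerXn2r ?nnegrE ?enorm_ge0//.
by rewrite mulr_ge0 ?ltW.
Qed.

Lemma exit_gauss_le_gauss y : exit_gauss y <= gauss x c y.
Proof. by rewrite ler_piMr ?expR_ge0 ?cutoff_le1. Qed.

Let near_exit_gauss y : enorm (y - x) <= r ->
  \forall t \near y, exit_gauss t = gauss x c t.
Proof.
move=> yr.
have : sqdist x y < (2 * r) ^+ 2.
  by rewrite sqdistE (le_lt_trans _ r2_lt_4r2)// lerXn2r ?nnegrE ?enorm_ge0 ?(ltW r0).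
move=> /near_sqdist_lt; apply: filterS => t; rewrite sqdistE => tr.
apply: exit_gaussE; rewrite -ler_sqr ?nnegrE ?enorm_ge0 ?mulr_ge0 ?ltW//; exact: ltW.
Qed.

Definition H_summand y : \bar R :=
  ((2 / r ^+ 2 * (2^-1 * (\sum_(j < d) a y j j) + dot (y - x) (b y - jump_mean nu y r)))%:E
   + (r ^- 2)%:E * \int[nu y]_(z in [set z | enorm z <= r]%R) (enorm z ^+ 2)%:E
   + nu y [set z | r < enorm z]%R)%E.

(** Jumps are sorted by size. For |z| <= r the exponential inequality has the linear part 2c w.z,
    with w = y - x, which the compensator cancels. For r < |z| <= 1 the compensator survives and
    integrates to the [jump_mean] term. Beyond 1 only - u(y) remains. The diffusion part gives the
    trace term of H and a nonnegative remainder. *)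
Lemma levy_operator_exit_gauss y : enorm (y - x) <= r ->
  ((- levy_operator a b nu exit_gauss y)%:E <= (exit_gauss y)%:E * H_summand y)%E.
Proof.
move=> yr.
have [nu0 nufin] := levy_nu y.
have [ij _] := levy_operatorE a b levy_nu y Cc_smooth_exit_gauss.
have ilm := integrable_levy_min nufin.
have cp : 0 < c by rewrite invr_gt0 exprn_gt0.
have c1 : 1 < c by rewrite invf_gt1 ?exprn_gt0// exprn_ilt1// ?ltW.
pose D1 := [set z : 'rV[R]_d | enorm z <= r].
pose D2 := [set z : 'rV[R]_d | r < enorm z].
pose D3 := [set z : 'rV[R]_d | r < enorm z <= 1].
have mD1 : measurable D1.
  by apply: (@measurable_enorm_set `]-oo, r]%classic) => // z; rewrite /D1 /= in_itv.
have mD2 : measurable D2.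
  by apply: (@measurable_enorm_set `]r, +oo[%classic) => // z; rewrite /D2 /= in_itv/= andbT.
have mD3 : measurable D3.
  by apply: (@measurable_enorm_set `]r, 1]%classic) => // z; rewrite /D3 /= in_itv.
have dom (D : set 'rV[R]_d) (g : 'rV[R]_d -> R) : measurable D -> measurable_fun setT g ->
    (forall z, D z -> `|g z| <= c * levy_min z) ->
    (nu y).-integrable D (EFin \o g) /\ (nu y).-integrable setT (EFin \o (g \_ D)).
  move=> mD mg gb.
  have h : (nu y).-integrable D (EFin \o g).
    apply: (@Rintegrable_le _ _ _ (nu y) D mD _ (fun z => c * levy_min z)) => //.
    - exact: measurable_funTS.
    - apply: RintegrableZl => //; apply: integrableS ilm => //.
  split => //; have := (integrable_mkcond (mu := nu y) (EFin \o g) mD).1 h.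
  by rewrite restrict_EFin.
have men := @measurable_enorm R d.
(* Together with c > 1, which comes from r < 1, this dominates all pieces by the single integrable
   function c [levy_min]. *)
have lm2 z : r < enorm z -> 1 <= c * levy_min z.
  move=> zr; rewrite /levy_min; case: (leP 1 (enorm z ^+ 2)) => h.
    by rewrite mulr1 ltW.
  rewrite -(ler_pM2l (exprn_gt0 2 r0)) mulr1 mulrA mulfV ?mul1r; last by rewrite gt_eqF// exprn_gt0.
  by rewrite lerXn2r ?nnegrE ?enorm_ge0 ?ltW.
have lm1 z : enorm z <= r -> enorm z ^+ 2 = levy_min z.
  move=> zr; rewrite /levy_min (min_idPr _)// exprn_ile1 ?enorm_ge0//.
  exact: le_trans zr (ltW r1).
have [j1 k1] : (nu y).-integrable D1 (EFin \o (fun z => enorm z ^+ 2)) /\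
    (nu y).-integrable setT (EFin \o ((fun z => enorm z ^+ 2) \_ D1)).
  apply: dom => //; first exact: measurable_funX.
  move=> z zr; rewrite ger0_norm ?sqr_ge0// lm1// ler_peMl ?levy_min_ge0// ltW//.
have [j2 k2] : (nu y).-integrable D2 (EFin \o (fun=> 1 : R)) /\
    (nu y).-integrable setT (EFin \o ((fun=> 1 : R) \_ D2)).
  by apply: dom => // z zr; rewrite normr1 lm2.
have j3 j : (nu y).-integrable D3 (EFin \o (fun z : 'rV[R]_d => z 0 j)) /\
    (nu y).-integrable setT (EFin \o ((fun z : 'rV[R]_d => z 0 j) \_ D3)).
  apply: dom => //; first exact: measurable_rV_coord.
  by move=> z /andP[zr z1]; rewrite (le_trans (coord_le_enorm _ _))// (le_trans z1)// lm2.
set E := gauss x c y.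
have E0 : 0 < E by exact: expR_gt0.
have EE : exit_gauss y = E by apply: exit_gaussE; rewrite (le_trans yr)// ler_peMl ?ltW//; lra.
have pd1E j : pd j exit_gauss y = E * (- (2 * c) * (y - x) 0 j).
  by rewrite /pd (near_eq_derive _ (near_exit_gauss yr)) -/(pd j _ y) pd_gauss.
have pd2E j k : pd j (pd k exit_gauss) y =
    E * (4 * c ^+ 2 * ((y - x) 0 j * (y - x) 0 k) - 2 * c * (j == k)%:R).
  have := near_pd k (near_exit_gauss yr) => /near_eq_derive h.
  by rewrite /pd h -/(pd j _ y) -/(pd k _) pd2_gauss.
pose A1 := \int[nu y]_(z in D1) (enorm z ^+ 2).
pose A2 := \int[nu y]_(z in D2) (1 : R).
have HE : H_summand y = (2 / r ^+ 2 * (2^-1 * (\sum_(j < d) a y j j)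
     + dot (y - x) (b y - jump_mean nu y r)) + c * A1 + A2)%:E.
  have e1 : (\int[nu y]_(z in D1) (enorm z ^+ 2)%:E = A1%:E)%E by exact: Rintegral_EFin.
  have e2 : nu y D2 = A2%:E.
    by rewrite -Rintegral_EFin//; have := integral_cst (nu y) mD2 1%E; rewrite mul1e => /esym.
  by rewrite /H_summand -/D1 -/D2 e1 e2 -EFinM -!EFinD.
rewrite HE EE -EFinM lee_fin.
set w := y - x in pd1E pd2E *.
set jm := jump_mean nu y r.
have T1 : \sum_j \sum_k a y j k * pd j (pd k exit_gauss) y =
    E * (4 * c ^+ 2 * dot w (w *m (a y)^T) - 2 * c * \sum_j a y j j).
  rewrite mulrBr /dot !mulr_sumr -sumrB; apply: eq_bigr => j _.
  rewrite [(w *m _) 0 j]mxE !mulr_sumr.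
  have -> : E * (2 * c * a y j j) = \sum_k (a y j k * (E * (2 * c * (j == k)%:R))).
    rewrite (bigD1 j)//= eqxx mulr1 big1 ?addr0; first by ring.
    by move=> k kj; rewrite eq_sym (negbTE kj) !mulr0.
  rewrite -sumrB; apply: eq_bigr => k _; rewrite pd2E [(a y)^T k j]mxE; ring.
have T2 : \sum_j b y 0 j * pd j exit_gauss y = - (2 * c) * E * dot w (b y).
  by rewrite /dot mulr_sumr; apply: eq_bigr => j _; rewrite pd1E; ring.
pose f1 := (fun z : 'rV[R]_d => enorm z ^+ 2) \_ D1.
pose f2 := (fun=> 1 : R) \_ D2.
pose f3 j := (fun z : 'rV[R]_d => z 0 j) \_ D3.
(* A pointwise minorant of the jump term whose integral is exactly the jump part of - E
   [H_summand]. *)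
pose l z := E * ((2 * c * (\sum_j w 0 j * f3 j z)) - (c * f1 z + f2 z)).
have jmE j : \int[nu y]_z f3 j z = jm 0 j by rewrite /jm mxE [RHS]Rintegral_mkcond.
have [is3 Is3] := @Rintegral_linear_comb _ _ R (nu y) _ (fun j => w 0 j) (fun j => jm 0 j) f3
  (fun j => (j3 j).2) jmE.
have i12 := RintegrableD measurableT (RintegrableZl measurableT c k1) k2.
have i3 := RintegrableZl measurableT (2 * c) is3.
have il : (nu y).-integrable setT (EFin \o l).
  exact: (RintegrableZl measurableT E (RintegrableB measurableT i3 i12)).
have Il : \int[nu y]_z l z = E * (2 * c * dot w jm - (c * A1 + A2)).
  rewrite (RintegralZl _ measurableT (RintegrableB measurableT i3 i12)).
  rewrite (RintegralB measurableT i3 i12) (RintegralZl _ measurableT is3) Is3.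
  rewrite (RintegralD measurableT (RintegrableZl measurableT c k1) k2).
  rewrite (RintegralZl _ measurableT k1).
  by rewrite /A1 /A2 [in RHS]Rintegral_mkcond [X in _ = _ * (_ - (_ + X))]Rintegral_mkcond.
have lj z : l z <= jump_term exit_gauss y z.
  have SE : \sum_j z 0 j * pd j exit_gauss y = - (2 * c) * E * dot w z.
    by rewrite /dot mulr_sumr; apply: eq_bigr => j _; rewrite pd1E; ring.
  have f3E : \sum_j w 0 j * f3 j z = dot w z * (r < enorm z <= 1)%R%:R.
    rewrite /dot mulr_suml; apply: eq_bigr => j _; rewrite -mulrA; congr (_ * _).
    rewrite /f3 patchE; case: (boolP (_ < _ <= _)) => h.
      by rewrite mem_set ?mulr1.
    by rewrite memNset ?mulr0//; apply/negP.
  rewrite /l f3E /jump_term EE SE.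
  have [zr|zr] := leP (enorm z) r.
    have -> : f1 z = enorm z ^+ 2 by rewrite /f1 patchE mem_set.
    have -> : f2 z = 0 by rewrite /f2 patchE memNset// /D2 /= ltNge zr.
    rewrite (le_trans zr (ltW r1)) /= mulr0 mulr0 add0r addr0 mul1r.
    have -> : exit_gauss (y + z) = E * expR (- c * (2 * dot w z + enorm z ^+ 2)).
      rewrite exit_gaussE; last first.
        rewrite addrAC (le_trans (enorm_triangle _ _))// mulr_natl mulr2n.
        exact: lerD.
      have -> : gauss x c (y + z) = expR (- c * sqdist x (y + z)) by [].
      have -> : sqdist x (y + z) = sqdist x y + (2 * dot w z + enorm z ^+ 2).
        rewrite /sqdist -/w sqr_enorm (_ : y + z - x = w + z); last by rewrite /w addrAC.
        exact: dot_sqrD.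
      by rewrite mulrDr expRD.
    have := expR_ge1Dx (- c * (2 * dot w z + enorm z ^+ 2)) => /(ler_wpM2l (ltW E0)).
    by rewrite -subr_ge0 => h; rewrite -subr_ge0; move: h; congr (0 <= _); ring.
  have -> : f1 z = 0 by rewrite /f1 patchE memNset// /D1 /= leNgt zr.
  have -> : f2 z = 1 by rewrite /f2 patchE mem_set.
  have := exit_gauss_ge0 (y + z).
  by case: (leP (enorm z) 1) => z1 /= t0; rewrite -subr_ge0; move: t0; congr (0 <= _); ring.
have Tj : E * (2 * c * dot w jm - (c * A1 + A2)) <= \int[nu y]_z jump_term exit_gauss y z.
  by rewrite -Il; apply: le_Rintegral => // z _; exact: lj.
rewrite /levy_operator T1 T2.
(* The term of the Gaussian's Hessian that is quadratic in w has a favourable sign by nonnegativity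
   of a(y), and is discarded. *)
have Q0 : 0 <= E * (2 * c ^+ 2 * dot w (w *m (a y)^T)).
  have [_ Qw] := psd y.
  by apply: mulr_ge0; [exact: ltW|apply: mulr_ge0; [rewrite mulr_ge0// sqr_ge0|exact: Qw]].
have -> : dot w (b y - jm) = dot w (b y) - dot w jm.
  by rewrite dotC dotBl ![dot _ w]dotC.
rewrite -subr_ge0 in Tj; have := addr_ge0 Q0 Tj.
by move=> h; rewrite -subr_ge0 -/c; move: h; congr (0 <= _); field.
Qed.

End generator_bounds.

(** * Discrete skeletons of the process *)

Section layer_sums.
Context (R : realType).

(** The sum counts the naturals below t, so it is the ceiling of t. The induction on N replaces t by
    min(t, N), which removes the constraint t <= N. *)
Lemma sum_lt_bounds (t : R) (N : nat) : 0 <= t -> t <= N%:R ->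
  t <= \sum_(k < N) (k%:R < t)%R%:R <= t + 1.
Proof.
move=> t0 tN.
suff [h1 h2] : Num.min t N%:R <= \sum_(k < N) (k%:R < t)%R%:R :> R /\
    \sum_(k < N) (k%:R < t)%R%:R <= t + 1 :> R.
  by rewrite h2 andbT; move: h1; rewrite (min_idPl _).
elim: N {tN} => [|N [h1 h2]].
  by rewrite big_ord0 ge_min lexx orbT addr_ge0.
rewrite big_ord_recr/=; case: (ltP N%:R t) => h /=.
  have h3 : \sum_(k < N) (k%:R < t)%R%:R <= N%:R :> R.
    rewrite -[leRHS](_ : \sum_(k < N) 1 = N%:R); last by rewrite sumr_const card_ord.
    by apply: ler_sum => i _; case: (_ < _); rewrite ?ler01.
  split; last by lra.
  move: h1; rewrite (min_idPr _); last exact: ltW.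
  by rewrite -[N.+1%:R]natr1 => h1; rewrite ge_min; apply/orP; right; lra.
rewrite addr0; split => //; move: h1; rewrite (min_idPl _)// => h1.
by rewrite ge_min h1.
Qed.

End layer_sums.

Section skeleton.
Context (R : realType) (d : nat) (dO : measure_display)
  (Omega : measurableType dO).
Variable P : 'rV[R]_d -> probability Omega R.
Variable X : R -> Omega -> one_point_compactification 'rV[R]_d.
Hypothesis FP : feller_process P X.

Let mp := feller_markov FP.
Let mev_in := mp_measurable mp.
Implicit Types (x y : 'rV[R]_d) (u : 'rV[R]_d -> R) (U B : set 'rV[R]_d) (s t delta : R).

Definition state u t (w : Omega) : R := oapp u 0 (X t w).

Lemma past_measurable t F : past X t F -> measurable F.
Proof.
apply: smallest_sub; first exact: sigma_algebra_measurable.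
by move=> A [s [B [s0 st mB ->]]]; exact: mev_in.
Qed.

Lemma past_event t s B : 0 <= s -> s <= t -> measurable B -> past X t (event_in X s B).
Proof. by move=> s0 st mB; apply: sub_sigma_algebra; exists s, B. Qed.

Lemma past_setI t (F1 F2 : set Omega) : past X t F1 -> past X t F2 -> past X t (F1 `&` F2).
Proof.
rewrite /past; set G := [set A | _] => h1 h2.
exact: (@measurableI _ (g_sigma_algebraType G) F1 F2 h1 h2).
Qed.

Lemma measurable_state u t : 0 <= t -> measurable_fun setT u -> measurable_fun setT (state u t).
Proof.
move=> t0 mu _ B mB; rewrite setTI.
have m1 : measurable (event_in X t (u @^-1` B)).
  by apply: mev_in => //; rewrite -[X in measurable X]setTI; exact: mu.
have m2 : measurable (~` event_in X t setT) by apply: measurableC; exact: mev_in.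
(* At the cemetery the state is 0, so the paths already killed belong to the preimage exactly when 0
   is in B. *)
rewrite (_ : _ @^-1` _ = event_in X t (u @^-1` B) `|`
    ((if 0 \in B then setT else set0) `&` ~` event_in X t setT)).
  by apply: measurableU => //; apply: measurableI => //; case: ifP.
apply/seteqP; split=> w; rewrite /state /event_in /=.
- case: (X t w) => [y|] /= h; first by left; exists y.
  right; rewrite ifT ?inE//; split => // -[y _]; discriminate.
- case: (X t w) => [y|] /= [[z /= h]|].
  + by move=> [<-].
  + by move=> [_ []]; exists y.
  + by [].
  + by case: ifPn => [|_ []]//; rewrite inE.
Qed.

Lemma bounded_integrable x (Z : Omega -> R) M : measurable_fun setT Z ->
  (forall w, `|Z w| <= M) -> (P x).-integrable setT (EFin \o Z).
Proof.
move=> mZ ZM; apply: (@Rintegrable_le _ _ _ (P x) setT measurableT _ (fun=> M)) => //.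
exact: finite_measure_integrable_cst.
Qed.

Lemma state_ge0 u t w : (forall y, 0 <= u y) -> 0 <= state u t w.
Proof. by move=> u0; rewrite /state; case: (X t w) => /=. Qed.

Lemma state_le u M t w : 0 <= M -> (forall y, u y <= M) -> state u t w <= M.
Proof. by move=> M0 uM; rewrite /state; case: (X t w) => /=. Qed.

Lemma state_normr_le u M t w : 0 <= M -> (forall y, `|u y| <= M) -> `|state u t w| <= M.
Proof. by move=> M0 uM; rewrite /state; case: (X t w) => /=; rewrite ?normr0. Qed.

Lemma state_integrable x u M t F : 0 <= t -> 0 <= M -> measurable_fun setT u -> measurable F ->
  (forall y, `|u y| <= M) ->
  (P x).-integrable setT (EFin \o (fun w => state u t w * \1_F w)).
Proof.
move=> t0 M0 mu mF uM; apply: (@bounded_integrable _ _ M).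
  by apply: measurable_funM; [exact: measurable_state|exact: measurable_indic].
move=> w; rewrite normrM indicE; case: (_ \in _); rewrite ?normr1 ?normr0 ?mulr1 ?mulr0//.
exact: state_normr_le.
Qed.

Lemma Rintegral_indic x F : measurable F -> \int[P x]_w \1_F w = fine (P x F).
Proof. by move=> mF; rewrite /Rintegral integral_indic// setIT. Qed.

Let prob_fin x F : measurable F -> (P x F) \is a fin_num.
Proof. by move=> mF; exact: fin_num_measure. Qed.

Lemma semigroupE t u x : semigroup P X t u x = \int[P x]_w state u t w.
Proof. by []. Qed.

Lemma semigroup_indic t B y : 0 <= t -> measurable B ->
  semigroup P X t \1_B y = fine (P y (event_in X t B)).
Proof.
move=> t0 mB; rewrite -Rintegral_indic; last exact: mev_in.
apply: eq_Rintegral => w _; rewrite !indicE /event_in.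
case E : (X t w) => [z|] /=; rewrite ?indicE.
  congr (_%:R); congr nat_of_bool; apply/idP/idP; rewrite !inE /= E.
    by move=> Bz; exists z.
  by move=> [z' Bz' [<-]].
by rewrite memNset// /= E => -[].
Qed.

Lemma markov_indic x s t F B : 0 <= s -> 0 <= t -> past X s F -> measurable B ->
  \int[P x]_w (state \1_B (s + t) w * \1_F w) =
  \int[P x]_w (state (semigroup P X t \1_B) s w * \1_F w).
Proof.
move=> s0 t0 pF mB; have mF := past_measurable pF.
transitivity (fine (P x (F `&` event_in X (s + t) B))).
  rewrite -Rintegral_indic; last by apply: measurableI => //; apply: mev_in => //; exact: addr_ge0.
  apply: eq_Rintegral => w _; rewrite setIC indicI; congr (_ * _).
  rewrite /state /event_in [RHS]indicE; case E : (X (s + t) w) => [z|] /=.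
    rewrite indicE; congr (_%:R); congr nat_of_bool; apply/idP/idP; rewrite !inE /= E.
      by move=> Bz; exists z.
    by move=> [z' Bz' [<-]].
  by rewrite memNset// /= E => -[].
rewrite (mp_markov mp)// integral_mkcond; congr fine.
apply: eq_integral => w _; rewrite patchE indicE /state.
case: (w \in F); last by rewrite mulr0.
rewrite mulr1; case: (X s w) => [z|] //=.
by rewrite semigroup_indic// fineK//; apply: prob_fin; exact: mev_in.
Qed.

End skeleton.

Section skeleton_bounds.
Context (R : realType) (d : nat) (dO : measure_display)
  (Omega : measurableType dO).
Variable P : 'rV[R]_d -> probability Omega R.
Variable X : R -> Omega -> one_point_compactification 'rV[R]_d.
Hypothesis FP : feller_process P X.

Let mp := feller_markov FP.
Implicit Types (x y : 'rV[R]_d) (u : 'rV[R]_d -> R) (U B : set 'rV[R]_d) (s t delta : R).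
Local Notation semigroup := (semigroup P X).

(* Approximates [u] by indicators, to extend [mp_markov] from indicators to bounded functions. *)
Definition layer (N : nat) u y : R := N%:R^-1 * \sum_(k < N) \1_[set y | k%:R < N%:R * u y] y.

Lemma layer_bounds N u y : (0 < N)%N -> 0 <= u y <= 1 -> u y <= layer N u y <= u y + N%:R^-1.
Proof.
move=> N0 /andP[u0 u1]; have n0 : 0 < N%:R :> R by rewrite ltr0n.
have nu0 : 0 <= N%:R * u y by rewrite mulr_ge0 ?(ltW n0).
have nu1 : N%:R * u y <= N%:R by rewrite ler_piMr ?(ltW n0).
have := sum_lt_bounds nu0 nu1.
have -> : \sum_(k < N) (k%:R < N%:R * u y)%R%:R = \sum_(k < N) \1_[set y | k%:R < N%:R * u y] y :> R.
  by apply: eq_bigr => k _; rewrite indicE; congr (_%:R); congr nat_of_bool; apply/idP/idP; rewrite inE.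
move=> /andP[h1 h2]; rewrite /layer ler_pdivlMl// h1/= ler_pdivrMl// mulrDr mulfV//.
by rewrite gt_eqF.
Qed.

Lemma measurable_layer_set N u (k : nat) : measurable_fun setT u ->
  measurable [set y | k%:R < N%:R * u y].
Proof.
move=> mu; have m : measurable_fun setT (fun y => N%:R * u y) by exact: measurable_funM.
have := m measurableT `]k%:R, +oo[%classic (measurable_itv _); rewrite setTI.
by congr measurable; apply/seteqP; split => y; rewrite /= in_itv/= andbT.
Qed.

Lemma expectation_cst x (c : R) : \int[P x]_w c = c.
Proof.
have := integral_cst (P x) measurableT c%:E.
by rewrite /Rintegral => ->; rewrite [X in (_ * X)%E]probability_setT mule1.
Qed.

Lemma state_layer N u t w :
  state X (layer N u) t w = N%:R^-1 * \sum_(k < N) state X \1_[set y | k%:R < N%:R * u y] t w.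
Proof.
rewrite /state /layer; case: (X t w) => //=.
by rewrite big1 ?mulr0.
Qed.

Lemma indic_normr_le (T : Type) (B : set T) (y : T) : `|\1_B y : R| <= 1.
Proof. by rewrite indicE; case: (_ \in _); rewrite ?normr1 ?normr0. Qed.

Lemma state_integrable1 x u M t : 0 <= t -> 0 <= M -> measurable_fun setT u ->
  (forall y, `|u y| <= M) -> (P x).-integrable setT (EFin \o state X u t).
Proof.
move=> t0 M0 mu uM; apply: (@bounded_integrable _ _ _ _ P x _ M).
  exact: measurable_state FP _ _ t0 mu.
by move=> w; exact: state_normr_le.
Qed.

Lemma semigroup_layer N u t y : 0 <= t -> measurable_fun setT u ->
  semigroup t (layer N u) y =
  N%:R^-1 * \sum_(k < N) semigroup t \1_[set y | k%:R < N%:R * u y] y.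
Proof.
move=> t0 mu; rewrite semigroupE.
have h (k : 'I_N) : (P y).-integrable setT (EFin \o state X \1_[set y | k%:R < N%:R * u y] t).
  apply: (@state_integrable1 _ _ 1) => //.
    by apply: measurable_indic; exact: measurable_layer_set.
  by move=> z; exact: indic_normr_le.
have := @Rintegral_linear_comb _ _ R (P y) _ (fun=> N%:R^-1) _ _ h (fun=> erefl).
rewrite -!mulr_sumr => -[_ <-]; apply: eq_Rintegral => w _.
by rewrite state_layer mulr_sumr.
Qed.

(** The bound 2 leaves room for layer functions, which may exceed a function with values in [0, 1]
    by 1/N. *)
Lemma state_approx x s (F : set Omega) u (v : 'rV[R]_d -> R) (e : R) : 0 <= s -> 0 <= e -> measurable F ->
  measurable_fun setT u -> measurable_fun setT v ->
  (forall y, `|u y| <= 2) -> (forall y, `|v y| <= 2) ->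
  (forall y, u y <= v y <= u y + e) ->
  \int[P x]_w (state X u s w * \1_F w) <= \int[P x]_w (state X v s w * \1_F w)
    <= \int[P x]_w (state X u s w * \1_F w) + e.
Proof.
move=> s0 e0 mF mu mv u2 v2 uv.
have iu := state_integrable FP x s0 (ler0n _ 2) mu mF u2.
have iv := state_integrable FP x s0 (ler0n _ 2) mv mF v2.
have ie : (P x).-integrable setT (EFin \o (fun=> e)) by exact: finite_measure_integrable_cst.
have sv w : state X u s w <= state X v s w <= state X u s w + e.
  by rewrite /state; case: (X s w) => //=; rewrite lexx add0r.
apply/andP; split.
  apply: le_Rintegral => // w _; have /andP[h _] := sv w.
  by rewrite ler_wpM2r// indicE.
rewrite -[X in _ + X](expectation_cst x e) -RintegralD//; apply: le_Rintegral => //; first exact: RintegrableD.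
move=> w _; have /andP[_ h] := sv w.
by rewrite indicE; case: (_ \in _); rewrite ?mulr1 ?mulr0 ?add0r.
Qed.

Lemma semigroup_setT u t y : semigroup t u y = \int[P y]_w (state X u t w * \1_setT w).
Proof. by rewrite semigroupE; apply: eq_Rintegral => w _; rewrite indicE in_setT mulr1. Qed.

Lemma semigroup01 u t y : 0 <= t -> measurable_fun setT u -> (forall y, 0 <= u y <= 1) ->
  0 <= semigroup t u y <= 1.
Proof.
move=> t0 mu u01; have un z : `|u z| <= 1 by have /andP[? ?] := u01 z; rewrite ger0_norm.
rewrite semigroupE; apply/andP; split.
  by apply: Rintegral_ge0 => w _; apply: state_ge0 => z; have /andP[] := u01 z.
rewrite -[leRHS](expectation_cst y 1).
apply: le_Rintegral => //.
- exact: (state_integrable1 y t0 ler01 mu un).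
- exact: finite_measure_integrable_cst.
- by move=> w _; apply: state_le => // z; have /andP[] := u01 z.
Qed.

(** For a layer function both sides agree by linearity from the case of indicators. Replacing u by
    its layers moves each side upwards by at most 1/N, so the two sides differ by at most 1/N for
    every N. *)
Lemma markov_state x s t F u : 0 <= s -> 0 <= t -> past X s F ->
  measurable_fun setT u -> measurable_fun setT (semigroup t u) ->
  (forall y, 0 <= u y <= 1) ->
  \int[P x]_w (state X u (s + t) w * \1_F w) =
  \int[P x]_w (state X (semigroup t u) s w * \1_F w).
Proof.
have close (p q r e : R) : p <= r <= p + e -> q <= r <= q + e -> `|p - q| <= e.
  by rewrite ler_norml => /andP[? ?] /andP[? ?]; apply/andP; split; lra.
move=> s0 t0 pF mu msu u01; have mF := past_measurable FP pF.
have st0 : 0 <= s + t by exact: addr_ge0.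
have un y : `|u y| <= 1 by have /andP[? ?] := u01 y; rewrite ger0_norm.
have su01 y : 0 <= semigroup t u y <= 1 by exact: semigroup01.
suff h N : (0 < N)%N -> `|\int[P x]_w (state X u (s + t) w * \1_F w) -
  \int[P x]_w (state X (semigroup t u) s w * \1_F w)| <= N%:R^-1.
  apply/eqP; rewrite -subr_eq0 -normr_le0; apply/ler_addgt0Pl => e e0; rewrite addr0.
  apply: le_trans (h (Num.bound e^-1).+1 _) _ => //.
  rewrite invf_ple ?posrE// (le_trans (ltW (archi_boundP _))) ?ler_nat//.
  by rewrite invr_ge0 ltW.
move=> N0.
pose B (k : 'I_N) := [set y | k%:R < N%:R * u y].
have mB k : measurable (B k) by exact: measurable_layer_set.
have n0 : 0 < N%:R :> R by rewrite ltr0n.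
have ln y : `|layer N u y| <= 2.
  have /andP[h1 h2] := layer_bounds N0 (u01 y); have /andP[h3 h4] := u01 y.
  rewrite ger0_norm ?(le_trans h3)// (le_trans h2)//.
  have : N%:R^-1 <= 1 :> R by rewrite invf_le1// ler1n.
  lra.
have ml : measurable_fun setT (layer N u).
  apply: measurable_funM => //; apply: measurable_sum => k.
  by apply: measurable_indic; exact: mB.
have ib : (P x).-integrable setT (EFin \o (fun w => state X u (s + t) w * \1_F w)).
  exact: (state_integrable FP x (M := 1)).
have il : (P x).-integrable setT (EFin \o (fun w => state X (layer N u) (s + t) w * \1_F w)).
  exact: (state_integrable FP x (M := 2)).
have Tl y : semigroup t (layer N u) y = N%:R^-1 * \sum_(k < N) semigroup t \1_(B k) y.
  exact: semigroup_layer.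
have mT1 k : measurable_fun setT (semigroup t \1_(B k)).
  rewrite (_ : semigroup t _ = fun y => fine (P y (event_in X t (B k)))); last first.
    by apply/funext => y; exact: (semigroup_indic FP).
  by apply: measurableT_comp => //; exact: (mp_kernel mp).
have mTl : measurable_fun setT (semigroup t (layer N u)).
  rewrite (_ : semigroup t _ = fun y => N%:R^-1 * \sum_(k < N) semigroup t \1_(B k) y).
    by apply: measurable_funM => //; apply: measurable_sum => k; exact: mT1.
  by apply/funext => y; exact: Tl.
have ii k := state_integrable FP x st0 ler01 (measurable_indic (mB k)) mF (indic_normr_le (B k)).
have i01 k y : 0 <= (\1_(B k) y : R) <= 1 by rewrite indicE; case: (_ \in _); rewrite ?lexx ler01.
have Tn k y : `|semigroup t \1_(B k) y| <= 1.
  have /andP[? ?] := semigroup01 y t0 (measurable_indic (mB k)) (i01 k).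
  by rewrite ger0_norm.
have jj k := state_integrable FP x s0 ler01 (mT1 k) mF (Tn k).
have E1 : \int[P x]_w (state X (layer N u) (s + t) w * \1_F w) =
          \int[P x]_w (state X (semigroup t (layer N u)) s w * \1_F w).
  have [_ e1] := @Rintegral_linear_comb _ _ R (P x) _ (fun=> N%:R^-1) _ _ ii (fun=> erefl).
  have [_ e2] := @Rintegral_linear_comb _ _ R (P x) _ (fun=> N%:R^-1) _ _ jj (fun=> erefl).
  transitivity (\int[P x]_w (\sum_(k < N) N%:R^-1 * (state X \1_(B k) (s + t) w * \1_F w))).
    apply: eq_Rintegral => w _; rewrite state_layer -mulrA mulr_suml mulr_sumr.
    by apply: eq_bigr => k _.
  transitivity (\int[P x]_w (\sum_(k < N) N%:R^-1 * (state X (semigroup t \1_(B k)) s w * \1_F w))).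
    rewrite e1 e2; apply: eq_bigr => k _; congr (_ * _).
    exact: (markov_indic FP).
  apply: eq_Rintegral => w _; rewrite -mulr_sumr -mulr_suml mulrA; congr (_ * _).
  rewrite /state; case: (X s w) => [y|] /=; first by rewrite Tl.
  by rewrite big1 ?mulr0.
have u2 y : `|u y| <= 2 by rewrite (le_trans (un y))// ler1n.
have N1 : 0 <= N%:R^-1 :> R by rewrite invr_ge0 ltW.
have A1 := state_approx x st0 N1 mF mu ml u2 ln (fun y => layer_bounds N0 (u01 y)).
have Tul y : semigroup t u y <= semigroup t (layer N u) y <= semigroup t u y + N%:R^-1.
  rewrite !semigroup_setT.
  exact: (state_approx y t0 N1 measurableT mu ml u2 ln (fun y => layer_bounds N0 (u01 y))).
have Tu2 y : `|semigroup t u y| <= 2.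
  by have /andP[? ?] := su01 y; rewrite ger0_norm// (le_trans (y := 1))// ler1n.
have Tl2 y : `|semigroup t (layer N u) y| <= 2.
  have /andP[h1 h2] := Tul y; have /andP[h3 h4] := su01 y.
  rewrite ger0_norm ?(le_trans h3)// (le_trans h2)//.
  have : N%:R^-1 <= 1 :> R by rewrite invf_le1// ler1n.
  lra.
have A2 := state_approx x s0 N1 mF msu mTl Tu2 Tl2 Tul.
by move: A1 A2; rewrite E1; exact: close.
Qed.

End skeleton_bounds.

Lemma closed_measurable_rV (R : realType) d (A : set 'rV[R]_d) : closed A -> measurable A.
Proof.
move=> cA; rewrite -(setCK A); apply: measurableC.
by apply: sub_sigma_algebra; rewrite openC.
Qed.

(** * Telescoping along the skeleton *)

Section stay.
Context (R : realType) (d : nat) (dO : measure_display)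
  (Omega : measurableType dO).
Variable P : 'rV[R]_d -> probability Omega R.
Variable X : R -> Omega -> one_point_compactification 'rV[R]_d.
Hypothesis FP : feller_process P X.
Variables (U : set 'rV[R]_d) (delta : R).
Hypotheses (mU : measurable U) (delta0 : 0 <= delta).

Let mp := feller_markov FP.
Implicit Types (x y : 'rV[R]_d) (u : 'rV[R]_d -> R).
Local Notation semigroup := (semigroup P X).

Definition stay (j : nat) : set Omega :=
  [set w | forall i : nat, (i <= j)%N -> event_in X (i%:R * delta) U w].

Let nd0 (j : nat) : 0 <= j%:R * delta.
Proof. exact: mulr_ge0. Qed.

Lemma stay0 : stay 0 = event_in X 0 U.
Proof.
apply/seteqP; split=> w h; first by have := h 0%N (leqnn _); rewrite mul0r.
by move=> i; rewrite leqn0 => /eqP ->; rewrite mul0r.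
Qed.

Lemma stayS j : stay j.+1 = stay j `&` event_in X (j.+1%:R * delta) U.
Proof.
apply/seteqP; split=> w; first by move=> h; split=> [i ij|]; apply: h => //; exact: leqW.
by move=> [h1 h2] i; rewrite leq_eqVlt => /orP[/eqP ->//|]; rewrite ltnS; exact: h1.
Qed.

Lemma past_mono s t F : s <= t -> past X s F -> past X t F.
Proof.
move=> st; apply: smallest_sub; first exact: smallest_sigma_algebra.
by move=> A [q [B [q0 qs mB ->]]]; apply: past_event => //; exact: le_trans st.
Qed.

(** Only observations up to time j delta are involved, so the Markov property applies to the next
    step. *)
Lemma past_stay j : past X (j%:R * delta) (stay j).
Proof.
elim: j => [|j IH]; first by rewrite stay0; apply: past_event.
rewrite stayS; apply: past_setI; last exact: past_event.
by apply: past_mono IH; rewrite ler_wpM2r// ler_nat.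
Qed.

Lemma measurable_stay j : measurable (stay j).
Proof. by apply: (past_measurable FP); exact: past_stay. Qed.

Variable u : 'rV[R]_d -> R.
Hypotheses (mu : measurable_fun setT u) (mTu : measurable_fun setT (semigroup delta u)).
Hypothesis u01 : forall y, 0 <= u y <= 1.

Let un y : `|u y| <= 1.
Proof. by have /andP[? ?] := u01 y; rewrite ger0_norm. Qed.

Let Tun y : `|semigroup delta u y| <= 1.
Proof. by have /andP[? ?] := semigroup01 FP y delta0 mu u01; rewrite ger0_norm. Qed.

Variable x : 'rV[R]_d.
Let e j := \int[P x]_w (state X u (j%:R * delta) w * \1_(stay j) w).
Let p j := \int[P x]_w (\1_(stay j) w : R).

Let iind F : measurable F -> (P x).-integrable setT (EFin \o (fun w => \1_F w : R)).
Proof.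
move=> mF; apply: (@bounded_integrable _ _ _ _ P x _ 1); first exact: measurable_indic.
exact: indic_normr_le.
Qed.

Let mstep j : \int[P x]_w (state X u (j.+1%:R * delta) w * \1_(stay j) w) =
  \int[P x]_w (state X (semigroup delta u) (j%:R * delta) w * \1_(stay j) w).
Proof.
rewrite -markov_state//; last exact: past_stay.
by apply: eq_Rintegral => w _; rewrite -natr1 mulrDl mul1r.
Qed.

Let istate j F : measurable F ->
  (P x).-integrable setT (EFin \o (fun w => state X u (j%:R * delta) w * \1_F w)).
Proof. by move=> mF; apply: (state_integrable FP x (M := 1)). Qed.

Let iTstate j F : measurable F -> (P x).-integrable setT
  (EFin \o (fun w => state X (semigroup delta u) (j%:R * delta) w * \1_F w)).
Proof. by move=> mF; apply: (state_integrable FP x (M := 1)). Qed.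

Let stay_in j w : stay j w -> exists2 y, U y & X (j%:R * delta) w = Some y.
Proof. by move=> /(_ j (leqnn _)) [y Uy <-]; exists y. Qed.

Let p_le1 j : p j <= 1.
Proof.
rewrite -(expectation_cst P x 1); apply: (le_Rintegral measurableT (iind (measurable_stay j))) => [|w _].
  exact: finite_measure_integrable_cst.
by rewrite indicE; case: (_ \in _).
Qed.

Let e_ge0 j : 0 <= e j.
Proof.
apply: Rintegral_ge0 => w _; apply: mulr_ge0; last by rewrite indicE.
by apply: state_ge0 => y; have /andP[] := u01 y.
Qed.

Let e_le j : e j <= p j.
Proof.
apply: (le_Rintegral measurableT (istate j (measurable_stay j)) (iind (measurable_stay j))) => w _.
rewrite -[leRHS]mul1r; apply: ler_wpM2r; first by rewrite indicE.
by apply: state_le => // y; have /andP[] := u01 y.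
Qed.

(* A discrete Dynkin formula: E[u(X_(j delta)); stay j] decreases by at least
   [delta * kappa * P(stay j)] at each step. *)
Lemma expected_stay_le (kappa : R) (n : nat) :
  (forall y, U y -> semigroup delta u y <= u y - delta * kappa) ->
  delta * kappa * \sum_(j < n) \int[P x]_w (\1_(stay j) w : R) <= 1.
Proof.
move=> TU.
have step j : e j.+1 <= e j - delta * kappa * p j.
  (* As u is nonnegative, forgetting the observation at step j + 1 only increases the integral; the
     Markov property then applies. *)
  have h1 : e j.+1 <= \int[P x]_w (state X u (j.+1%:R * delta) w * \1_(stay j) w).
    apply: (le_Rintegral measurableT (istate j.+1 (measurable_stay j.+1))
      (istate j.+1 (measurable_stay j))) => w _.
    apply: ler_wpM2l.
        by apply: state_ge0 => y; have /andP[] := u01 y.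
      rewrite stayS indicI /=; apply: ler_piMr; first by rewrite indicE.
      by rewrite indicE; case: (w \in _).
  apply: (le_trans h1); rewrite mstep.
  have i1 := istate j (measurable_stay j).
  have i2 := iTstate j (measurable_stay j).
  have i3 := RintegrableZl measurableT (delta * kappa) (iind (measurable_stay j)).
  rewrite /e /p -(RintegralZl (delta * kappa) measurableT (iind (measurable_stay j))) -(RintegralB measurableT i1 i3).
  apply: (le_Rintegral measurableT i2 (RintegrableB measurableT i1 i3)) => w _.
  rewrite -mulrBl [in leLHS]indicE [in leRHS]indicE; case: (boolP (w \in stay j)) => [|_]; last by rewrite !mulr0.
  rewrite inE => /stay_in[y Uy Xy] /=; rewrite !mulr1 /state Xy /=.
  exact: TU.
have tel m : delta * kappa * \sum_(j < m) p j <= e 0%N - e m.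
  elim: m => [|m IH]; first by rewrite big_ord0 mulr0 subrr.
  rewrite big_ord_recr mulrDr; apply: le_trans (lerD IH (lexx _)) _.
  by have := step m; lra.
apply: le_trans (tel n) _.
by have := e_ge0 n; have := e_le 0%N; have := p_le1 0%N; lra.
Qed.

(* The same telescoping sum from below: a path that leaves [U] at step [j.+1] contributes at most [q]. *)
Lemma stay_probability_ge (kappa q : R) (n : nat) : U x -> u x = 1 -> 0 <= q -> 0 <= kappa ->
  (forall y, ~ U y -> u y <= q) ->
  (forall y, U y -> u y - delta * kappa <= semigroup delta u y) ->
  (1 - q) * (1 - \int[P x]_w (\1_(stay n) w : R)) <= n%:R * (delta * kappa).
Proof.
move=> Ux ux q0 k0 uq TU; have dk : 0 <= delta * kappa by exact: mulr_ge0.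
have step j : e j - delta * kappa <= e j.+1 + q * (p j - p j.+1).
  have i1 := istate j (measurable_stay j).
  have i2 := iTstate j (measurable_stay j).
  have i3 := RintegrableZl measurableT (delta * kappa) (iind (measurable_stay j)).
  have h1 : e j - delta * kappa * p j <= \int[P x]_w (state X u (j.+1%:R * delta) w * \1_(stay j) w).
    rewrite mstep /e /p -(RintegralZl (delta * kappa) measurableT (iind (measurable_stay j))) -(RintegralB measurableT i1 i3).
    apply: (le_Rintegral measurableT (RintegrableB measurableT i1 i3) i2) => w _.
    rewrite -mulrBl [in leLHS]indicE [in leRHS]indicE; case: (boolP (w \in stay j)) => [|_]; last by rewrite !mulr0.
    rewrite inE => /stay_in[y Uy Xy] /=; rewrite !mulr1 /state Xy /=.
    exact: TU.
  have j1 := istate j.+1 (measurable_stay j.+1).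
  have j2 := RintegrableB measurableT (iind (measurable_stay j)) (iind (measurable_stay j.+1)).
  have j3 := RintegrableZl measurableT q j2.
  have h2 : \int[P x]_w (state X u (j.+1%:R * delta) w * \1_(stay j) w) <= e j.+1 + q * (p j - p j.+1).
    rewrite /e /p -(RintegralB measurableT (iind (measurable_stay j)) (iind (measurable_stay j.+1))).
    rewrite -(RintegralZl q measurableT j2) -(RintegralD measurableT j1 j3).
    apply: (le_Rintegral measurableT (istate j.+1 (measurable_stay j)) (RintegrableD measurableT j1 j3)) => w _.
    rewrite stayS indicI/= ![\1_(stay j) w]indicE.
    case: (boolP (w \in stay j)) => [|_]; last by rewrite !(mulr0, mul0r, subrr, addr0).
    move=> _ /=; rewrite mulr1 mul1r indicE; case: (boolP (w \in _)) => [_|] /=.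
      by rewrite mulr1 subrr mulr0 addr0.
    rewrite notin_setE /event_in /= mulr0 add0r subr0 mulr1 /state => h.
    (* The cemetery counts as outside U; there the state is 0, which is at most q. *)
    case E : (X _ w) h => [y|] //= h; apply: uq => Uy; apply: h.
    by exists y.
  have : delta * kappa * p j <= delta * kappa by rewrite ler_piMr.
  by move: h1 h2; lra.
have tel m : e 0%N - m%:R * (delta * kappa) <= e m + q * (p 0%N - p m).
  elim: m => [|m IH]; first by rewrite subrr mulr0 mul0r subr0 addr0.
  by move: IH (step m); rewrite -natr1; lra.
(* The path starts at x almost surely and u x = 1. *)
have e1 : 1 <= e 0%N.
  have mx : measurable (event_in X 0 [set x]).
    apply: (mp_measurable mp) => //; apply: closed_measurable_rV.
    rewrite (_ : [set x] = [set y | sqdist x y <= 0]).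
      exact: (@closed_sqdist_le _ _ x).
    apply/seteqP; split => y /=; rewrite sqdistE; first by move->; rewrite subrr enorm0 expr0n.
    rewrite real_exprn_even_le0 ?num_real//= => /eqP/enorm0_eq0/eqP.
    by rewrite subr_eq0 => /eqP.
  have -> : 1 = \int[P x]_w (\1_(event_in X 0 [set x]) w : R).
    by rewrite Rintegral_indic// (mp_start mp).
  apply: (le_Rintegral measurableT (iind mx) (istate 0%N (measurable_stay 0))) => w _.
  rewrite [in leLHS]indicE; case: (boolP (w \in _)) => [|_] /=.
    rewrite inE => -[y /= -> Xx]; rewrite /state mul0r -Xx /= ux mul1r.
    by rewrite indicE mem_set// stay0; exists x.
  apply: mulr_ge0; last by rewrite indicE.
  by apply: state_ge0 => y; have /andP[] := u01 y.
have : q * p 0%N <= q by rewrite ler_piMr.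
rewrite -/(p n).
have := tel n; have := e_le n; move: e1; lra.
Qed.

End stay.

(** * Exit times *)

(* [ge0_le_integral] without the measurability of the integrands. *)
Lemma ge0_le_integralT dO (T : measurableType dO) (R : realType)
    (mu : {measure set T -> \bar R}) (f g : T -> \bar R) :
  (forall w, 0 <= f w)%E -> (forall w, f w <= g w)%E ->
  (\int[mu]_w f w <= \int[mu]_w g w)%E.
Proof.
move=> f0 fg; have g0 w : (0 <= g w)%E by exact: le_trans (fg w).
rewrite !ge0_integralTE//; apply: le_ereal_sup => _ [h hf <-].
by exists h => // w; exact: le_trans (fg w).
Qed.

Section completed_law_theory.
Context (R : realType) (d : nat) (dO : measure_display)
  (Omega : measurableType dO).
Variable P : 'rV[R]_d -> probability Omega R.
Implicit Types (x : 'rV[R]_d) (N M : set Omega).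

Lemma measurable_completed x N : measurable N ->
  @measurable _ (caratheodory_type (P x)^*%mu) N.
Proof. exact: caratheodory_measurable_mu_ext. Qed.

Lemma completed_lawE x N : measurable N -> completed_law P x N = P x N.
Proof. by move=> mN; exact: measurable_mu_extE. Qed.

(** The completed law is given by the outer measure, which is monotone on arbitrary sets; exit
    events are estimated through measurable covers. *)
Lemma completed_law_le x N M : N `<=` M -> measurable M -> (completed_law P x N <= P x M)%E.
Proof. by move=> NM mM; rewrite -completed_lawE//; exact: le_mu_ext. Qed.

End completed_law_theory.

Section exit_time.
Context (R : realType) (d : nat) (dO : measure_display)
  (Omega : measurableType dO).
Variable P : 'rV[R]_d -> probability Omega R.
Variable X : R -> Omega -> one_point_compactification 'rV[R]_d.
Variable U : set 'rV[R]_d.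

Lemma exit_time_le t w : 0 <= t -> ~ event_in X t U w -> (exit_time X U w <= t%:E)%E.
Proof. by move=> t0 h; apply: ereal_inf_lbound; exists t. Qed.

Lemma exit_time_gt s t w : 0 <= s -> s <= t -> (t%:E < exit_time X U w)%E -> event_in X s U w.
Proof.
move=> s0 st h; apply: contrapT => /(exit_time_le s0) h1.
by have := lt_le_trans h h1; rewrite lte_fin ltNge st.
Qed.

Lemma exit_time_ge0 w : (0 <= exit_time X U w)%E.
Proof. by apply: le_ereal_inf_tmp => _ [t [t0 _] <-]; rewrite lee_fin. Qed.

(** If i is the first index at which the skeleton is outside U, the exit time is at most i delta,
    and the terms 0, ..., i - 1 of the series already sum to that. If there is no such index the
    series diverges. *)
Lemma exit_time_le_stay (delta : R) w : 0 < delta ->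
  (exit_time X U w <= \sum_(j <oo) (delta * \1_(stay X U delta j) w)%:E)%E.
Proof.
move=> d0; set S := (\sum_(j <oo) _)%E.
have S1 (n : nat) : (forall k : nat, (k < n)%N -> event_in X (k%:R * delta) U w) ->
    ((n%:R * delta)%:E <= S)%E.
  move=> h; apply: (@le_trans _ _ (\sum_(0 <= j < n) (delta * \1_(stay X U delta j) w)%:E)%E).
    rewrite big_mkord sumEFin lee_fin.
    rewrite (eq_bigr (fun=> delta)) ?sumr_const ?card_ord ?mulr_natl// => i _.
    rewrite indicE mem_set ?mulr1// => k ki; apply: h.
    exact: leq_ltn_trans ki (ltn_ord i).
  apply: nneseries_lim_ge => k _ _; rewrite lee_fin mulr_ge0 ?(ltW d0)//.
have [h|h] := pselect (exists i : nat, `[< ~ event_in X (i%:R * delta) U w >]).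
  have [i /asboolP ni min] := ex_minnP h.
  apply: le_trans (S1 i _).
    by apply: exit_time_le => //; rewrite mulr_ge0// ltW.
  move=> k ki; apply: contrapT => nk.
  by have /min : `[< ~ event_in X (k%:R * delta) U w >] by [exact/asboolP]; rewrite leqNgt ki.
suff -> : S = +oo%E by exact: leey.
apply/eqyP => e e0; apply: le_trans (S1 (Num.bound (e / delta)).+1 _).
  rewrite lee_fin -ler_pdivrMr// (le_trans (ltW (archi_boundP _))) ?ler_nat//.
  by rewrite divr_ge0// ltW.
by move=> k _; apply: contrapT => nk; apply: h; exists k; apply/asboolP.
Qed.

Hypothesis FP : feller_process P X.
Hypothesis mU : measurable U.

Lemma expected_exit_time_le x (delta C : R) : 0 < delta ->
  (forall n, delta * \sum_(j < n) \int[P x]_w (\1_(stay X U delta j) w : R) <= C) ->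
  (\int[completed_law P x]_w exit_time X U w <= C%:E)%E.
Proof.
move=> d0 h; have d1 := ltW d0.
have := @ge0_le_integralT _ _ _ (completed_law P x) _ _ exit_time_ge0
  (fun w => exit_time_le_stay w d0).
move=> /le_trans; apply.
have mS j : measurable (stay X U delta j) by apply: (measurable_stay FP).
have iS j : (\int[completed_law P x]_w (delta * \1_(stay X U delta j) w)%:E =
    (delta * \int[P x]_w (\1_(stay X U delta j) w : R))%:E)%E.
  have mc := measurable_completed P x (mS j).
  have m1 : measurable_fun setT (fun w : caratheodory_type (P x)^*%mu => (\1_(stay X U delta j) w)%:E : \bar R).
    by apply/measurable_EFinP; apply: measurable_indic.
  have i0 (w : caratheodory_type (P x)^*%mu) : setT w -> (0 <= (\1_(stay X U delta j) w)%:E :> \bar R)%E.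
    by rewrite lee_fin indicE.
  under eq_integral do rewrite EFinM.
  rewrite (ge0_integralZl _ measurableT m1 i0) ?lee_fin//.
  rewrite (integral_indic _ measurableT mc).
  rewrite setIT completed_lawE// Rintegral_indic// EFinM fineK//.
  exact: fin_num_measure.
have m2 j : measurable_fun setT (fun w : caratheodory_type (P x)^*%mu =>
    (delta * \1_(stay X U delta j) w)%:E : \bar R).
  apply/measurable_EFinP; apply: measurable_funM; first exact: measurable_cst.
  exact: measurable_indic (measurable_completed P x (mS j)).
have i2 j (w : caratheodory_type (P x)^*%mu) :
    setT w -> (0 <= (delta * \1_(stay X U delta j) w)%:E :> \bar R)%E.
  by rewrite lee_fin indicE mulr_ge0.
rewrite (integral_nneseries _ measurableT m2 i2).
rewrite (eq_eseriesr (fun j _ => iS j)).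
apply: lime_le.
  by apply: is_cvg_nneseries => j _ _; rewrite lee_fin mulr_ge0// Rintegral_ge0.
by apply: nearW => n; rewrite big_mkord sumEFin lee_fin -mulr_sumr.
Qed.

End exit_time.

Lemma measurable_eball (R : realType) d (x : 'rV[R]_d) r : measurable (eball x r).
Proof.
have [r0|r0] := ltP 0 r; last first.
  rewrite (_ : eball x r = set0) ?measurable0//; apply/seteqP; split => y //=.
  by rewrite /eball/= ltNge (le_trans r0)// enorm_ge0.
rewrite (_ : eball x r = ~` [set y | r ^+ 2 <= sqdist x y]).
  apply: measurableC; apply: closed_measurable_rV.
  have c : continuous (sqdist x) := Ck_continuous (Ck_sqdist x 0).
  exact: (proj1 (continuous_closedP _) c [set t | r ^+ 2 <= t] (@closed_ge _ _)).
apply/seteqP; split => y /=; rewrite /eball/= sqdistE ler_sqr ?nnegrE ?enorm_ge0 ?(ltW r0)//.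
  by rewrite leNgt => ->.
by move=> /negP; rewrite -ltNge.
Qed.

(** * Upper bounds on the tail and the mean of the exit time *)

Section ball_exit_upper_bounds.
Context (R : realType) (d : nat) (dO : measure_display)
  (Omega : measurableType dO).
Variable P : 'rV[R]_d -> probability Omega R.
Variable X : R -> Omega -> one_point_compactification 'rV[R]_d.
Variables (a : 'rV[R]_d -> 'M[R]_d) (b : 'rV[R]_d -> 'rV[R]_d).
Variable nu : R.-ker 'rV[R]_d ~> 'rV[R]_d.
Hypothesis FP : feller_process P X.
Hypothesis levy_nu : levy_kernel nu.
Hypothesis dom : forall u, Cc_smooth u -> generator_domain P X u.
Hypothesis gen : forall u Au, Cc_smooth u -> is_generator P X u Au ->
  forall x, (Au x)%:C%C = pseudo_diff (symbol a b nu) u x.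
Implicit Types (x y : 'rV[R]_d) (u : 'rV[R]_d -> R).
Local Notation semigroup := (semigroup P X).

Lemma C_infty_measurable u : C_infty u -> measurable_fun setT u.
Proof. by move=> [cu _]; exact: continuous_measurable_rV. Qed.

(** Sup-norm convergence of the difference quotients makes the threshold independent of the starting
    point, so one step size serves all steps of the skeleton. Measurability comes from the Feller
    property. *)
Lemma semigroup_generator u e : Cc_smooth u -> 0 < e ->
  exists2 t0, 0 < t0 & forall t, 0 < t < t0 ->
    measurable_fun setT (semigroup t u) /\
    forall y, `|semigroup t u y - u y - t * levy_operator a b nu u y| <= t * e.
Proof.
move=> su e0; have [Au gu] := dom su; have [Cu _ cv] := gu.
have AuE y : Au y = levy_operator a b nu u y.
  by have [_ <-] := levy_operatorE a b levy_nu y su; rewrite -(gen su gu).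
have : nbhs 0%E [set z : \bar R | (z < e%:E)%E].
  change (nbhs (0 : R) (fun z => (z%:E < e%:E)%E)).
  apply/nbhs_ballP; exists e => //= z; rewrite /ball /= sub0r normrN => h.
  by rewrite lte_fin; exact: le_lt_trans (ler_norm _) h.
move=> /cv /nbhs_ballP[t0 /= t00 h]; exists t0 => // t /andP[t1 t2]; split.
  by apply: C_infty_measurable; exact: (feller_C_infty FP (ltW t1) Cu).
move=> y; have bt : ball (0 : R) t0 t.
  by change (`|0 - t| < t0); rewrite sub0r normrN gtr0_norm.
have h1 := h t bt t1.
have := le_lt_trans (ereal_sup_ubound _) h1.
move=> /(_ `|t^-1 * (semigroup t u y - u y) - Au y|%:E).
have -> : semigroup t u y - u y - t * levy_operator a b nu u y =
    t * (t^-1 * (semigroup t u y - u y) - Au y).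
  by rewrite AuE mulrBr mulrA mulfV ?gt_eqF// mul1r.
rewrite normrM gtr0_norm// ler_pM2l// lte_fin => h2; apply/ltW/h2.
by exists y.
Qed.

Lemma Cc_smooth_measurable u : Cc_smooth u -> measurable_fun setT u.
Proof. by move=> [h _]; apply: continuous_measurable_rV; have [] := h 0%N. Qed.

Lemma expected_time_in_ball x (r m e : R) : 0 < r -> 0 < e ->
  (forall y, enorm (y - x) < r -> (m%:E <= nu y [set z | 3 * r <= enorm z]%R)%E) ->
  exists2 t0, 0 < t0 & forall t, 0 < t < t0 -> forall n : nat,
    t * (m - e) * \sum_(j < n) \int[P x]_w (\1_(stay X (eball x r) t j) w : R) <= 1.
Proof.
move=> r0 e0 hm; have sm := Cc_smooth_tail_cutoff x r0.
have [t0 t00 h] := semigroup_generator sm e0; exists t0 => // t t01 n.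
have [mT hT] := h t t01; have /andP[t1 _] := t01.
apply: (expected_stay_le FP (measurable_eball x r) (ltW t1) (Cc_smooth_measurable sm) mT).
  by move=> y; rewrite cutoff_ge0 cutoff_le1.
move=> y yr; have := le_trans (hm y yr) (levy_operator_tail_cutoff a b levy_nu r0 yr).
rewrite lee_fin; set L := levy_operator _ _ _ _ _ => hL.
have := hT y; rewrite -/L ler_norml => /andP[_ h2].
have : t * m <= t * - L by rewrite ler_pM2l.
by move: h2; lra.
Qed.

(** With n steps of length exactly t/n, the event of exit after t lies in [stay n]. These events
    decrease, so n P([stay n]) is at most the sum bounded by the telescoping estimate. The product
    form allows m = 0. *)
Lemma exit_time_ball_tail x (r m t : R) : 0 < r -> 0 < t -> 0 <= m ->
  (forall y, enorm (y - x) < r -> (m%:E <= nu y [set z | 3 * r <= enorm z]%R)%E) ->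
  ((t * m)%:E * completed_law P x [set w | t%:E < exit_time X (eball x r) w] <= 1)%E.
Proof.
move=> r0 t0 m0 hm.
suff h e : 0 < e -> exists2 N, measurable N &
    [set w | t%:E < exit_time X (eball x r) w]%E `<=` N /\ t * (m - e) * fine (P x N) <= 1.
  apply/lee_addgt0Pr => e e0.
  have [N mN [sN hN]] := h (e / t) (divr_gt0 e0 t0).
  have := completed_law_le P x sN mN.
  have p1 : (P x N <= 1)%E by exact: probability_le1.
  have pf : P x N = (fine (P x N))%:E by rewrite fineK// fin_num_measure.
  move: p1 hN; rewrite pf lee_fin => p1 hN h1.
  apply: le_trans (lee_wpmul2l _ h1) _; first by rewrite lee_fin mulr_ge0// ltW.
  rewrite -EFinM lee_fin; move: hN; rewrite mulrBr mulrCA mulfV ?gt_eqF// mulr1 mulrBl => hN.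
  have : e * fine (P x N) <= e by rewrite ler_piMr// ltW.
  by move: hN; lra.
move=> e0; have [t1 t10 ht] := expected_time_in_ball r0 e0 hm.
pose n := (Num.bound (t / t1)).+1; pose delta := t / n%:R.
have n0 : 0 < n%:R :> R by rewrite ltr0n.
have d0 : 0 < delta by rewrite divr_gt0.
have d1 : delta < t1.
  rewrite ltr_pdivrMr// mulrC -ltr_pdivrMr//.
  apply: lt_le_trans (archi_boundP _) _; first by rewrite divr_ge0// ltW.
  by rewrite ler_nat.
have nd : n%:R * delta = t by rewrite mulrC divfK// gt_eqF.
have mS j : measurable (stay X (eball x r) delta j).
  by apply: (measurable_stay FP); [exact: measurable_eball|exact: ltW].
exists (stay X (eball x r) delta n) => //; split.
  move=> w /= tw i ni; apply: exit_time_gt tw; first by rewrite mulr_ge0// ltW.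
  by rewrite -nd ler_pM2r// ler_nat.
have [me|me] := leP (m - e) 0.
  apply: le_trans (ler01); rewrite -mulrA mulrCA mulr_le0_ge0//.
  by rewrite mulr_ge0 ?(ltW t0)// fine_ge0.
have /andP := conj d0 d1 => /(ht delta)/(_ n); apply: le_trans.
set p := fine _.
have -> : t * (m - e) * p = delta * (m - e) * (n%:R * p) by rewrite -nd; ring.
rewrite (ler_pM2l (mulr_gt0 d0 me)) /p.
have -> : n%:R * fine (P x (stay X (eball x r) delta n)) =
    \sum_(j < n) fine (P x (stay X (eball x r) delta n)).
  by rewrite sumr_const card_ord mulr_natl.
apply: ler_sum => j _; rewrite Rintegral_indic//.
apply: fine_le; [exact: fin_num_measure|exact: fin_num_measure|].
apply: le_measure; [by rewrite inE|by rewrite inE|move=> w hw i ij; apply: hw].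
exact: leq_trans ij (ltnW (ltn_ord j)).
Qed.

Lemma expected_exit_time_ball_le x (r m : R) : 0 < r -> 0 < m ->
  (forall y, enorm (y - x) < r -> (m%:E <= nu y [set z | 3 * r <= enorm z]%R)%E) ->
  (\int[completed_law P x]_w exit_time X (eball x r) w <= (m^-1)%:E)%E.
Proof.
move=> r0 m0 hm.
have h e : 0 < e < m -> (\int[completed_law P x]_w exit_time X (eball x r) w <= ((m - e)^-1)%:E)%E.
  move=> /andP[e0 em]; have [t0 t00 ht] := expected_time_in_ball r0 e0 hm.
  have t1 : 0 < t0 / 2 < t0 by lra.
  have /andP[t2 _] := t1; have me : 0 < m - e by rewrite subr_gt0.
  apply: (expected_exit_time_le FP (measurable_eball x r) t2) => n.
  rewrite -[leRHS]mul1r ler_pdivlMr// [leLHS](_ : _ = t0 / 2 * (m - e) *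
    \sum_(j < n) \int[P x]_w (\1_(stay X (eball x r) (t0 / 2) j) w : R)); last by ring.
  exact: ht.
apply/lee_addgt0Pr => e e0.
(* Chosen so that 1/(m - c) <= 1/m + e: first m - c >= m/2, then c/m <= e m/2 <= e (m - c). *)
pose c := Num.min (m / 2) (e * m ^+ 2 / 2).
have c0 : 0 < c by rewrite lt_min !divr_gt0 ?mulr_gt0 ?exprn_gt0.
have cm : c <= m / 2 by rewrite /c ge_min lexx.
have ce : c <= e * m ^+ 2 / 2 by rewrite /c ge_min lexx orbT.
apply: le_trans (h c _) _; first by rewrite c0/=; lra.
have mc : 0 < m - c by lra.
have h1 : c / m <= e * (m - c).
  rewrite ler_pdivrMr//; apply: le_trans ce _.
  have -> : e * (m - c) * m = e * m * (m - c) by ring.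
  have -> : e * m ^+ 2 / 2 = e * m * (m / 2) by ring.
  by rewrite ler_pM2l ?mulr_gt0//; lra.
rewrite -EFinD lee_fin -[leLHS]mul1r ler_pdivrMr// mulrDl mulrBr mulVf ?gt_eqF//.
by rewrite [m^-1 * c]mulrC; move: h1; lra.
Qed.

End ball_exit_upper_bounds.

(** At a finite point closedness of V suffices; at the cemetery the neighbourhoods are complements
    of closed compact sets. Killed paths are thus covered too. *)
Lemma one_point_compactification_nbhs_setC (T : topologicalType) (V : set T)
    (z : one_point_compactification T) : compact V -> closed V ->
  ~ (Some @` V) z -> nbhs z (~` (Some @` V)).
Proof.
move=> cV clV; case: z => [y|] h.
  have : nbhs y (~` V).
    by apply: open_nbhs_nbhs; split; [exact: closed_openC|move=> Vy; apply: h; exists y].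
  by apply: filterS => v nv [v' Vv' [vv]]; apply: nv; rewrite -vv.
exists V => // -[y|] /=; last by move=> _ [].
by move=> [[v nv [vy]]|//] [v' Vv' [v'y]]; apply: nv; rewrite vy -v'y.
Qed.

Lemma dyadic_point (R : realType) (T s rho : R) : 0 <= s -> s < T -> 0 < rho ->
  exists m k : nat, (k <= 2 ^ m)%N /\ s < k%:R * (T / (2 ^ m)%:R) < s + rho.
Proof.
move=> s0 sT rho0; have T0 : 0 < T by exact: le_lt_trans sT.
(* A mesh below rho puts the next grid point within rho of s, and a mesh below T - s keeps it before
   T. It lies strictly after s, where right-continuity gives information. *)
pose c := Num.min rho (T - s).
have c0 : 0 < c by rewrite lt_min rho0 subr_gt0.
have crho : c <= rho by rewrite /c ge_min lexx.
have cT : c <= T - s by rewrite /c ge_min lexx orbT.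
pose m := Num.bound (T / c); pose delta := T / (2 ^ m)%:R.
have p0 : 0 < (2 ^ m)%:R :> R by rewrite ltr0n expn_gt0.
have d0 : 0 < delta by rewrite divr_gt0.
have dc : delta < c.
  rewrite /delta ltr_pdivrMr// mulrC -ltr_pdivrMr//.
  apply: lt_le_trans (archi_boundP _) _; first by rewrite divr_ge0// ltW.
  by rewrite ler_nat ltnW// ltn_expl.
have sd0 : 0 <= s / delta by rewrite divr_ge0// ltW.
exists m, (Num.truncn (s / delta)).+1; rewrite -/delta.
have /andP[h1 h2] := truncn_itv sd0.
have k1 : s < (Num.truncn (s / delta)).+1%:R * delta by rewrite -ltr_pdivrMr.
have k2 : (Num.truncn (s / delta)).+1%:R * delta <= s + delta.
  by rewrite -natr1 mulrDl mul1r lerD2r -ler_pdivlMr.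
split; last by rewrite k1/= (le_lt_trans k2)// ltrD2l (lt_le_trans dc).
rewrite -(ler_nat R) -(ler_pM2r d0); apply: (le_trans k2).
by rewrite /delta mulrCA mulfV ?gt_eqF// mulr1 -/delta; move: dc cT; lra.
Qed.

(** * The probability of an early exit *)

Section exit_probability.
Context (R : realType) (d : nat) (dO : measure_display)
  (Omega : measurableType dO).
Variable P : 'rV[R]_d -> probability Omega R.
Variable X : R -> Omega -> one_point_compactification 'rV[R]_d.
Hypothesis FP : feller_process P X.
Implicit Types (x y : 'rV[R]_d) (U V : set 'rV[R]_d).

(** A path outside U at a time s < T is outside V there. That is an open condition, so it persists
    just after s, hence at some dyadic fraction of T. *)
Lemma exit_time_ge_dyadic U V (T : R) w : compact V -> closed V -> V `<=` U -> 0 < T ->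
  (forall m : nat, stay X V (T / (2 ^ m)%:R) (2 ^ m) w) -> (T%:E <= exit_time X U w)%E.
Proof.
move=> cV clV VU T0 h; apply: le_ereal_inf_tmp => _ [s [s0 ns] <-].
rewrite lee_fin leNgt; apply/negP => sT.
have nV : ~ (Some @` V) (X s w) by move=> [y Vy yX]; apply: ns; exists y => //; exact: VU.
have rc : X q w @[q --> s^'+] --> X s w by exact: (mp_right_continuous (feller_markov FP)).
have := rc _ (one_point_compactification_nbhs_setC cV clV nV).
move=> /nbhs_ballP[rho /= rho0 hr].
have [m [k [km /andP[k1 k2]]]] := dyadic_point s0 sT rho0.
apply: (hr (k%:R * (T / (2 ^ m)%:R))) => //; last exact: (h m k km).
change (`|s - k%:R * (T / (2 ^ m)%:R)| < rho).
by rewrite distrC gtr0_norm ?subr_gt0// ltrBlDl.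
Qed.

Lemma stay_dyadic_nonincreasing V (T : R) m w : stay X V (T / (2 ^ m.+1)%:R) (2 ^ m.+1) w ->
  stay X V (T / (2 ^ m)%:R) (2 ^ m) w.
Proof.
move=> h i im; have := h (2 * i)%N; rewrite expnS leq_mul2l/= => /(_ im).
have p0 : (2 ^ m)%:R != 0 :> R by rewrite pnatr_eq0 -lt0n expn_gt0.
congr (event_in _ _ _ _); rewrite !natrM; field.
by rewrite p0.
Qed.

Variables (a : 'rV[R]_d -> 'M[R]_d) (b : 'rV[R]_d -> 'rV[R]_d).
Variable nu : R.-ker 'rV[R]_d ~> 'rV[R]_d.
Hypothesis psd : diffusion_matrix a.
Hypothesis levy_nu : levy_kernel nu.
Hypothesis dom : forall u, Cc_smooth u -> generator_domain P X u.
Hypothesis gen : forall u Au, Cc_smooth u -> is_generator P X u Au ->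
  forall x, (Au x)%:C%C = pseudo_diff (symbol a b nu) u x.

(* The exit event may not be measurable; [N] is the event that the process is outside
   [V = closed ball of radius r'] at some dyadic fraction of [t + eta], which by right-continuity
   happens if the process leaves the larger ball before time [t + eta]. *)
Lemma exit_time_ball_event x (r r' t eta e H : R) :
  0 < r' -> r' < r -> r < 1 -> 0 < t -> 0 < eta -> 0 < e -> 0 <= H ->
  (forall y, enorm (y - x) <= r -> (H_summand a b nu x r y <= H%:E)%E) ->
  exists N, [/\ measurable N, [set w | (exit_time X (eball x r) w <= t%:E)%E] `<=` N &
    (P x N <= ((t + eta) * (H + e) / (1 - expR (- (r' / r) ^+ 2)))%:E)%E].
Proof.
have lin (dl v w L : R) : - (dl * e) <= v - w - dl * L -> dl * - L <= dl * H ->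
    w - dl * (H + e) <= v by lra.
move=> r'0 r'r r1 t0 eta0 e0 H0 hH; have r0 : 0 < r by exact: lt_trans r'r.
pose V := [set y | sqdist x y <= r' ^+ 2]; pose T := t + eta.
have T0 : 0 < T by rewrite addr_gt0.
have VE y : V y <-> enorm (y - x) <= r'.
  by rewrite /V/= sqdistE ler_sqr ?nnegrE ?enorm_ge0 ?(ltW r'0).
have clV : closed V by exact: (@closed_sqdist_le _ _ x).
have cV : compact V by exact: (@compact_sqdist_le _ _ x).
have mV : measurable V by exact: closed_measurable_rV.
have VU : V `<=` eball x r by move=> y /VE h; exact: le_lt_trans r'r.
pose S m := stay X V (T / (2 ^ m)%:R) (2 ^ m).
have p0 m : 0 < (2 ^ m)%:R :> R by rewrite ltr0n expn_gt0.
have d0 m : 0 < T / (2 ^ m)%:R by rewrite divr_gt0.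
have mS m : measurable (S m) by apply: (measurable_stay FP) => //; exact: ltW.
(* The value of the Gaussian on the boundary of V, an upper bound for u outside V. It tends to
   e^(-1) as r' tends to r. *)
pose q := expR (- (r' / r) ^+ 2).
have q1 : 0 < 1 - q by rewrite subr_gt0 expR_lt1 oppr_lt0 exprn_gt0// divr_gt0.
pose C := T * (H + e) / (1 - q).
have su := Cc_smooth_exit_gauss x r0; set u := exit_gauss x r in su.
have u1 y : u y <= 1.
  apply: le_trans (exit_gauss_le_gauss x r y) _.
  rewrite /gauss -[leRHS]expR0 ler_expR mulNr oppr_le0 mulr_ge0//.
    by rewrite invr_ge0 exprn_ge0// ltW.
  by rewrite sqdistE exprn_ge0// enorm_ge0.
have u01 y : 0 <= u y <= 1 by rewrite exit_gauss_ge0 u1.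
have uq y : ~ V y -> u y <= q.
  move=> /VE/negP; rewrite -ltNge => yr'.
  apply: le_trans (exit_gauss_le_gauss x r y) _.
  rewrite /gauss ler_expR mulNr lerN2 expr_div_n mulrC ler_pM2l ?invr_gt0 ?exprn_gt0//.
  by rewrite sqdistE ler_sqr ?nnegrE ?enorm_ge0 ?(ltW r'0)// ltW.
have ux : u x = 1.
  rewrite /u exit_gaussE ?subrr ?enorm0 ?mulr_ge0 ?(ltW r0)//.
  by rewrite /gauss sqdistE subrr enorm0 expr0n mulr0 expR0.
have Vx : V x by apply/VE; rewrite subrr enorm0 ltW.
have [t1 t10 ht] := semigroup_generator FP levy_nu dom gen su e0.
have PS m : T / (2 ^ m)%:R < t1 -> (P x (~` S m) <= C%:E)%E.
  move=> dm; have [mT hT] := ht _ (introT andP (conj (d0 m) dm)).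
  have low y : V y -> u y - T / (2 ^ m)%:R * (H + e) <= semigroup P X (T / (2 ^ m)%:R) u y.
    move=> /VE Vy; have yr : enorm (y - x) <= r by exact: le_trans (ltW r'r).
    have := levy_operator_exit_gauss b psd levy_nu r0 r1 yr.
    rewrite -/u; set L := levy_operator _ _ _ _ _ => hL.
    (* The factor u(y) in front of H is dropped by u <= 1 and H >= 0. *)
    have : - L <= H.
      rewrite -lee_fin; apply: (le_trans hL).
      apply: (@le_trans _ _ ((u y)%:E * H%:E)%E).
        by apply: lee_wpmul2l; [rewrite lee_fin exit_gauss_ge0|exact: hH].
      by rewrite -EFinM lee_fin ler_piMl.
    move=> /(ler_wpM2l (ltW (d0 m))); have := hT y; rewrite -/L ler_norml => /andP[+ _].
    exact: lin.
  have He : 0 <= H + e by rewrite addr_ge0// ltW.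
  have := stay_probability_ge FP mV (ltW (d0 m)) (Cc_smooth_measurable su) mT u01 (2 ^ m)
    Vx ux (expR_ge0 _) He uq low.
  rewrite -/(S m) Rintegral_indic// -/q mulrA [_%:R * _]mulrCA mulfV ?gt_eqF// mulr1 => h.
  rewrite probability_setC// /C.
  have -> : P x (S m) = (fine (P x (S m)))%:E by rewrite fineK// fin_num_measure.
  by rewrite -EFinB lee_fin ler_pdivlMr// mulrC.
exists (\bigcup_m ~` S m); split.
- by apply: bigcup_measurable => m _; exact: measurableC.
- move=> w /= wt; apply: contrapT => /= nw.
  have h : (T%:E <= exit_time X (eball x r) w)%E.
    by apply: (exit_time_ge_dyadic cV clV VU T0) => m; apply: contrapT => hm; apply: nw; exists m.
  by have := le_trans h wt; rewrite lee_fin /T gerDl leNgt eta0.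
(* Dyadic grids are nested, so the complements increase and their probabilities converge to that of
   the union. The bound is needed only for fine meshes. *)
- have cv : P x \o (fun m => ~` S m) @ \oo --> P x (\bigcup_m ~` S m).
    apply: nondecreasing_cvg_mu.
    + by move=> m; exact: measurableC.
    + by apply: bigcup_measurable => m _; exact: measurableC.
    + apply/nondecreasing_seqP => m; apply/subsetPset; apply: subsetC => w.
      exact: stay_dyadic_nonincreasing.
  rewrite -(cvg_lim _ cv)//; apply: lime_le; first by apply/cvg_ex; exists (P x (\bigcup_m ~` S m)).
  near=> m; apply: PS; rewrite ltr_pdivrMr// mulrC -ltr_pdivrMr//.
  apply: lt_le_trans (archi_boundP _) _; first by rewrite divr_ge0// ltW.
  rewrite ler_nat; apply: leq_trans (ltnW (ltn_expl m (ltnSn 1))).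
  by near: m; exists (Num.bound (T / t1)).
Unshelve. all: by end_near. Qed.

End exit_probability.

(** * The estimates in terms of H and h *)

Section main_bounds.
Context (R : realType) (d : nat) (dO : measure_display)
  (Omega : measurableType dO).
Variable P : 'rV[R]_d -> probability Omega R.
Variable X : R -> Omega -> one_point_compactification 'rV[R]_d.
Variables (a : 'rV[R]_d -> 'M[R]_d) (b : 'rV[R]_d -> 'rV[R]_d).
Variable nu : R.-ker 'rV[R]_d ~> 'rV[R]_d.
Hypothesis FP : feller_process P X.
Hypothesis psd : diffusion_matrix a.
Hypothesis levy_nu : levy_kernel nu.
Hypothesis dom : forall u, Cc_smooth u -> generator_domain P X u.
Hypothesis gen : forall u Au, Cc_smooth u -> is_generator P X u Au ->
  forall x, (Au x)%:C%C = pseudo_diff (symbol a b nu) u x.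
Implicit Types (x y : 'rV[R]_d) (U V : set 'rV[R]_d).

Lemma H_summand_le x (r : R) y : enorm (y - x) <= r ->
  (H_summand a b nu x r y <= H_fun a b nu x r)%E.
Proof. by move=> yr; apply: ereal_sup_ubound; exists y. Qed.

(** At y = x the drift term vanishes, and what remains is nonnegative. *)
Lemma H_fun_ge0 x (r : R) : 0 < r -> (0 <= H_fun a b nu x r)%E.
Proof.
move=> r0; apply: (@le_trans _ _ (H_summand a b nu x r x)); last first.
  by apply: H_summand_le; rewrite subrr enorm0 ltW.
rewrite /H_summand; apply: adde_ge0; last exact: measure_ge0.
apply: adde_ge0.
  rewrite lee_fin subrr (_ : dot 0 _ = 0) ?addr0; last first.
    by rewrite /dot big1// => j _; rewrite mxE mul0r.
  rewrite !mulr_ge0 ?invr_ge0 ?exprn_ge0 ?(ltW r0)// sumr_ge0// => j _.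
  have [_ /(_ (delta_mx 0 j))] := psd x.
  by rewrite dot_delta -rowE !mxE.
apply: mule_ge0; first by rewrite lee_fin invr_ge0 exprn_ge0// ltW.
by apply: integral_ge0 => z _; rewrite lee_fin exprn_ge0// enorm_ge0.
Qed.

Lemma h_fun_ge0 x (r : R) : (0 <= h_fun nu x r)%E.
Proof. by apply: le_ereal_inf_tmp => _ [y _ <-]; exact: measure_ge0. Qed.

Lemma measurable_far (s : R) : measurable [set z : 'rV[R]_d | s <= enorm z].
Proof.
apply: (@measurable_enorm_set _ _ `[s, +oo[%classic) => // z.
by rewrite /= in_itv/= andbT.
Qed.

Lemma h_fun_fin x (r : R) : 0 < r -> h_fun nu x r = (fine (h_fun nu x r))%:E.
Proof.
move=> r0; rewrite fineK// ge0_fin_numE ?h_fun_ge0//.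
have r30 : 0 < 3 * r by rewrite mulr_gt0.
apply: (@le_lt_trans _ _ (nu x [set z | 3 * r <= enorm z])).
  by apply: ereal_inf_lbound; exists x => //=; rewrite subrr enorm0.
(* [levy_tail_fin] concerns strict tails, so the tail |z| >= 3r is enlarged to |z| > 3r/2. *)
apply: le_lt_trans (levy_tail_fin (levy_nu x).2 (divr_gt0 r30 (ltr0n R 2))).
apply: le_measure; rewrite ?inE.
- exact: measurable_far.
- apply: (@measurable_enorm_set _ _ `](3 * r / 2), +oo[%classic) => // z.
  by rewrite /= in_itv/= andbT.
- by move=> z /=; apply: lt_le_trans; lra.
Qed.

Lemma h_fun_le x (r : R) y : 0 < r -> enorm (y - x) < r ->
  ((fine (h_fun nu x r))%:E <= nu y [set z | 3 * r <= enorm z]%R)%E.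
Proof. by move=> r0 yr; rewrite -h_fun_fin//; apply: ereal_inf_lbound; exists y. Qed.

(** One parameter e controls the radius r' = (1 - e) r, the horizon t + e and the generator error.
    The bound for each e in (0, 1) is continuous at 0, where it takes the claimed value; H = +oo is
    treated apart. *)
Lemma exit_time_ball_le x (r t : R) : 0 < r < 1 -> 0 < t ->
  (completed_law P x [set w | exit_time X (eball x r) w <= t%:E]
     <= t%:E * H_fun a b nu x r / (1 - expR (- 1))%:E)%E.
Proof.
move=> /andP[r0 r1] t0; have H0 := H_fun_ge0 x r0.
have K0 : 0 < 1 - expR (- 1) :> R by rewrite subr_gt0 expR_lt1 oppr_lt0.
have := @H_summand_le x r; case: (H_fun _ _ _ _ _) H0 => [H| |] //; last first.
  by move=> _ _; rewrite mulry gtr0_sg// mul1e inver gt_eqF// mulyr gtr0_sg ?invr_gt0// mul1e leey.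
rewrite lee_fin => H0 hH; rewrite inver gt_eqF// -!EFinM.
pose f (e : R) := (t + e) * (H + e) / (1 - expR (- (1 - e) ^+ 2)).
have fP e : 0 < e < 1 ->
    (completed_law P x [set w | exit_time X (eball x r) w <= t%:E]%E <= (f e)%:E)%E.
  move=> /andP[e0 e1]; have r'0 : 0 < (1 - e) * r by rewrite mulr_gt0// subr_gt0.
  have r'r : (1 - e) * r < r by rewrite gtr_pMl// gtrBl.
  have [N [mN sN]] := exit_time_ball_event FP psd levy_nu dom gen r'0 r'r r1 t0 e0 e0 H0 hH.
  by rewrite mulfK ?gt_eqF// => /(le_trans (completed_law_le P x sN mN)).
have f0 : t * H / (1 - expR (- 1)) = f 0.
  by rewrite /f !addr0 subr0 expr1n.
have cf : f e @[e --> 0^'+] --> f 0.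
  have cD (c : R) : c + e @[e --> (0 : R)] --> c + 0.
    by apply: cvgD; [exact: cvg_cst|exact: cvg_id].
  have cB : 1 - e @[e --> (0 : R)] --> 1 - (0 : R).
    by apply: cvgB; [exact: cvg_cst|exact: cvg_id].
  have cE : 1 - expR (- (1 - e) ^+ 2) @[e --> (0 : R)] --> 1 - expR (- (1 - (0 : R)) ^+ 2).
    apply: cvgB; first exact: cvg_cst.
    apply: (@continuous_cvg _ _ _ _ _ _ (@expR R)); first exact: continuous_expR.
    by apply: cvgN; rewrite !expr2; apply: cvgM.
  apply: cvg_at_right_filter; apply: cvgM; first exact: cvgM.
  by apply: cvgV => //; rewrite subr0 expr1n gt_eqF.
rewrite f0; have cfE : (f e)%:E @[e --> 0^'+] --> (f 0)%:E by apply: cvg_EFin; [exact: nearW|exact: cf].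
rewrite -(cvg_lim _ cfE)//; apply: lime_ge; first by apply/cvg_ex; exists (f 0)%:E.
near=> e; apply: fP; apply/andP; split; first by near: e; exact: nbhs_right_gt.
by near: e; exact: nbhs_right_lt.
Unshelve. all: by end_near. Qed.

Lemma exit_time_ball_gt x (r t : R) : 0 < r -> 0 < t ->
  (completed_law P x [set w | t%:E < exit_time X (eball x r) w] <= 1 / (t%:E * h_fun nu x r))%E.
Proof.
move=> r0 t0; set m := fine (h_fun nu x r).
have m0 : 0 <= m by rewrite fine_ge0// h_fun_ge0.
have := exit_time_ball_tail FP levy_nu dom gen r0 t0 m0 (fun y => @h_fun_le x r y r0).
(* If h = 0 the inverse is +oo and the bound is trivial. *)
rewrite h_fun_fin// -/m -EFinM inver mul1e; case: eqP => [_ _|/eqP tm]; first exact: leey.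
have tm0 : 0 < t * m by rewrite lt_neqAle eq_sym tm mulr_ge0// ltW.
by move=> h; rewrite -[leRHS]mule1 lee_pdivlMl.
Qed.

(** The mean estimate at radius 2r asks for a lower bound on the tail |z| >= 6r over |y - x| < 2r.
    The infimum h(x, 3r) is one, taken over a larger ball and for the smaller tail |z| >= 9r; hence
    the constant 1. *)
Lemma expected_exit_time_ball_ub x (r : R) : 0 < r ->
  (\int[completed_law P x]_w exit_time X (eball x (2 * r)) w <= 1%:E / h_fun nu x (3 * r))%E.
Proof.
move=> r0; have r30 : 0 < 3 * r by rewrite mulr_gt0.
have r20 : 0 < 2 * r by rewrite mulr_gt0.
rewrite (h_fun_fin x r30); set m := fine _.
have m0 : 0 <= m by rewrite fine_ge0// h_fun_ge0.
rewrite inver mul1e; case: eqP => [_|/eqP mn]; first exact: leey.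
have {mn}m0 : 0 < m by rewrite lt_neqAle eq_sym mn m0.
apply: (expected_exit_time_ball_le FP levy_nu dom gen r20 m0) => y yr.
apply: (le_trans (@h_fun_le x (3 * r) y r30 _)); first by apply: lt_trans yr _; lra.
apply: le_measure; rewrite ?inE; [exact: measurable_far|exact: measurable_far|].
by move=> z /=; apply: le_trans; lra.
Qed.

(** Markov's inequality, with the event of exit by time t replaced by a measurable cover N. *)
Lemma expected_exit_time_ge x U (t : R) N : 0 <= t -> measurable N ->
  [set w | exit_time X U w <= t%:E]%E `<=` N ->
  (t%:E * P x (~` N) <= \int[completed_law P x]_w exit_time X U w)%E.
Proof.
move=> t0 mN sN; have mc := measurable_completed P x (measurableC mN).
have i0 (w : caratheodory_type (P x)^*%mu) :
    setT w -> (0 <= (\1_(~` N) w)%:E :> \bar R)%E by rewrite lee_fin indicE.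
have m1 : measurable_fun setT (fun w : caratheodory_type (P x)^*%mu => (\1_(~` N) w)%:E : \bar R).
  by apply/measurable_EFinP; exact: measurable_indic.
have <- : (\int[completed_law P x]_w (t%:E * (\1_(~` N) w)%:E) = t%:E * P x (~` N))%E.
  rewrite (ge0_integralZl _ measurableT m1 i0) ?lee_fin//.
  rewrite (integral_indic _ measurableT mc) setIT completed_lawE//.
  exact: measurableC.
apply: ge0_le_integralT => w; first by rewrite mule_ge0// lee_fin indicE.
rewrite indicE; case: (boolP (w \in _)) => [|_]; last by rewrite mule0; exact: exit_time_ge0.
rewrite inE mule1 leNgt => nN; apply/negP => h; apply: nN; apply: sN; exact: ltW.
Qed.

Lemma exit_time_mono U V w : U `<=` V -> (exit_time X U w <= exit_time X V w)%E.
Proof.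
move=> UV; apply: ereal_inf_le_tmp => _ [t [t0 nt] <-]; exists t => //; split => //.
by move=> [y Uy yX]; apply: nt; exists y => //; exact: UV.
Qed.

(** With r' = r/2 and eta = t, the exit probability from B(x,r) by time t is at most 2t (H + e) / K,
    where K = 1 - e^(-1/4). If this is at most 1/2, Markov's inequality bounds the mean below by
    t/2. Taking e = H and t = K/(8H) gives K/(16H), and the exit from B(x,2r) is no earlier. *)
Lemma expected_exit_time_ball_lb x (r : R) : 0 < r < 1 ->
  (((1 - expR (- (2^-1) ^+ 2)) / 16)%:E / H_fun a b nu x r
     <= \int[completed_law P x]_w exit_time X (eball x (2 * r)) w)%E.
Proof.
move=> /andP[r0 r1]; set K := 1 - _.
have K0 : 0 < K by rewrite subr_gt0 expR_lt1 oppr_lt0 exprn_gt0.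
have H0 := H_fun_ge0 x r0.
have I0 : (0 <= \int[completed_law P x]_w exit_time X (eball x (2 * r)) w)%E.
  by apply: integral_ge0 => w _; exact: exit_time_ge0.
have := @H_summand_le x r; case: (H_fun _ _ _ _ _) H0 => [H| |] //; last first.
  by move=> _ _; rewrite invey mule0.
rewrite lee_fin => H0 hH.
have lower t e : 0 < t -> 0 < e -> 4 * t * (H + e) <= K ->
    ((t / 2)%:E <= \int[completed_law P x]_w exit_time X (eball x (2 * r)) w)%E.
  move=> t0 e0 hK.
  have r'0 : 0 < r / 2 by rewrite divr_gt0.
  have r'r : r / 2 < r by rewrite gtr_pMr// invf_lt1// ltr1n.
  have [N [mN sN]] := exit_time_ball_event FP psd levy_nu dom gen r'0 r'r r1 t0 t0 e0 H0 hH.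
  rewrite (_ : r / 2 / r = 2^-1); last by rewrite mulrAC mulfV ?gt_eqF// mul1r.
  rewrite -/K => PN.
  have PN2 : (P x N <= (2^-1)%:E)%E.
    apply: (le_trans PN); rewrite lee_fin ler_pdivrMr//; move: hK; lra.
  apply: le_trans (@expected_exit_time_ge x _ t N (ltW t0) mN _); last first.
    move=> w /= wt; apply: sN; apply: le_trans wt; apply: exit_time_mono => y.
    by rewrite /eball/= => /lt_trans; apply; lra.
  move: PN2; rewrite probability_setC//.
  have -> : P x N = (fine (P x N))%:E by rewrite fineK// fin_num_measure.
  rewrite lee_fin -EFinB -EFinM lee_fin => PN2; rewrite ler_pM2l//; move: PN2; lra.
rewrite inver; case: eqP => [H00|/eqP Hn].
  rewrite mulry gtr0_sg ?divr_gt0// mul1e.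
  rewrite [X in (_ <= X)%E](_ : _ = +oo%E)//; apply/eqyP => A A0.
  (* For H = 0 the time 2A may be arbitrarily large, the error e being taken small enough that 4
     (2A) e = K; so the mean is infinite. *)
  have := lower (2 * A) (K / (8 * A)).
  rewrite (_ : 2 * A / 2 = A); last by field.
  apply; [by rewrite mulr_gt0|by rewrite divr_gt0 ?mulr_gt0|].
  by rewrite H00 add0r [leLHS](_ : _ = K)//; field; rewrite gt_eqF.
have {Hn}H0 : 0 < H by rewrite lt_neqAle eq_sym Hn.
rewrite -EFinM (_ : K / 16 / H = K / (8 * H) / 2); last by field; rewrite gt_eqF.
apply: (lower _ H) => //; first by rewrite divr_gt0 ?mulr_gt0.
by rewrite [leLHS](_ : _ = K)//; field; rewrite gt_eqF.
Qed.

End main_bounds.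

Theorem proposition3p7 (R : realType) :
  exists c1 c2 : R, [/\ 0 < c1, 0 < c2 &
  forall (d : nat) (dO : measure_display) (Omega : measurableType dO)
    (P : 'rV[R]_d -> probability Omega R)
    (X : R -> Omega -> one_point_compactification 'rV[R]_d)
    (a : 'rV[R]_d -> 'M[R]_d) (b : 'rV[R]_d -> 'rV[R]_d)
    (nu : R.-ker 'rV[R]_d ~> 'rV[R]_d),
  (0 < d)%N ->
  feller_process P X ->
  diffusion_matrix a ->
  levy_kernel nu ->
  locally_bounded (symbol a b nu) ->
  (forall u, Cc_smooth u -> generator_domain P X u) ->
  (forall u Au, Cc_smooth u -> is_generator P X u Au ->
     forall x, (Au x)%:C%C = pseudo_diff (symbol a b nu) u x) ->
  forall (x : 'rV[R]_d) (r : R), 0 < r < 1 ->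
  [/\ forall t : R, 0 < t ->
        (completed_law P x [set w | exit_time X (eball x r) w <= t%:E]
           <= t%:E * H_fun a b nu x r / (1 - expR (- 1))%:E)%E,
      forall t : R, 0 < t ->
        (completed_law P x [set w | t%:E < exit_time X (eball x r) w]
           <= 1 / (t%:E * h_fun nu x r))%E,
      (c1%:E / H_fun a b nu x r
         <= \int[completed_law P x]_w exit_time X (eball x (2 * r)) w)%E &
      (\int[completed_law P x]_w exit_time X (eball x (2 * r)) w
         <= c2%:E / h_fun nu x (3 * r))%E]].
Proof.
exists ((1 - expR (- (2^-1) ^+ 2)) / 16), 1; split; [|exact: ltr01|].
  by apply: divr_gt0 => //; rewrite subr_gt0 expR_lt1 oppr_lt0 exprn_gt0.
move=> d dO Omega P X a b nu _ FP psd levy_nu _ dom gen x r r01.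
have /andP[r0 r1] := r01; split.
- by move=> t t0; exact: (exit_time_ball_le FP psd levy_nu dom gen).
- by move=> t t0; exact: (exit_time_ball_gt FP levy_nu dom gen).
- exact: (expected_exit_time_ball_lb FP psd levy_nu dom gen).
- exact: (expected_exit_time_ball_ub FP levy_nu dom gen).
Qed.
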